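(* Let $1<p\le\infty$ and let $X$ be a separable Banach space not containing a copy of $\ell_1$. Then $X$ has property $(m_p)$ if and only if, given any $\varepsilon>0$, there is a quotient $X_0$ of $C_p$ such that $d(X,X_0)<1+\varepsilon$.
   Context: A separable Banach space $X$ has property $(m_p)$ if $\limsup_n\|x+x_n\|=\|(\|x\|,\limsup_n\|x_n\|)\|_p$ whenever $x\in X$ and $x_n\to0$ weakly in $X$, where $\|\cdot\|_p$ is the $\ell_p$-norm on $\mathbb{R}^2$. $d(X,Y)=\inf\|T\|\,\|T^{-1}\|$, over all surjective isomorphisms $T:X\to Y$, is the Banach–Mazur distance. Fix a sequence $(E_n)$ of finite-dimensional Banach spaces that is dense in the class of all finite-dimensional Banach spaces in the sense of Banach–Mazur distance (for every finite-dimensional $F$ and $\varepsilon>0$ there is $n$ with $d(E_n,F)<1+\varepsilon$). For $1\le p<\infty$, $C_p=\ell_p(E_n)$ is the $\ell_p$-direct sum of the $E_n$; $C_\infty=c_0(E_n)$ is their $c_0$-direct sum. (Different choices of $(E_n)$ give spaces at Banach–Mazur distance $1$.) A quotient means a quotient by a closed subspace. ''Not containing a copy of $\ell_1$'' means having no closed subspace isomorphic to $\ell_1$. *)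

(* Defs.v *)
From HB Require Import structures.
From mathcomp Require Import all_boot all_order all_algebra.
From mathcomp Require Import complex.
From mathcomp Require Import all_classical all_reals all_analysis.
From mathcomp Require Import ess_sup_inf.

Set Implicit Arguments.
Unset Strict Implicit.
Unset Printing Implicit Defensive.
Import Order.TTheory GRing.Theory Num.Theory.
Import numFieldNormedType.Exports.

Local Open Scope classical_set_scope.
Local Open Scope ring_scope.

(* Banach spaces are over R or over C = R[i]. *)
Inductive scalars := RealScalars | ComplexScalars.

Definition scalar_field (R : realType) (s : scalars) : numFieldType :=
  match s return numFieldType with
  | RealScalars => R
  | ComplexScalars => (R[i] : numFieldType)
  end.

Section scalar_field.
Context {R : realType} {s : scalars}.
Local Notation K := (scalar_field R s).

Definition of_real : R -> K :=
  match s return R -> scalar_field R s with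
  | RealScalars => fun r => r
  | ComplexScalars => fun r => (r%:C)%C
  end.

Definition re_part : K -> R :=
  match s return scalar_field R s -> R with
  | RealScalars => fun k => k
  | ComplexScalars => @complex.Re R
  end.

Lemma of_realK : cancel of_real re_part.
Proof. by rewrite /of_real /re_part; case: s. Qed.

Lemma of_real0 : of_real 0 = 0.
Proof. by rewrite /of_real; case: s. Qed.

Lemma of_real1 : of_real 1 = 1.
Proof. by rewrite /of_real; case: s. Qed.

Lemma of_realD x y : of_real (x + y) = of_real x + of_real y.
Proof. by rewrite /of_real; case: s => //=; exact: (rmorphD (real_complex R)). Qed.

Lemma of_realM x y : of_real (x * y) = of_real x * of_real y.
Proof. by rewrite /of_real; case: s => //=; exact: (rmorphM (real_complex R)). Qed.

Lemma ler_of_real x y : (of_real x <= of_real y) = (x <= y).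
Proof. by rewrite /of_real; case: s => //=; exact: lecR. Qed.

Lemma ltr_of_real x y : (of_real x < of_real y) = (x < y).
Proof. by rewrite /of_real; case: s => //=; exact: ltcR. Qed.

Lemma re_partK (k : K) : 0 <= k -> of_real (re_part k) = k.
Proof.
rewrite /of_real /re_part; move: k; case: s => //= -[a b].
by rewrite lecE /= => /andP[/eqP -> _].
Qed.

End scalar_field.

Section rnorm.
Context {R : realType} {s : scalars}.
Local Notation K := (scalar_field R s).

(* The library norm of a normed K-module takes its values in K. *)
Definition rnorm (V : normedZmodType K) (x : V) : R := re_part `|x|.

Lemma rnormE (V : normedZmodType K) (x : V) : of_real (rnorm x) = `|x|.
Proof. exact: re_partK. Qed.

Lemma rnorm_ge0 (V : normedZmodType K) (x : V) : 0 <= rnorm x.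
Proof. by rewrite -(@ler_of_real _ s) of_real0 rnormE. Qed.

Lemma rnorm0 (V : normedZmodType K) : rnorm (0 : V) = 0.
Proof. by apply: (can_inj (@of_realK R s)); rewrite rnormE of_real0 normr0. Qed.

Lemma rnorm_eq0 (V : normedZmodType K) (x : V) : rnorm x = 0 -> x = 0.
Proof.
by move=> x0; apply/eqP; rewrite -normr_eq0 -rnormE x0 of_real0.
Qed.

Lemma ler_rnormD (V : normedZmodType K) (x y : V) :
  rnorm (x + y) <= rnorm x + rnorm y.
Proof. by rewrite -(@ler_of_real _ s) of_realD !rnormE ler_normD. Qed.

Lemma rnormZ (V : normedModType K) (a : K) (x : V) :
  rnorm (a *: x) = re_part `|a| * rnorm x.
Proof.
apply: (can_inj (@of_realK R s)).
by rewrite of_realM (@re_partK _ _ `|a|)// !rnormE normrZ.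
Qed.

End rnorm.

Section operators.
Context {R : realType} {s : scalars}.
Local Notation K := (scalar_field R s).

Definition opnorm (V W : normedModType K) (T : V -> W) : R :=
  sup [set rnorm (T x) | x in [set x | rnorm x <= 1]].

Definition isomorphism_pair (V W : normedModType K)
    (T : {linear V -> W}) (S : {linear W -> V}) : Prop :=
  [/\ continuous T, continuous S, cancel T S & cancel S T].

Definition isomorphic (V W : normedModType K) : Prop :=
  exists (T : {linear V -> W}) (S : {linear W -> V}), isomorphism_pair T S.

(* +oo when V and W are not isomorphic. *)
Definition banach_mazur (V W : normedModType K) : \bar R :=
  ereal_inf [set d | exists (T : {linear V -> W}) (S : {linear W -> V}),
    isomorphism_pair T S /\ d = (opnorm T * opnorm S)%:E].

Definition finite_dimensional (V : normedModType K) : Prop :=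
  exists (n : nat) (v : 'I_n -> V),
    forall x, exists c : 'I_n -> K, x = \sum_i c i *: v i.

Definition separable (V : normedModType K) : Prop :=
  exists A : set V, countable A /\ dense A.

Definition weakly_null (V : normedModType K) (u : nat -> V) : Prop :=
  forall f : {linear V -> K^o}, continuous f -> f (u n) @[n --> \oo] --> (0 : K^o).

End operators.

Section subspaces.
Context {R : realType} {s : scalars}.
Local Notation K := (scalar_field R s).

Record closed_subspace (V : normedModType K) := ClosedSubspace {
  cs_pred : {pred V} ;
  cs_submod_closed : submod_closed cs_pred ;
  cs_closed : closed [set x | x \in cs_pred] }.

HB.instance Definition _ (V : normedModType K) (Z : closed_subspace V) :=
  GRing.isSubmodClosed.Build K V (cs_pred Z)
    (GRing.submod_closed_semi (cs_submod_closed Z)).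

Section subspace.
Variables (V : normedModType K) (Z : closed_subspace V).

Definition subspace_type := {x : V | x \in cs_pred Z}.

HB.instance Definition _ := [isSub of subspace_type for @sval V _].
HB.instance Definition _ := [Choice of subspace_type by <:].
HB.instance Definition _ := [SubChoice_isSubLmodule of subspace_type by <:].

Let subnorm (x : subspace_type) : K := `|val x|.

Let ler_subnormD x y : subnorm (x + y) <= subnorm x + subnorm y.
Proof. by rewrite /subnorm raddfD ler_normD. Qed.

Let subnormZ (l : K) x : subnorm (l *: x) = `|l| * subnorm x.
Proof. by rewrite /subnorm linearZ normrZ. Qed.

Let subnorm_eq0 x : subnorm x = 0 -> x = 0.
Proof. by move=> /eqP; rewrite normr_eq0 => /eqP x0; exact/val_inj. Qed.

HB.instance Definition _ :=
  Lmodule_isNormed.Build K subspace_type ler_subnormD subnormZ subnorm_eq0.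

Lemma rnorm_subspace (x : subspace_type) : rnorm x = rnorm (val x).
Proof. by []. Qed.

End subspace.
End subspaces.

Section quotient.
Context {R : realType} {s : scalars}.
Local Notation K := (scalar_field R s).
Variables (V : normedModType K) (Z : closed_subspace V).

Definition quotient_type := Quotient.quot (cs_pred Z).

HB.instance Definition _ := GRing.Zmodule.on quotient_type.

Definition quotient_map (x : V) : quotient_type := (\pi x)%qT.

Lemma quotient_map_eq (x y : V) :
  quotient_map x = quotient_map y <-> x - y \in cs_pred Z.
Proof.
rewrite /quotient_map; split=> [xy|xy].
  by rewrite Quotient.idealrBE; apply/eqP.
by apply/eqP; rewrite -Quotient.idealrBE.
Qed.

Lemma quotient_map_surj (q : quotient_type) : exists x, quotient_map x = q.
Proof. by exists (repr (q : Quotient.quot (cs_pred Z))); exact: reprK. Qed.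

Lemma quotient_mapD x y : quotient_map (x + y) = quotient_map x + quotient_map y.
Proof. exact: raddfD. Qed.

Let scaleq (a : K) (q : quotient_type) : quotient_type :=
  quotient_map (a *: repr (q : Quotient.quot (cs_pred Z))).

Let scaleqE a x : scaleq a (quotient_map x) = quotient_map (a *: x).
Proof.
apply/quotient_map_eq; rewrite -scalerBr rpredZ//; apply/quotient_map_eq.
exact: reprK.
Qed.

Let scaleqA a b q : scaleq a (scaleq b q) = scaleq (a * b) q.
Proof. by have [x <-] := quotient_map_surj q; rewrite !scaleqE scalerA. Qed.

Let scale1q : left_id 1 scaleq.
Proof.
by move=> q; have [x <-] := quotient_map_surj q; rewrite scaleqE scale1r.
Qed.

Let scaleqDr : right_distributive scaleq +%R.
Proof.
move=> a q1 q2.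
have [x <-] := quotient_map_surj q1; have [y <-] := quotient_map_surj q2.
by rewrite -quotient_mapD !scaleqE scalerDr quotient_mapD.
Qed.

Let scaleqDl q : {morph scaleq^~ q : a b / a + b}.
Proof.
move=> a b /=; have [x <-] := quotient_map_surj q.
by rewrite !scaleqE scalerDl quotient_mapD.
Qed.

HB.instance Definition _ := GRing.Zmodule_isLmodule.Build K quotient_type
  scaleqA scale1q scaleqDr scaleqDl.

Lemma quotient_mapZ a x : quotient_map (a *: x) = a *: quotient_map x.
Proof. by symmetry; exact: scaleqE. Qed.

Definition quotient_norm (q : quotient_type) : R :=
  inf [set rnorm x | x in [set x | quotient_map x = q]].

Let quotient_norm_has_inf q :
  has_inf [set rnorm x | x in [set x | quotient_map x = q]].
Proof.
split; first by have [x xq] := quotient_map_surj q; exists (rnorm x), x.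
by exists 0 => _ [x _ <-]; exact: rnorm_ge0.
Qed.

Let quotient_norm_le x : quotient_norm (quotient_map x) <= rnorm x.
Proof.
have [_ h] := quotient_norm_has_inf (quotient_map x).
by apply: (ge_inf h); exists x.
Qed.

Let quotient_norm_lt q e : 0 < e ->
  exists2 x, quotient_map x = q & rnorm x < quotient_norm q + e.
Proof.
move=> e0; have [_ [x xq <-] xe] := inf_adherent e0 (quotient_norm_has_inf q).
by exists x.
Qed.

Let qnorm (q : quotient_type) : K := of_real (quotient_norm q).

Let ler_qnormD q1 q2 : qnorm (q1 + q2) <= qnorm q1 + qnorm q2.
Proof.
rewrite /qnorm -of_realD ler_of_real; apply/ler_addgt0Pr => e e0.
have e2 : 0 < e / 2 by rewrite divr_gt0.
have [x <- xe] := quotient_norm_lt q1 e2.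
have [y <- ye] := quotient_norm_lt q2 e2.
rewrite -quotient_mapD (le_trans (quotient_norm_le _))//.
rewrite (le_trans (ler_rnormD _ _))// [e]splitr addrACA.
by rewrite ltW// ltrD.
Qed.

Let quotient_normZ_le a q :
  quotient_norm (a *: q) <= rnorm (a : K^o) * quotient_norm q.
Proof.
apply/ler_addgt0Pr => e e0.
have a1 : 0 < rnorm (a : K^o) + 1 by rewrite ltr_wpDl// rnorm_ge0.
have [x xq xe] := quotient_norm_lt q (divr_gt0 e0 a1).
rewrite -xq -quotient_mapZ (le_trans (quotient_norm_le _))// xq rnormZ.
rewrite (le_trans (ler_wpM2l (rnorm_ge0 (a : K^o)) (ltW xe)))// mulrDr lerD2l.
rewrite mulrCA ger_pMr// ler_pdivrMr// mul1r lerDl//.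
Qed.

Let qnormZ a q : qnorm (a *: q) = `|a| * qnorm q.
Proof.
rewrite /qnorm -(rnormE (a : K^o)) -of_realM; congr of_real.
apply/eqP; rewrite eq_le quotient_normZ_le/=.
have [->|a0] := eqVneq a 0.
  rewrite [rnorm _]rnorm0 mul0r; apply: lb_le_inf.
    by have [] := quotient_norm_has_inf (0 *: q).
  by move=> _ [x _ <-]; exact: rnorm_ge0.
have aV : rnorm (a : K^o) * rnorm (a^-1 : K^o) = 1.
  apply: (can_inj (@of_realK R s)).
  rewrite of_realM (rnormE (a : K^o)) (rnormE (a^-1 : K^o)) -normrM mulfV//.
  by rewrite normr1 of_real1.
have := quotient_normZ_le a^-1 (a *: q); rewrite scalerA mulVf// scale1r.
move=> /(ler_wpM2l (rnorm_ge0 (a : K^o))); rewrite mulrA aV mul1r; exact.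
Qed.

Let qnorm_eq0 q : qnorm q = 0 -> q = 0.
Proof.
rewrite /qnorm -(@of_real0 R s) => /(can_inj (@of_realK R s)) q0.
have [x xq] := quotient_map_surj q.
have xZ : x \in cs_pred Z.
  apply: (@cs_closed _ _ _ Z) => B /nbhs_normP[e /= e0 xeB].
  have re0 : 0 < re_part e.
    rewrite -(@ltr_of_real _ s) of_real0 re_partK// ltW//.
  have [y yq ye] := quotient_norm_lt q re0.
  exists (x - y); split => /=.
    by apply/quotient_map_eq; rewrite xq yq.
  apply: xeB => /=; rewrite opprB addrC subrK.
  by rewrite -rnormE -(re_partK (ltW e0)) ltr_of_real -[ltRHS]add0r -q0.
rewrite -xq -[RHS](raddf0 (\pi_(Quotient.quot (cs_pred Z)))%qT).
by apply/quotient_map_eq; rewrite subr0.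
Qed.

HB.instance Definition _ :=
  Lmodule_isNormed.Build K quotient_type ler_qnormD qnormZ qnorm_eq0.

Lemma rnorm_quotient (q : quotient_type) : rnorm q = quotient_norm q.
Proof. exact: of_realK. Qed.

End quotient.

Section counting.
Context {R : realType}.
Local Notation mu := (@counting nat R).
Implicit Types (p : \bar R) (c : R) (a b : nat -> R).

Let counting_gt0 : (0 < mu [set: nat])%E.
Proof.
rewrite /counting asboolF ?lt0y//; exact: infinite_nat.
Qed.

Let counting_ae (P : nat -> Prop) :
  (\forall n \near almost_everywhere mu, P n) -> forall n, P n.
Proof.
move=> [A [_ A0 PA]] n; apply: contrapT => Pn.
have {Pn}An : A n by exact: PA.
move: A0; rewrite [LHS]/counting; case: ifPn => [/asboolP finA|_] //.
move=> /eqP; rewrite eqe pnatr_eq0 finmap.cardfs_eq0 => /eqP /(fset_set_set0 finA) A0.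
by rewrite A0 in An.
Qed.

Lemma le_Lnorm_counting p a b : (1 <= p)%E ->
  (forall n, 0 <= a n <= b n) ->
  ('N[mu]_p[EFin \o a] <= 'N[mu]_p[EFin \o b])%E.
Proof.
move=> p1 ab; have ab' n : (`|(EFin \o a) n| <= `|(EFin \o b) n|)%E.
  have /andP[a0 leab] := ab n.
  by rewrite /= lee_fin !ger0_norm// (le_trans a0).
case: p p1 => [r|_|//]; last first.
  by rewrite unlock counting_gt0; apply: le_ess_sup; apply: nearW.
rewrite lee_fin => r1; have r0 : 0 < r by exact: lt_le_trans r1.
rewrite !Lnorm_counting//; apply: gt0_ler_poweR.
- by rewrite invr_ge0 ltW.
- by rewrite in_itv /= leey nneseries_ge0// => n _ _; rewrite poweR_ge0.
- by rewrite in_itv /= leey nneseries_ge0// => n _ _; rewrite poweR_ge0.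
apply: lee_nneseries => [n _ _|n _]; first exact: poweR_ge0.
apply: gt0_ler_poweR (ab' n); first exact: ltW.
  by rewrite in_itv /= leey lee_fin normr_ge0.
by rewrite in_itv /= leey lee_fin normr_ge0.
Qed.

Lemma Lnorm_countingZ p c a : (1 <= p)%E -> 0 <= c ->
  ('N[mu]_p[EFin \o (fun n => (c * a n)%R)] = c%:E * 'N[mu]_p[EFin \o a])%E.
Proof.
move=> p1 c0; have caE n :
    (`|(EFin \o (fun n => (c * a n)%R)) n| = c%:E * `|(EFin \o a) n|)%E.
  by rewrite /= normrM ger0_norm.
case: p p1 => [r|_|//]; last first.
  rewrite unlock counting_gt0 -ess_supZl//; congr ess_sup.
  by apply/funext => n; rewrite [LHS]caE.
rewrite lee_fin => r1; have r0 : 0 < r by exact: lt_le_trans r1.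
rewrite !Lnorm_counting//.
under eq_eseriesr => n _ do rewrite caE poweRM ?abse_ge0 ?lee_fin// poweR_EFin.
rewrite nneseriesZl; last by move=> n _; rewrite poweR_ge0.
rewrite poweRM ?lee_fin ?powR_ge0//; last first.
  by rewrite nneseries_ge0// => n _ _; rewrite poweR_ge0.
by rewrite poweR_EFin -powRrM mulfV ?gt_eqF// powRr1.
Qed.

Lemma Lnorm_counting_eq0 p a : (1 <= p)%E ->
  ('N[mu]_p[EFin \o a] = 0)%E -> forall n, a n = 0.
Proof.
move=> p1 a0 n; have p0 : (0 < p)%E by exact: lt_le_trans p1.
have [//|A [mA A0 aA]] := @Lnorm_eq0_eq0 _ _ R mu (EFin \o a) p _ p0 a0.
suff : (EFin \o a) n = 0%E by case.
move: n; apply: counting_ae; exists A; split => // n /= an.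
by apply: aA => /=; apply: contra_not an; exact.
Qed.

End counting.

Section lp_sum.
Context {R : realType} {s : scalars}.
Local Notation K := (scalar_field R s).
Variable E : nat -> normedModType K.

Definition dprod := forall n, E n.

Implicit Types (p : \bar R) (a : K) (f g : dprod).

HB.instance Definition _ := gen_eqMixin dprod.
HB.instance Definition _ := gen_choiceMixin dprod.

Let dzero : dprod := fun n => 0.
Let dopp (f : dprod) : dprod := fun n => - f n.
Let dadd (f g : dprod) : dprod := fun n => f n + g n.
Let dscale (a : K) (f : dprod) : dprod := fun n => a *: f n.

Let daddA : associative dadd.
Proof. by move=> f g h; apply: functional_extensionality_dep => n; exact: addrA. Qed.
Let daddC : commutative dadd.
Proof. by move=> f g; apply: functional_extensionality_dep => n; exact: addrC. Qed.
Let dadd0 : left_id dzero dadd.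
Proof. by move=> f; apply: functional_extensionality_dep => n; exact: add0r. Qed.
Let daddN : left_inverse dzero dopp dadd.
Proof. by move=> f; apply: functional_extensionality_dep => n; exact: addNr. Qed.

HB.instance Definition _ := GRing.isZmodule.Build dprod daddA daddC dadd0 daddN.

Let dscaleA a b f : dscale a (dscale b f) = dscale (a * b) f.
Proof. by apply: functional_extensionality_dep => n; exact: scalerA. Qed.
Let dscale1 : left_id 1 dscale.
Proof. by move=> f; apply: functional_extensionality_dep => n; exact: scale1r. Qed.
Let dscaleDr : right_distributive dscale +%R.
Proof. by move=> a f g; apply: functional_extensionality_dep => n; exact: scalerDr. Qed.
Let dscaleDl f : {morph dscale^~ f : a b / a + b}.
Proof. by move=> a b; apply: functional_extensionality_dep => n; exact: scalerDl. Qed.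

HB.instance Definition _ := GRing.Zmodule_isLmodule.Build K dprod
  dscaleA dscale1 dscaleDr dscaleDl.

Definition lp_norm (p : \bar R) (f : dprod) : \bar R :=
  'N[@counting nat R]_p[EFin \o (fun n => rnorm (f n))]%E.

(* For p = +oo the second conjunct makes this the c_0-sum; elsewhere it is void. *)
Definition in_lp_sum (p : \bar R) (f : dprod) : Prop :=
  (lp_norm p f < +oo)%E /\
  (p = +oo%E -> rnorm (f n) @[n --> \oo] --> (0 : R)).

Lemma lp_norm_fin p f : (lp_norm p f < +oo)%E ->
  (fine (lp_norm p f))%:E = lp_norm p f.
Proof. by move=> fp; rewrite fineK// ge0_fin_numE// Lnorm_ge0. Qed.

Lemma lp_normD p f g : (1 <= p)%E ->
  (lp_norm p (f + g)%R <= lp_norm p f + lp_norm p g)%E.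
Proof.
move=> p1; apply: le_trans (@eminkowski _ _ R (@counting nat R)
  (fun n => rnorm (f n)) (fun n => rnorm (g n)) p _ _ p1) => //.
apply: le_Lnorm_counting => // n; rewrite rnorm_ge0; exact: ler_rnormD.
Qed.

Lemma lp_normZ p a f : (1 <= p)%E ->
  lp_norm p (a *: f) = ((rnorm (a : K^o))%:E * lp_norm p f)%E.
Proof.
move=> p1; rewrite /lp_norm -Lnorm_countingZ//; last exact: rnorm_ge0.
by congr Lnorm; apply/funext => n; rewrite /= -rnormZ.
Qed.

Lemma lp_norm_eq0 p f : (1 <= p)%E -> lp_norm p f = 0%E -> f = 0.
Proof.
move=> p1 /(Lnorm_counting_eq0 p1) f0; apply: functional_extensionality_dep => n.
exact/rnorm_eq0/f0.
Qed.

Definition lp_pred p : {pred dprod} := [pred f | `[< in_lp_sum p f >]].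

Lemma lp_predP p f : reflect (in_lp_sum p f) (f \in lp_pred p).
Proof. exact: asboolP. Qed.

Lemma lp_submod_closed p : (1 <= p)%E -> submod_closed (lp_pred p).
Proof.
move=> p1; split.
  apply/lp_predP; split => [|_].
    rewrite -[X in lp_norm p X](scale0r (0 : dprod)) lp_normZ//.
    by rewrite [rnorm _]rnorm0 mul0e ltry.
  rewrite [X in X @ _ --> _](_ : _ = cst 0); first exact: cvg_cst.
  by apply/funext => n; exact: rnorm0.
move=> a f g /lp_predP[fp f0] /lp_predP[gp g0].
apply/lp_predP; split => [|py].
  rewrite (le_lt_trans (lp_normD _ _ p1))// lp_normZ// lte_add_pinfty//.
  by rewrite lte_mul_pinfty ?lee_fin ?rnorm_ge0.
have h : (fun n => rnorm (a : K^o) * rnorm (f n) + rnorm (g n)) @ \oo --> (0 : R).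
  rewrite -[X in _ --> X](addr0 (0 : R)) -[X in X + _](mulr0 (rnorm (a : K^o))).
  by apply: cvgD; [apply: cvgMr; exact: f0|exact: g0].
apply: (squeeze_cvgr _ (cvg_cst 0) h).
by apply: nearW => n; rewrite rnorm_ge0 -rnormZ; exact: ler_rnormD.
Qed.

Section lp_normed.
Variables (p : \bar R) (p1 : (1 <= p)%E).

(* The unused proof lets inference find the norm, a norm only when 1 <= p. *)
Definition lp_sum (_ : (1 <= p)%E) := {f : dprod | f \in lp_pred p}.

HB.instance Definition _ := [isSub of lp_sum p1 for @sval dprod _].
HB.instance Definition _ := [Choice of lp_sum p1 by <:].
HB.instance Definition _ := GRing.SubChoice_isSubLmodule.Build K dprod
  (lp_pred p) (lp_sum p1) (GRing.submod_closed_semi (lp_submod_closed p1)).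

Let lpn (f : lp_sum p1) : K := of_real (fine (lp_norm p (val f))).

Let lp_sum_lty (f : lp_sum p1) : (lp_norm p (val f) < +oo)%E.
Proof. by case: f => f /= /lp_predP[]. Qed.

Let ler_lpnD (f g : lp_sum p1) : lpn (f + g) <= lpn f + lpn g.
Proof.
rewrite /lpn -of_realD ler_of_real -lee_fin EFinD !lp_norm_fin//.
by rewrite raddfD; exact: lp_normD.
Qed.

Let lpnZ a (f : lp_sum p1) : lpn (a *: f) = `|a| * lpn f.
Proof.
rewrite /lpn -(rnormE (a : K^o)) -of_realM; congr of_real.
apply: EFin_inj; rewrite EFinM !lp_norm_fin// linearZ; exact: lp_normZ.
Qed.

Let lpn_eq0 (f : lp_sum p1) : lpn f = 0 -> f = 0.
Proof.
rewrite /lpn -(@of_real0 R s) => /(can_inj (@of_realK R s)) f0.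
apply: val_inj; apply: (lp_norm_eq0 p1).
by rewrite -lp_norm_fin// f0.
Qed.

HB.instance Definition _ :=
  Lmodule_isNormed.Build K (lp_sum p1) ler_lpnD lpnZ lpn_eq0.

Lemma rnorm_lp_sum (f : lp_sum p1) : rnorm f = fine (lp_norm p (val f)).
Proof. exact: of_realK. Qed.

End lp_normed.
End lp_sum.

Section properties.
Context {R : realType} {s : scalars}.
Local Notation K := (scalar_field R s).

Definition ell1 : normedModType K := lp_sum (fun _ : nat => K^o) (lexx (1%E : \bar R)).

Definition contains_copy (V W : normedModType K) : Prop :=
  exists Z : closed_subspace V, isomorphic (subspace_type Z) W.

Definition lp_norm2 (p : \bar R) (a b : R) : R :=
  if p is r%:E then (`|a| `^ r + `|b| `^ r) `^ r^-1
  else Num.max `|a| `|b|.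

(* In a Banach space weakly null sequences are bounded, so that the real-valued
   limn_sup is the usual limit superior. *)
Definition property_m (p : \bar R) (X : normedModType K) : Prop :=
  forall (x : X) (u : nat -> X), weakly_null u ->
    limn_sup (fun n => rnorm (x + u n)) =
    lp_norm2 p (rnorm x) (limn_sup (fun n => rnorm (u n))).

Definition banach_mazur_dense (E : nat -> completeNormedModType K) : Prop :=
  forall F : completeNormedModType K, finite_dimensional F ->
  forall e : R, 0 < e -> exists n, (banach_mazur (E n) F < (1 + e)%:E)%E.

End properties.

(* Main.v *)
(* Write lp for the l_p norm on R^2 and lps for the l_p norm of finite sequences.

   Quotients have (m_p): let Q map C_p onto X with |Q| <= 1 and lifts of norm
   at most 1 + e, and let u_n be weakly null. Norming functionals f_n of x + u_n
   (or of u_n) have a pointwise limit f along an ultrafilter. As p > 1, f o Q is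
   small on the tails of C_p; f_n o Q - f o Q is small on the bounded subsets of
   the initial segments, which are finite dimensional. So lifts of x and of u_n
   behave as if they lived on an initial segment and on a tail, respectively.

   Conversely let X have (m_p). As X contains no copy of l_1, Rosenthal's theorem
   makes every bounded sequence u_n weakly Cauchy along a subsequence, and then
   (m_p) yields a convex combination z of the u_n with lp |z| (lim |u_n - z|)
   at most 1 + e: averages along lattice paths whose steps are +- u_n compare the
   two numbers. This transfers (m_p) to the weak* null sequences of X*, with the
   dual of lp. Hence X* is separable, and one finds in X finite-dimensional
   blocks B_i, cut out by initial segments of dense sequences of X and X*, and
   a weight w such that w |sum g_i| <= C lps |g_i| for g_i in B_i while the sums
   w sum g_i, lps |g_i| <= 1, are C^5-norming for X*; this last point follows by
   averaging over the residues of i modulo a large N, since N^(1/p) / N -> 0.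
   Each B_i is almost a quotient of some E_n, with distinct n for distinct i, so
   that g |-> w sum g_i becomes a map from C_p whose image of the unit ball is
   almost dense in a ball of X, hence is onto by completeness of C_p. *)
From HB Require Import structures.
From mathcomp Require Import all_boot all_order all_algebra.
From mathcomp Require Import complex.
From mathcomp Require Import all_classical all_reals all_analysis.
From mathcomp Require Import ess_sup_inf.
From mathcomp Require Import ring lra zify.
Require Import Defs.

Set Implicit Arguments.
Unset Strict Implicit.
Unset Printing Implicit Defensive.
Import Order.TTheory GRing.Theory Num.Theory.
Import numFieldNormedType.Exports.

Local Open Scope classical_set_scope.
Local Open Scope ring_scope.

(** * The functions lp_norm2 p and their iterates *)

(** In the converse, vectors that norm functionals on X are only weakly Cauchy: their limit lives in
    the bidual, about which (m_p) says nothing. The convex combination z stands in X for this limit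
    and behaves as if (m_p) held at the limit itself; this is what makes the dual law computable. A
    sum of blocks separated by gaps norms only those functionals that vanish on the gaps. The N
    residue classes give N such decompositions, and the gaps of all classes together are still
    separated from each other. A functional of norm 1 therefore has total size of order N^(1/p) on
    the N families of gaps, hence N^(1/p) / N on average. The blocks of different classes overlap,
    and the triangle inequality over the N classes is what produces the weight w = N^(1/p) / N. The
    condition p > 1 acts through one inequality, [lp 1 1 < 2], that is 2^(1/p) < 2, which gives
    N^(1/p) / N -> 0. Hahn-Banach, duality and the blocks are treated on the underlying real space;
    the scalar field returns for copies of l_1, for the subspaces carried by the blocks and for the
    final operators. *)

Section lp2.
Context {R : realType}.
Variables (p : \bar R) (p1 : (1 <= p)%E).
Local Notation lp := (lp_norm2 p).

(* Opaque stand-ins for the powers [x `^ r] and [x `^ r^-1], whose unfolding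
   during unification is prohibitive. *)
Record power_pair (f g : R -> R) : Prop := {
  pp_f0 : f 0 = 0; pp_g1 : g 1 = 1;
  pp_f_ge0 : forall x, 0 <= f x; pp_g_ge0 : forall x, 0 <= g x;
  pp_fK : forall x, 0 <= x -> g (f x) = x;
  pp_gK : forall x, 0 <= x -> f (g x) = x;
  pp_f_le : forall x y, 0 <= x -> x <= y -> f x <= f y;
  pp_g_le : forall x y, 0 <= x -> x <= y -> g x <= g y;
  pp_fM : forall x y, 0 <= x -> 0 <= y -> f (x * y) = f x * f y;
  pp_gM : forall x y, 0 <= x -> 0 <= y -> g (x * y) = g x * g y;
  pp_convex : forall t x y, 0 <= t <= 1 -> 0 <= x -> 0 <= y ->
    f (t * x + (1 - t) * y) <= t * f x + (1 - t) * f y }.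

Let pow_pair r : 1 <= r -> power_pair (@powR R ^~ r) (@powR R ^~ r^-1).
Proof.
move=> r1; have r0 : 0 <= r by lra.
have ri : 0 <= r^-1 by rewrite invr_ge0.
have rn : r != 0 by lra.
split.
- exact: powR0.
- by rewrite powR1.
- by move=> x; exact: powR_ge0.
- by move=> x; exact: powR_ge0.
- by move=> x x0; rewrite -powRrM mulfV// powRr1.
- by move=> x x0; rewrite -powRrM mulVf// powRr1.
- by move=> x y x0 xy; apply: (ge0_ler_powR r0); rewrite // nnegrE (le_trans x0).
- by move=> x y x0 xy; apply: (ge0_ler_powR ri); rewrite // nnegrE (le_trans x0).
- by move=> x y x0 y0; exact: powRM.
- by move=> x y x0 y0; exact: powRM.
- move=> t x y /andP[t0 t1] x0 y0; have := @convex_powR R r r1 (Itv01 t0 t1) x y.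
  by rewrite !inE/= !in_itv/= x0 y0 => /(_ isT isT).
Qed.

Let pP : (exists f g, power_pair f g /\ lp = fun a b => g (f `|a| + f `|b|)) \/ p = +oo%E.
Proof.
move: p1; case: p => [r r1|_|]; [left|by right|by []].
exists (@powR R ^~ r), (@powR R ^~ r^-1); split; first exact: pow_pair.
by apply/funext => a; apply/funext => b.
Qed.

Lemma lp_ge0 (a b : R) : 0 <= lp a b.
Proof.
by case: pP => [[f [g [h ->]]]|->] /=; [exact: pp_g_ge0 h _|rewrite le_max normr_ge0].
Qed.

Lemma lpC (a b : R) : lp a b = lp b a.
Proof. by case: pP => [[f [g [h ->]]]|->] /=; [rewrite addrC|rewrite maxC]. Qed.

Lemma lp_abs (a b : R) : lp `|a| `|b| = lp a b.
Proof. by case: pP => [[f [g [h ->]]]|->] /=; rewrite !normr_id. Qed.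

Lemma lp0r (a : R) : lp a 0 = `|a|.
Proof.
case: pP => [[f [g [h ->]]]|->] /=; rewrite normr0.
  by rewrite (pp_f0 h) addr0 (pp_fK h).
by apply/max_idPl; exact: normr_ge0.
Qed.

Lemma lp0l (a : R) : lp 0 a = `|a|.
Proof. by rewrite lpC lp0r. Qed.

Lemma lpZ (c a b : R) : 0 <= c -> lp (c * a) (c * b) = c * lp a b.
Proof.
move=> c0; case: pP => [[f [g [h ->]]]|->] /=; rewrite !normrM (ger0_norm c0).
  by rewrite !(pp_fM h)// -mulrDr (pp_gM h) ?addr_ge0 ?(pp_f_ge0 h)// (pp_fK h).
by rewrite (maxr_pMr _ _ c0).
Qed.

Lemma lp_le (a b a' b' : R) : 0 <= a <= a' -> 0 <= b <= b' -> lp a b <= lp a' b'.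
Proof.
move=> /andP[a0 aa] /andP[b0 bb].
have a'0 := le_trans a0 aa; have b'0 := le_trans b0 bb.
case: pP => [[f [g [h ->]]]|->] /=;
  rewrite (ger0_norm a0) (ger0_norm b0) (ger0_norm a'0) (ger0_norm b'0).
  by apply: (pp_g_le h); rewrite ?addr_ge0 ?(pp_f_ge0 h)// lerD// (pp_f_le h).
by rewrite ge_max !le_max aa bb orbT.
Qed.

Lemma lp_lel (a b : R) : `|a| <= lp a b.
Proof. by rewrite -[leLHS]lp0r -lp_abs normr0 -(lp_abs a b); apply: lp_le; rewrite ?normr_ge0 ?lexx. Qed.

Lemma lp_ler (a b : R) : `|b| <= lp a b.
Proof. by rewrite lpC; exact: lp_lel. Qed.

Lemma lpA (a b c : R) : lp (lp a b) c = lp a (lp b c).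
Proof.
case: pP => [[f [g [h ->]]]|->] /=.
  by rewrite !(ger0_norm (pp_g_ge0 h _)) !(pp_gK h) ?addr_ge0 ?(pp_f_ge0 h)// addrA.
have M0 (x y : R) : 0 <= Num.max `|x| `|y| by rewrite le_max normr_ge0.
by rewrite !(ger0_norm (M0 _ _)) maxA.
Qed.

(** Convexity of the unit ball. For finite p it is the convexity of the power function, read through
    the equivalence of [g x <= 1] and [x <= 1]. *)
Let lp_convex (a b a' b' t : R) : 0 <= t <= 1 -> 0 <= a -> 0 <= b -> 0 <= a' -> 0 <= b' ->
  lp a b <= 1 -> lp a' b' <= 1 ->
  lp (t * a + (1 - t) * a') (t * b + (1 - t) * b') <= 1.
Proof.
move=> t01 a0 b0 a'0 b'0; have /andP[t0 t1] := t01; have t1' : 0 <= 1 - t by lra.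
have h1 : 0 <= t * a + (1 - t) * a' by rewrite addr_ge0 ?mulr_ge0.
have h2 : 0 <= t * b + (1 - t) * b' by rewrite addr_ge0 ?mulr_ge0.
case: pP => [[f [g [h ->]]]|->] /=; rewrite (ger0_norm a0) (ger0_norm b0)
  (ger0_norm a'0) (ger0_norm b'0) (ger0_norm h1) (ger0_norm h2); last first.
  rewrite !ge_max => /andP[u1 u2] /andP[u3 u4]; apply/andP; split.
    have := ler_wpM2l t0 u1; have := ler_wpM2l t1' u3; lra.
  have := ler_wpM2l t0 u2; have := ler_wpM2l t1' u4; lra.
have S0 x y : 0 <= f x + f y by rewrite addr_ge0 ?(pp_f_ge0 h).
have E x : 0 <= x -> (g x <= 1) = (x <= 1).
  move=> x0; apply/idP/idP => k; last by rewrite -(pp_g1 h) (pp_g_le h).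
  have := pp_f_le h (pp_g_ge0 h x) k.
  by rewrite (pp_gK h)// -[X in f X](pp_g1 h) (pp_gK h).
rewrite !E// => g1 g2.
have := pp_convex h t01 a0 a'0; have := pp_convex h t01 b0 b'0.
have := ler_wpM2l t0 g1; have := ler_wpM2l t1' g2; lra.
Qed.

Lemma lp_eq0 (a b : R) : lp a b = 0 -> a = 0 /\ b = 0.
Proof.
move=> h; split; apply/eqP; rewrite -normr_le0 -h; [exact: lp_lel|exact: lp_ler].
Qed.

(** Minkowski's inequality from the convexity of the unit ball: the two normalised pairs are
    averaged with weights proportional to their norms. *)
Lemma lpD (a b a' b' : R) : lp (a + a') (b + b') <= lp a b + lp a' b'.
Proof.
rewrite -(lp_abs (a + a')).
apply: (@le_trans _ _ (lp (`|a| + `|a'|) (`|b| + `|b'|))).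
  by apply: lp_le; rewrite normr_ge0 ler_normD.
rewrite -(lp_abs a b) -(lp_abs a' b').
move: (normr_ge0 a) (normr_ge0 b) (normr_ge0 a') (normr_ge0 b').
move: `|a| `|b| `|a'| `|b'| => {}a {}b {}a' {}b' a0 b0 a'0 b'0.
have [/lp_eq0[-> ->]|/eqP n1] := eqVneq (lp a b) 0; first by rewrite !add0r lerDr lp_ge0.
have [/lp_eq0[-> ->]|/eqP n2] := eqVneq (lp a' b') 0; first by rewrite !addr0 lerDl lp_ge0.
have g1 : 0 < lp a b by rewrite lt_neqAle lp_ge0 andbT eq_sym; apply/eqP.
have g2 : 0 < lp a' b' by rewrite lt_neqAle lp_ge0 andbT eq_sym; apply/eqP.
have i1 : 0 <= (lp a b)^-1 by rewrite invr_ge0 ltW.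
have i2 : 0 <= (lp a' b')^-1 by rewrite invr_ge0 ltW.
have AB : 0 < lp a b + lp a' b' by lra.
have t01 : 0 <= lp a b / (lp a b + lp a' b') <= 1.
  by rewrite divr_ge0 ?ler_pdivrMr ?(ltW g1) ?(ltW AB)//= mul1r lerDl (ltW g2).
have l1 : lp ((lp a b)^-1 * a) ((lp a b)^-1 * b) <= 1 by rewrite lpZ// mulVf// gt_eqF.
have l2 : lp ((lp a' b')^-1 * a') ((lp a' b')^-1 * b') <= 1 by rewrite lpZ// mulVf// gt_eqF.
have := lp_convex t01 (mulr_ge0 i1 a0) (mulr_ge0 i1 b0) (mulr_ge0 i2 a'0) (mulr_ge0 i2 b'0) l1 l2.
have E (x y : R) : lp a b / (lp a b + lp a' b') * ((lp a b)^-1 * x) +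
    (1 - lp a b / (lp a b + lp a' b')) * ((lp a' b')^-1 * y) = (lp a b + lp a' b')^-1 * (x + y).
  by move: (lp a b) (lp a' b') g1 g2 AB => A B g1 g2 AB; field; rewrite !gt_eqF.
have iAB : 0 <= (lp a b + lp a' b')^-1 by rewrite invr_ge0 ltW.
by rewrite !E lpZ// -ler_pdivlMl ?invr_gt0// invrK mulr1.
Qed.

Lemma lp_leD (a b : R) : lp a b <= `|a| + `|b|.
Proof. by rewrite -{1}(addr0 a) -{1}(add0r b) (le_trans (lpD _ _ _ _))// lp0r lp0l. Qed.

Lemma lp_lip (a b a' b' : R) : `|lp a b - lp a' b'| <= `|a - a'| + `|b - b'|.
Proof.
rewrite ler_norml; apply/andP; split.
  rewrite lerNl opprB lerBlDl.
  have := lpD a b (a' - a) (b' - b); rewrite !subrKC => /le_trans; apply.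
  by rewrite lerD2l (le_trans (lp_leD _ _))// (distrC a) (distrC b).
rewrite lerBlDl.
have := lpD a' b' (a - a') (b - b'); rewrite !subrKC => /le_trans; apply.
by rewrite lerD2l lp_leD.
Qed.

(** The source of every strict gain below: for finite p the left side is 2^(1/p), for p = +oo it is
    1. *)
Lemma lp11_lt2 : (1 < p)%E -> lp 1 1 < 2.
Proof.
move=> p1s; have [->|[r r1 ->]] : p = +oo%E \/ exists2 r, 1 < r & p = r%:E.
- by move: p1s; case: p => [r r1|_|]; [right; exists r|left|].
- by rewrite /= normr1 maxxx ltr1n.
rewrite /= normr1 !powR1 (_ : 1 + 1 = 2 :> R)// -[ltRHS](@powRr1 _ 2)//.
have ri1 : r^-1 < 1 by rewrite invf_lt1 ?ltr1n//; lra.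
by rewrite /powR gt_eqF// ltr_expR ltr_pM2r// ln_gt0// ltr1n.
Qed.

Lemma lp11_ge0 : 0 <= lp 1 1. Proof. exact: lp_ge0. Qed.

(** The l_p norm of the first L entries, built by iterating [lp], so that finite p and p = +oo are
    treated alike in the estimates on blocks. *)
Fixpoint lps (L : nat) (a : nat -> R) : R := 
  if L is L'.+1 then lp (lps L' a) (a L') else 0.

Lemma lps_ge0 L a : 0 <= lps L a.
Proof. by case: L => [|L] //=; exact: lp_ge0. Qed.

Lemma lps_le L a b : (forall i, (i < L)%N -> 0 <= a i <= b i) -> lps L a <= lps L b.
Proof.
elim: L => [//|L IH] ab /=; apply: lp_le; last exact: ab.
by rewrite lps_ge0/= IH// => i iL; apply: ab; rewrite ltnS ltnW.
Qed.

Lemma eq_lps L a b : (forall i, (i < L)%N -> a i = b i) -> lps L a = lps L b.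
Proof.
elim: L => [//|L IH] ab /=; rewrite ab// IH// => i iL.
by apply: ab; rewrite ltnS ltnW.
Qed.

Lemma lpsZ L c a : 0 <= c -> lps L (fun i => c * a i) = c * lps L a.
Proof. by move=> c0; elim: L => [|L IH] /=; rewrite ?mulr0// IH lpZ. Qed.

Lemma lpsD L a b : lps L (fun i => a i + b i) <= lps L a + lps L b.
Proof.
elim: L => [|L IH] /=; first by rewrite addr0.
apply: le_trans (lpD _ _ _ _).
by rewrite -lp_abs -[leRHS]lp_abs; apply: lp_le; rewrite ?normr_ge0 ?lexx// !ger0_norm ?addr_ge0 ?lps_ge0.
Qed.

Lemma lps_widen L M a : (L <= M)%N -> (forall i, (L <= i < M)%N -> a i = 0) -> lps M a = lps L a.
Proof.
move=> LM; elim: M LM => [|M IH]; first by rewrite leqn0 => /eqP ->.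
rewrite leq_eqVlt => /predU1P[->//|]; rewrite ltnS => LM a0 /=.
rewrite a0 ?LM ?ltnSn// lp0r ger0_norm ?lps_ge0// IH// => i /andP[? ?].
by apply: a0; apply/andP; split => //; rewrite ltnS ltnW.
Qed.

Lemma lps_mono L M a : (L <= M)%N -> lps L a <= lps M a.
Proof.
move=> LM; rewrite -(subnKC LM); elim: (M - L)%N => [|k IH]; first by rewrite addn0.
rewrite addnS /=; apply: le_trans IH _; rewrite -[leLHS]ger0_norm ?lps_ge0//.
exact: lp_lel.
Qed.

Lemma lps_coord L a i : (i < L)%N -> `|a i| <= lps L a.
Proof. by move=> iL; apply: le_trans (lps_mono a iL) => /=; exact: lp_ler. Qed.

Lemma lps_cat L M a : lps (L + M) a = lp (lps L a) (lps M (fun i => a (L + i)%N)).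
Proof.
elim: M => [|M IH]; first by rewrite addn0 /= lp0r ger0_norm ?lps_ge0.
by rewrite addnS /= IH lpA.
Qed.


(** For N > 0 this is N^(1/p), and 1 when p = +oo. *)
Definition kappa N := lps N (fun=> 1).

Lemma kappa_double N : kappa (N + N) = kappa N * lp 1 1.
Proof. by rewrite /kappa lps_cat -lpZ ?lps_ge0// mulr1. Qed.

Lemma kappa_gt0 N : (0 < N)%N -> 0 < kappa N.
Proof.
move=> N0; apply: lt_le_trans (@lps_coord N (fun=> 1) 0%N N0).
by rewrite normr1.
Qed.

Lemma kappa_pow2 k : kappa (2 ^ k) = lp 1 1 ^+ k.
Proof.
elim: k => [|k IH]; first by rewrite /kappa /= lp0l normr1 expr0.
by rewrite expnS mul2n -addnn kappa_double IH exprSr.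
Qed.

(** Along the powers of two the ratio of [kappa] to its argument is geometric, of ratio
    [lp 1 1 / 2 < 1]. *)
Lemma kappa_small (e : R) : (1 < p)%E -> 0 < e ->
  exists k, kappa (2 ^ k) <= e * (2 ^ k)%:R.
Proof.
move=> p1s e0; have g0 : `|lp 1 1 / 2| < 1.
  by rewrite ger0_norm ?divr_ge0 ?lp_ge0// ltr_pdivrMr// mul1r lp11_lt2.
have /cvgrPdist_le/(_ _ e0)[k _ /(_ k (leqnn _))] := cvg_expr g0.
rewrite sub0r normrN ger0_norm ?exprn_ge0 ?divr_ge0 ?lp_ge0//= => h.
exists k; rewrite kappa_pow2 natrX -ler_pdivrMr ?exprn_gt0//.
by rewrite -expr_div_n.
Qed.

(** The pairs (a, b) and (b, a) have the same norm and their sum is (a + b) times (1, 1). *)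
Lemma lp_mean (a b : R) : 0 <= a -> 0 <= b -> (a + b) * lp 1 1 <= 2 * lp a b.
Proof.
move=> a0 b0; rewrite -lpZ ?addr_ge0// mulr1 mulr_natl mulr2n {2}(lpC a).
by rewrite {2}(addrC a); exact: lpD.
Qed.

(** Hoelder's inequality against the constant sequence 1, by halving the index set; the conjugate
    exponent never appears. *)
Lemma sum_kappa_le k (b : nat -> R) : (forall i, 0 <= b i) ->
  (\sum_(i < 2 ^ k) b i) * kappa (2 ^ k) <= (2 ^ k)%:R * lps (2 ^ k) b.
Proof.
elim: k b => [|k IH] b b0.
  by rewrite expn0 big_ord1 /kappa /= !lp0l normr1 ger0_norm// mulr1 mul1r.
rewrite expnS mul2n -addnn kappa_double big_split_ord /= lps_cat natrD.
set N := (2 ^ k)%N in IH *.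
have h1 := IH b b0; have h2 := IH (fun i => b (N + i)%N) (fun i => b0 _).
have h := lp_mean (lps_ge0 N b) (lps_ge0 N (fun i => b (N + i)%N)).
have := ler_wpM2r lp11_ge0 h1; have := ler_wpM2r lp11_ge0 h2.
have := ler_wpM2l (ler0n R N) h; lra.
Qed.

(** An entry absorbs a new term in place whatever its position. This is the step that lets [lps] be
    regrouped by residue classes. *)
Lemma lps_update N (b b' : nat -> R) j x : (j < N)%N ->
  b' j = lp (b j) x -> (forall i, i != j -> b' i = b i) ->
  lps N b' = lp (lps N b) x.
Proof.
elim: N => [//|N IH]; rewrite ltnS leq_eqVlt => /predU1P[->|jN] bj bi /=.
  by rewrite bj (@eq_lps N b' b) ?lpA// => i iN; apply: bi; rewrite ltn_eqF.
by rewrite IH// bi ?gtn_eqF// !lpA (lpC x).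
Qed.

Lemma lps_classes L N (g : nat -> R) : (0 < N)%N -> lps L g =
  lps N (fun j => lps L (fun i => if (i %% N == j)%N then g i else 0)).
Proof.
move=> N0; elim: L => [|L IH] /=.
  by elim: N {N0} => [//|N IH] /=; rewrite -IH lp0r normr0.
rewrite IH; symmetry; apply: (@lps_update _ _ _ (L %% N)%N); first exact: ltn_pmod.
  by rewrite eqxx.
by move=> i /negbTE; rewrite eq_sym => ->; rewrite lp0r ger0_norm ?lps_ge0.
Qed.

Definition lpd_set (al be : R) := [set al * st.1 + be * st.2 | st in
  [set st : R * R | [/\ 0 <= st.1, 0 <= st.2 & lp st.1 st.2 <= 1]]].

(** The dual norm of [lp] for nonnegative arguments; the supremum spares a case distinction on the
    conjugate exponent. *)
Definition lpd (al be : R) := sup (lpd_set al be).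

Let lp_le1 (s t : R) : 0 <= s -> 0 <= t -> lp s t <= 1 -> s <= 1 /\ t <= 1.
Proof.
move=> s0 t0 st; split.
  by rewrite -(ger0_norm s0) (le_trans (lp_lel s t)).
by rewrite -(ger0_norm t0) (le_trans (lp_ler s t)).
Qed.

Let lpd_has (al be : R) : 0 <= al -> 0 <= be -> has_sup (lpd_set al be).
Proof.
move=> a0 b0; split.
  by exists (al * 0 + be * 0), (0, 0) => //=; rewrite lp0r normr0 ler01 lexx.
exists (al + be) => _ [[s t]/= [s0 t0 st] <-].
have [s1 t1] := lp_le1 s0 t0 st.
by have := ler_wpM2l a0 s1; have := ler_wpM2l b0 t1; lra.
Qed.

Lemma lpd_ub1 (al be s t : R) : 0 <= al -> 0 <= be -> 0 <= s -> 0 <= t -> lp s t <= 1 ->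
  al * s + be * t <= lpd al be.
Proof. by move=> ? ? ? ? ?; apply: ub_le_sup; [exact: (lpd_has _ _).2|exists (s, t)]. Qed.

Lemma lpd_ub (al be s t : R) : 0 <= al -> 0 <= be -> 0 <= s -> 0 <= t ->
  al * s + be * t <= lpd al be * lp s t.
Proof.
move=> a0 b0 s0 t0.
have [/lp_eq0[-> ->]|n0] := eqVneq (lp s t) 0; first by rewrite lp0r normr0; lra.
have g : 0 < lp s t by rewrite lt_neqAle eq_sym n0 lp_ge0.
have i0 : 0 <= (lp s t)^-1 by rewrite invr_ge0 ltW.
have := @lpd_ub1 al be ((lp s t)^-1 * s) ((lp s t)^-1 * t) a0 b0.
rewrite !mulr_ge0// lpZ// mulVf// => /(_ isT isT (lexx _)).
by rewrite !(mulrCA _ (lp s t)^-1) -mulrDr ler_pdivrMl// [lpd al be * _]mulrC.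
Qed.

Lemma lpd_adh (al be e : R) : 0 <= al -> 0 <= be -> 0 < e -> exists s t,
  [/\ 0 <= s, 0 <= t, lp s t <= 1 & lpd al be - e < al * s + be * t].
Proof.
move=> a0 b0 e0; have [_ [[s t]/= [s0 t0 st] <-] h] := sup_adherent e0 (lpd_has a0 b0).
by exists s, t.
Qed.

Lemma lpd_least (al be M : R) : (forall s t, 0 <= s -> 0 <= t -> lp s t <= 1 -> al * s + be * t <= M) ->
  lpd al be <= M.
Proof.
move=> h; apply: ge_sup.
  by exists (al * 0 + be * 0), (0, 0) => //=; rewrite lp0r normr0 ler01 lexx.
by move=> _ [[s t]/= [s0 t0 st] <-]; exact: h.
Qed.

Lemma lpd_lel (al be : R) : 0 <= al -> 0 <= be -> al <= lpd al be.
Proof.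
move=> a0 b0; have := @lpd_ub al be 1 0 a0 b0 ler01 (lexx _).
by rewrite lp0r normr1 !mulr1 mulr0 addr0.
Qed.

Lemma lpd_ler (al be : R) : 0 <= al -> 0 <= be -> be <= lpd al be.
Proof.
move=> a0 b0; have := @lpd_ub al be 0 1 a0 b0 (lexx _) ler01.
by rewrite lp0l normr1 !mulr1 mulr0 add0r.
Qed.

Lemma lpd_ge0 (al be : R) : 0 <= al -> 0 <= be -> 0 <= lpd al be.
Proof. by move=> a0 b0; apply: le_trans (lpd_lel a0 b0). Qed.

Lemma lpd_leD (al be : R) : 0 <= al -> 0 <= be -> lpd al be <= al + be.
Proof.
move=> a0 b0; apply: lpd_least => s t s0 t0 /(lp_le1 s0 t0)[s1 t1].
by have := ler_wpM2l a0 s1; have := ler_wpM2l b0 t1; lra.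
Qed.

Lemma lpd0l (be : R) : 0 <= be -> lpd 0 be = be.
Proof.
move=> b0; apply/eqP; rewrite eq_le lpd_ler// andbT.
by have := lpd_leD (lexx 0) b0; rewrite add0r.
Qed.

Lemma lpdZ (c al be : R) : 0 <= al -> 0 <= be -> 0 <= c -> lpd (c * al) (c * be) = c * lpd al be.
Proof.
move=> a0 b0; rewrite le_eqVlt => /predU1P[<-|c0].
  by rewrite !mul0r lpd0l.
apply/eqP; rewrite eq_le; apply/andP; split.
  apply: lpd_least => s t s0 t0 st; rewrite -!mulrA -mulrDr ler_pM2l//.
  exact: lpd_ub1.
rewrite -ler_pdivlMl//; apply: lpd_least => s t s0 t0 st.
rewrite ler_pdivlMl// mulrDr !mulrA; apply: lpd_ub1 => //; rewrite mulr_ge0// ltW//.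
Qed.

Lemma lpd_lip (al be al' be' : R) : 0 <= al -> 0 <= be -> 0 <= al' -> 0 <= be' ->
  lpd al be <= lpd al' be' + `|al - al'| + `|be - be'|.
Proof.
move=> a0 b0 a'0 b'0; apply: lpd_least => s t s0 t0 st.
have [s1 t1] := lp_le1 s0 t0 st.
have := lpd_ub1 a'0 b'0 s0 t0 st.
have := ler_wpM2r s0 (ler_norm (al - al')); have := ler_wpM2r t0 (ler_norm (be - be')).
have := ler_wpM2l (normr_ge0 (al - al')) s1; have := ler_wpM2l (normr_ge0 (be - be')) t1.
lra.
Qed.

End lp2.

(** * Extraction of subsequences and limits along an ultrafilter *)

Section extraction.
Context {R : realType}.

Lemma extraction (P : nat -> nat -> Prop) :
  (forall k N, exists2 n, (N <= n)%N & P k n) ->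
  exists2 phi : nat -> nat, {homo phi : m n / (m < n)%N} & forall k, P k (phi k).
Proof.
move=> H; have /choice[f Hf] : forall kN : nat * nat, exists n, (kN.2 <= n)%N /\ P kN.1 n.
  by move=> [k N]; have [n ? ?] := H k N; exists n.
pose phi := fix phi k := if k is k'.+1 then f (k, (phi k').+1) else f (0%N, 0%N).
exists phi; last by case=> [|k] /=; [exact: (Hf (0, 0)%N).2|exact: (Hf (k.+1, _)).2].
apply: homo_ltn; first exact: ltn_trans.
by move=> k /=; exact: (Hf (k.+1, _)).1.
Qed.

Lemma homo_leq_id (phi : nat -> nat) : {homo phi : m n / (m < n)%N} -> forall n, (n <= phi n)%N.
Proof. by move=> h; elim=> [//|n IH]; apply: leq_ltn_trans IH _; exact: h. Qed.

Lemma cvg_subseq (T : topologicalType) (u : nat -> T) (phi : nat -> nat) (l : T) :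
  {homo phi : m n / (m < n)%N} -> u n @[n --> \oo] --> l -> u (phi n) @[n --> \oo] --> l.
Proof.
move=> h ul; apply: (cvg_comp phi u _ ul).
move=> A [N _ NA]; exists N => // n /= Nn; apply: NA => /=.
exact: leq_trans Nn (homo_leq_id h n).
Qed.

Lemma cvgn_distP (u : nat -> R) l : u @ \oo --> l <->
  forall e, 0 < e -> exists N, forall n, (N <= n)%N -> `|u n - l| <= e.
Proof.
split=> [/cvgrPdist_le h e /h[N _ HN]|h].
  by exists N => n Nn; rewrite distrC; exact: HN.
apply/cvgrPdist_le => e /h[N HN]; exists N => // n Nn.
by rewrite distrC; exact: HN.
Qed.

End extraction.

Section ulim.
Context {R : realType}.

(** One fixed ultrafilter refining the filter at infinity: all bounded real sequences converge along
    it, so that iterated limits and pointwise limits of functionals exist without passing to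
    subsequences. *)
Definition ultra : set_system nat :=
  projT1 (cid (ultraFilterLemma (@eventually_filter))).

Lemma ultra_ultra : UltraFilter ultra.
Proof. by rewrite /ultra; case: cid => ? []. Qed.

#[global] Instance ultra_proper' : ProperFilter ultra.
Proof. by case: ultra_ultra. Qed.

Lemma ultra_oo : \oo `<=` ultra.
Proof. by rewrite /ultra; case: cid => ? []. Qed.

Lemma cvg_ultra (T : topologicalType) (u : nat -> T) (l : T) : u @ \oo --> l -> u @ ultra --> l.
Proof. by move=> h A /h hA; exact: ultra_oo. Qed.

Definition ulim (u : nat -> R) : R := lim (u @ ultra).

Lemma ulim_cvg (u : nat -> R) (M : R) : (forall n, `|u n| <= M) -> u @ ultra --> ulim u.
Proof.
move=> uM; have cK := @segment_compact R (- M) M.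
have UF := ultra_ultra.
have UF' : UltraFilter (u @ ultra).
  split; first exact: fmap_proper_filter.
  move=> G GF uG; apply/seteqP; split=> [A GA|]; last exact: uG.
  have [//|nA] := in_ultra_setVsetC (u @^-1` A) UF.
  have : G (~` A) by exact: uG.
  by move=> /(filterI GA); rewrite setICr => G0; case: (@filter_not_empty _ G GF G0).
have : cvg (u @ ultra).
  move: cK; rewrite compact_ultra => /(_ (u @ ultra) UF')[].
    by apply: (@filterE _ ultra) => n; rewrite /= in_itv /= -ler_norml; exact: uM.
  by move=> l [_ ul]; apply/cvg_ex; exists l.
by [].
Qed.

Lemma ulimP (u : nat -> R) l : u @ ultra --> l -> ulim u = l.
Proof. by move=> h; apply/cvg_lim. Qed.

Lemma ultra_freq (P : set nat) N : ultra P -> exists2 n, (N <= n)%N & P n.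
Proof.
move=> UP; have UN : ultra [set n | (N <= n)%N] by apply: ultra_oo; exists N.
by have [n [Pn Nn]] := filter_ex (filterI UP UN); exists n.
Qed.

Lemma cvg_ultra_dist (u : nat -> R) l e : 0 < e -> u @ ultra --> l ->
  ultra [set n | `|u n - l| <= e].
Proof.
by move=> e0 /cvgrPdist_le/(_ _ e0); apply: filterS => n /=; rewrite distrC.
Qed.

Lemma bounded_subseq_cvg (u : nat -> R) (M : R) : (forall n, `|u n| <= M) ->
  exists2 phi : nat -> nat, {homo phi : m n / (m < n)%N} &
   exists l : R, u (phi n) @[n --> \oo] --> l.
Proof.
move=> /ulim_cvg ul.
have [k N|phi h Hphi] := @extraction (fun k n => `|u n - ulim u| <= k.+1%:R^-1).
  have k0 : 0 < k.+1%:R^-1 :> R by rewrite invr_gt0.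
  by have [n ? ?] := ultra_freq N (cvg_ultra_dist k0 ul); exists n.
exists phi => //; exists (ulim u); apply/cvgrPdist_le => e e0.
near=> n; rewrite distrC; apply: (le_trans (Hphi n)).
near: n; have /cvgrPdist_le/(_ _ e0) := @cvg_harmonic R.
by apply: filterS => n /=; rewrite sub0r normrN ger0_norm.
Unshelve. all: by end_near. Qed.

End ulim.

(** * Real functionals *)

Section hahn_banach.
Context {R : realType} {V : lmodType R}.
Variable q : V -> R.
Hypothesis qD : forall x y, q (x + y) <= q x + q y.
Hypothesis qZ : forall t x, 0 <= t -> q (t *: x) = t * q x.

(* A functional is represented by its graph, which domination makes functional. *)
Definition dominated_graph (G : set (V * R)) :=
  (forall t u v, G u -> G v -> G (t *: u.1 + v.1, t * u.2 + v.2)) /\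
  (forall u, G u -> u.2 <= q u.1).

Let q0 : q 0 = 0. Proof. by rewrite -(scale0r 0) qZ// mul0r. Qed.

Let graph_fun G x r r' : dominated_graph G -> G (x, r) -> G (x, r') -> r = r'.
Proof.
move=> [Gl Gd].
have H a b : G (x, a) -> G (x, b) -> b <= a.
  move=> Ga Gb; have := Gd _ (Gl (-1) _ _ Ga Gb) => /=.
  by rewrite scaleN1r addNr q0 mulN1r addrC subr_le0.
by move=> h1 h2; apply/eqP; rewrite eq_le !H.
Qed.

Let graph0 G u : dominated_graph G -> G u -> G (0, 0).
Proof. by move=> [Gl _] Gu; have := Gl (-1) _ _ Gu Gu; rewrite scaleN1r mulN1r !addNr. Qed.

Let graphZ G u t : dominated_graph G -> G u -> G (t *: u.1, t * u.2).
Proof. by move=> dG Gu; have := dG.1 t _ _ Gu (graph0 dG Gu); rewrite /= !addr0. Qed.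

(** Extension by one dimension: every value at x0 between the lower and the upper bounds is
    admissible, and the supremum of the lower ones is taken. *)
Let graph_extend G x0 : dominated_graph G -> G !=set0 ->
  exists2 c, True & dominated_graph
   [set u | exists t v, G v /\ u = (v.1 + t *: x0, v.2 + t * c)].
Proof.
move=> dG [g0 Gg0]; have [Gl Gd] := dG.
pose A := [set v.2 - q (v.1 - x0) | v in G].
have AB v w : G v -> G w -> v.2 - q (v.1 - x0) <= q (w.1 + x0) - w.2.
  move=> Gv Gw; rewrite lerBlDr addrAC lerBrDr -[v.2]mul1r.
  have := Gd _ (Gl 1 _ _ Gv Gw) => /= /le_trans; apply.
  rewrite (_ : 1 *: v.1 + w.1 = w.1 + x0 + (v.1 - x0))//.
  by rewrite scale1r [RHS]addrACA subrr addr0 addrC.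
have Asup : has_sup A.
  split; first by exists (g0.2 - q (g0.1 - x0)), g0.
  by exists (q (g0.1 + x0) - g0.2) => _ [v Gv <-]; exact: AB.
pose c := sup A.
have c1 v : G v -> v.2 - c <= q (v.1 - x0).
  move=> Gv; rewrite lerBlDr -lerBlDl; apply: ub_le_sup; first exact: Asup.2.
  by exists v.
have c2 v : G v -> v.2 + c <= q (v.1 + x0).
  move=> Gv; rewrite addrC -lerBrDr; apply: ge_sup; first exact: Asup.1.
  by move=> _ [w Gw <-]; exact: AB.
exists c => //; split.
  move=> t _ _ [a [v [Gv ->]]] [b [w [Gw ->]]] /=.
  exists (t * a + b), (t *: v.1 + w.1, t * v.2 + w.2); split; first exact: Gl.
  by rewrite /= !scalerDr scalerDl !scalerA addrACA; congr pair; ring.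
move=> _ [t [v [Gv ->]]] /=.
have [t0|t0|->] := ltgtP t 0; last by rewrite scale0r mul0r !addr0; exact: Gd.
- have n0 : 0 < - t by rewrite oppr_gt0.
  have := c1 _ (graphZ (- t)^-1 dG Gv) => /=.
  rewrite -(ler_pM2l n0) -qZ ?(ltW n0)// scalerBr scalerA mulfV ?gt_eqF// scale1r.
  by rewrite mulrBr mulrA mulfV ?gt_eqF// mul1r mulNr opprK scaleNr opprK.
- have := c2 _ (graphZ t^-1 dG Gv) => /=.
  rewrite -(ler_pM2l t0) -qZ ?(ltW t0)// scalerDr scalerA mulfV ?gt_eqF// scale1r.
  by rewrite mulrDr mulrA mulfV ?gt_eqF// mul1r.
Qed.

Theorem hahn_banach (G0 : set (V * R)) : dominated_graph G0 -> G0 !=set0 ->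
  exists f : V -> R, [/\ (forall t x y, f (t *: x + y) = t * f x + f y),
    (forall x, f x <= q x) & (forall u, G0 u -> f u.1 = u.2)].
Proof.
move=> dG0 [g0 Gg0].
(* The members of [P] are parts to be added to [G0]; in this form the empty chain, whose union is
   empty, causes no exception. *)
pose P := [set G : set (V * R) | dominated_graph (G0 `|` G)].
have [F FP Ftot|G [PG Gmax]] := @Zorn_bigcup _ P.
  split=> [t u v Hu Hv|u [|[X FX Xu]]]; last 2 first.
  - exact: dG0.2.
  - by apply: (FP _ FX).2; right.
  case: Hu => [Gu|[X FX Xu]]; case: Hv => [Gv|[Y FY Yv]].
  - by left; exact: dG0.1.
  - by case: ((FP _ FY).1 t u v (or_introl Gu) (or_intror Yv)); [left|right; exists Y].
  - by case: ((FP _ FX).1 t u v (or_intror Xu) (or_introl Gv)); [left|right; exists X].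
  have [XY|YX] := Ftot _ _ FX FY.
    by case: ((FP _ FY).1 t u v (or_intror (XY _ Xu)) (or_intror Yv)); [left|right; exists Y].
  by case: ((FP _ FX).1 t u v (or_intror Xu) (or_intror (YX _ Yv))); [left|right; exists X].
set H := G0 `|` G in PG.
have Hg0 : H g0 by left.
have Htot x : exists r, H (x, r).
  apply: contrapT => nH.
  have [|c _ dE] := graph_extend x PG; first by exists g0.
  set E := (X in dominated_graph X) in dE.
  have HE : H `<=` E by move=> [y r] Hy; exists 0, (y, r); rewrite scale0r mul0r !addr0.
  apply: (Gmax E).
    rewrite properEneq; split; last by move=> u Gu; apply: HE; right.
    apply/eqP => GE; apply: nH; exists c; right; rewrite GE.
    exists 1, (0, 0); split; first exact: graph0 Hg0.
    by rewrite scale1r mul1r !add0r.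
  by rewrite /P/= (_ : G0 `|` E = E)//; apply/setUidPr => u Gu; apply: HE; left.
have [f Hf] := choice Htot; exists f; split.
- move=> t x y; apply: (graph_fun PG (Hf _)).
  exact: (PG.1 t _ _ (Hf x) (Hf y)).
- by move=> x; exact: (PG.2 _ (Hf x)).
- by move=> [x r] Gx; apply: (graph_fun PG (Hf _)); left.
Qed.

End hahn_banach.

Section dual.
Context {R : realType}.

Definition dual_pred (V : normedModType R) : {pred V -> R^o} :=
  [pred f : V -> R^o | `[< (forall t x y, f (t *: x + y) = t * f x + f y) /\
    exists C, forall x, `|f x| <= C * `|x| >]].
Arguments dual_pred : clear implicits.

Lemma dual_submod_closed V : submod_closed (dual_pred V).
Proof.
split.
  apply/asboolP; split=> [t x y|]; first by rewrite /= mulr0 addr0.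
  by exists 0 => x; rewrite normr0 mul0r.
move=> a f g /asboolP[fl [C fC]] /asboolP[gl [D gD]]; apply/asboolP; split.
  move=> t x y; rewrite !fctE/= fl gl /GRing.scale/=; ring.
exists (`|a| * C + D) => x; rewrite fctE (le_trans (ler_normD _ _))// mulrDl.
apply: lerD => //; rewrite fctE [`|_|]normrM -mulrA.
exact: ler_wpM2l.
Qed.

HB.instance Definition _ (V : normedModType R) := GRing.isSubmodClosed.Build R (V -> R^o) (dual_pred V)
  (GRing.submod_closed_semi (dual_submod_closed V)).

Variable V : normedModType R.

Definition dual := {f : V -> R^o | f \in dual_pred V}.
HB.instance Definition _ := [isSub of dual for @sval (V -> R^o) _].
HB.instance Definition _ := [Choice of dual by <:].
HB.instance Definition _ := [SubChoice_isSubLmodule of dual by <:].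

Definition dapp (f : dual) (x : V) : R := val f x.
Coercion dapp : dual >-> Funclass.
Implicit Types (f g : dual) (x y : V).

Lemma dapp_linear f t x y : f (t *: x + y) = t * f x + f y.
Proof. by have /asboolP[h _] := valP f; exact: h. Qed.
Lemma dappD f x y : f (x + y) = f x + f y.
Proof. by have := dapp_linear f 1 x y; rewrite scale1r mul1r. Qed.
Lemma dapp0 f : f 0 = 0.
Proof. by apply: (addrI (f 0)); rewrite -dappD !addr0. Qed.
Lemma dappZ f t x : f (t *: x) = t * f x.
Proof. by have := dapp_linear f t x 0; rewrite dapp0 !addr0. Qed.
Lemma dappN f x : f (- x) = - f x.
Proof. by rewrite -scaleN1r dappZ mulN1r. Qed.
Lemma dappB f x y : f (x - y) = f x - f y.
Proof. by rewrite dappD dappN. Qed.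
Lemma dapp_sum f (I : Type) (r : seq I) (P : pred I) (F : I -> V) :
  f (\sum_(i <- r | P i) F i) = \sum_(i <- r | P i) f (F i).
Proof. by apply: (big_morph _ (dappD f) (dapp0 f)). Qed.
Lemma dualD f g x : dapp (f + g) x = f x + g x. Proof. by []. Qed.
Lemma dualN f x : dapp (- f) x = - f x. Proof. by []. Qed.
Lemma dualB f g x : dapp (f - g) x = f x - g x. Proof. by []. Qed.
Lemma dualZ t f x : dapp (t *: f) x = t * f x. Proof. by []. Qed.
Lemma dual0 x : dapp 0 x = 0. Proof. by []. Qed.
Lemma dual_sum (I : Type) (r : seq I) (P : pred I) (F : I -> dual) x :
  dapp (\sum_(i <- r | P i) F i) x = \sum_(i <- r | P i) F i x.
Proof. by apply: (big_morph (fun f : dual => f x) (fun f g => dualD f g x) (dual0 x)). Qed.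
Lemma dualP f g : (forall x, f x = g x) -> f = g.
Proof. by move=> fg; apply/val_inj/funext. Qed.

Let dset f := [set `|f x| | x in [set x : V | `|x| <= 1]].
Let dn f := sup (dset f).

Let dset_has f : has_sup (dset f).
Proof.
split; first by exists `|f 0|, 0 => //=; rewrite normr0 ler01.
have /asboolP[_ [C fC]] := valP f; exists `|C| => _ [x /= x1 <-].
apply: (le_trans (fC x)); apply: (le_trans (ler_norm _)).
by rewrite normrM normr_id ler_piMr.
Qed.

Let dn_ub1 f x : `|x| <= 1 -> `|f x| <= dn f.
Proof. by move=> x1; apply: ub_le_sup; [exact: (dset_has f).2|exists x]. Qed.

Let dn_ub f x : `|f x| <= dn f * `|x|.
Proof.
have [->|x0] := eqVneq x 0; first by rewrite dapp0 !normr0 mulr0.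
have n0 : 0 < `|x| by rewrite normr_gt0.
rewrite -ler_pdivrMr// mulrC -(@gtr0_norm _ `|x|^-1) ?invr_gt0// -normrM -dappZ.
by apply: dn_ub1; rewrite normrZ gtr0_norm ?invr_gt0// mulVf ?gt_eqF.
Qed.

Let dn_least f C : 0 <= C -> (forall x, `|f x| <= C * `|x|) -> dn f <= C.
Proof.
move=> C0 fC; apply: ge_sup; first exact: (dset_has f).1.
move=> _ [x /= x1 <-]; apply: (le_trans (fC x)); exact: ler_piMr.
Qed.

Let dn_ge0 f : 0 <= dn f.
Proof. by apply: le_trans (normr_ge0 (f 0)) (dn_ub1 f _); rewrite normr0 ler01. Qed.

Let dnD f g : dn (f + g) <= dn f + dn g.
Proof.
apply: dn_least; first by rewrite addr_ge0.
by move=> x; rewrite dualD mulrDl (le_trans (ler_normD _ _))// lerD.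
Qed.

Let dnZ_le a f : dn (a *: f) <= `|a| * dn f.
Proof.
apply: dn_least; first by rewrite mulr_ge0.
by move=> x; rewrite dualZ normrM -mulrA ler_wpM2l.
Qed.

Let dnZ a f : dn (a *: f) = `|a| * dn f.
Proof.
apply/eqP; rewrite eq_le dnZ_le/=.
have [->|a0] := eqVneq a 0; first by rewrite normr0 mul0r.
rewrite -ler_pdivlMl ?normr_gt0// -normfV; apply: le_trans (dnZ_le _ _).
by rewrite scalerA mulVf// scale1r.
Qed.

Let dn_eq0 f : dn f = 0 -> f = 0.
Proof.
by move=> f0; apply: dualP => x; apply/eqP; rewrite -normr_le0 (le_trans (dn_ub f x))// f0 mul0r.
Qed.

HB.instance Definition _ := Lmodule_isNormed.Build R dual dnD dnZ dn_eq0.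

Lemma dual_ub f x : `|f x| <= `|f| * `|x|. Proof. exact: dn_ub. Qed.

Lemma dual_le f x : f x <= `|f| * `|x|.
Proof. exact: le_trans (ler_norm _) (dual_ub f x). Qed.

Lemma dual_least f C : 0 <= C -> (forall x, `|f x| <= C * `|x|) -> `|f| <= C.
Proof. exact: dn_least. Qed.

Lemma dual_adh f e : 0 < e -> exists2 x, `|x| <= 1 & `|f| - e < f x.
Proof.
move=> e0; have [_ [x /= x1 <-] h] := sup_adherent e0 (dset_has f).
have [f0|f0] := leP 0 (f x); first by exists x => //; rewrite -(ger0_norm f0).
by exists (- x); rewrite ?normrN// dappN -(ltr0_norm f0).
Qed.

(** A one-sided bound is enough, because linearity turns its instance at -x into the opposite
    bound. *)
Lemma dual_make (g : V -> R) C : (forall t x y, g (t *: x + y) = t * g x + g y) ->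
  0 <= C -> (forall x, g x <= C * `|x|) -> exists f : dual, (forall x, f x = g x) /\ `|f| <= C.
Proof.
move=> gl C0 gC; have g0 : g 0 = 0.
  by have := gl 1 0 0; rewrite scaler0 addr0 mul1r => /eqP; rewrite -subr_eq subrr => /eqP <-.
have gN x : g (- x) = - g x.
  by have := gl (-1) x 0; rewrite scaleN1r addr0 g0 addr0 mulN1r.
have gC' x : `|g x| <= C * `|x|.
  by rewrite ler_norml gC andbT lerNl -gN (le_trans (gC _))// normrN.
have gP : (g : V -> R^o) \in dual_pred V by apply/asboolP; split => //; exists C.
exists (exist _ (g : V -> R^o) gP); split => //; exact: dual_least.
Qed.

Lemma dual_extend (P : set V) (f : dual) C : 0 <= C -> P 0 ->
  (forall t x y, P x -> P y -> P (t *: x + y)) -> (forall x, P x -> f x <= C * `|x|) ->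
  exists g : dual, (forall x, P x -> g x = f x) /\ `|g| <= C.
Proof.
move=> C0 P0 Pl fC.
have qD (x y : V) : C * `|x + y| <= C * `|x| + C * `|y| by rewrite -mulrDr ler_wpM2l ?ler_normD.
have qZ t (x : V) : 0 <= t -> C * `|t *: x| = t * (C * `|x|).
  by move=> t0; rewrite normrZ ger0_norm// mulrCA.
have [||g [gl gq gP]] := @hahn_banach R V (fun x => C * `|x|) qD qZ [set u | P u.1 /\ u.2 = f u.1].
- split=> [t u v [Pu ->] [Pv ->]|u [Pu ->]] /=; last exact: fC.
  by split; [exact: Pl|rewrite dapp_linear].
- by exists (0, 0); split => //=; rewrite dapp0.
have [g' [g'E g'C]] := dual_make gl C0 gq; exists g'; split => // x Px.
by rewrite g'E; apply: (gP (x, f x)).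
Qed.

Lemma dual_norming x : exists f : dual, `|f| <= 1 /\ f x = `|x|.
Proof.
have qD (u v : V) : `|u + v| <= `|u| + `|v| by exact: ler_normD.
have qZ t (u : V) : 0 <= t -> `|t *: u| = t * `|u| by move=> t0; rewrite normrZ ger0_norm.
have [||g [gl gq gP]] := @hahn_banach R V _ qD qZ [set u | exists t, u = (t *: x, t * `|x|)].
- split=> [t u v [a ->] [b ->]|u [a ->]] /=.
    by exists (t * a + b); rewrite scalerA -scalerDl mulrA -mulrDl.
  by rewrite normrZ ler_wpM2r// ler_norm.
- by exists (0, 0), 0; rewrite scale0r mul0r.
have [|g' [g'E g'C]] := dual_make gl ler01 _; first by move=> y; rewrite mul1r.
by exists g'; split => //; rewrite g'E; apply: (gP (x, `|x|)); exists 1; rewrite scale1r mul1r.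
Qed.

(** Weak* compactness of balls in the form used here: the pointwise limit along the ultrafilter
    inherits linearity and the bound. *)
Lemma dual_ulim (u : nat -> dual) (M : R) : (forall n, `|u n| <= M) ->
  exists f : dual, (forall x, u n x @[n --> ultra] --> f x) /\ `|f| <= M.
Proof.
move=> uM; have M0 : 0 <= M by apply: le_trans (uM 0%N).
have bd x n : `|u n x| <= M * `|x| by rewrite (le_trans (dual_ub _ _))// ler_wpM2r.
have cv x := ulim_cvg (bd x).
have [|x|f [fE fM]] := @dual_make (fun x => ulim (fun n => u n x)) M _ M0 _.
- move=> t x y; apply: ulimP; under eq_fun do rewrite dapp_linear.
  by apply: cvgD => //; apply: cvgMr; exact: cv.
- apply: limr_le; first exact: cvgP (cv x).
  by apply: nearW => n; apply: le_trans (ler_norm _) (bd x n).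
by exists f; split => // x; rewrite fE.
Qed.

End dual.

(** * Finite-dimensional spans and annihilators *)

Section span.
Context {R : realType} {V : normedModType R}.
Variable v : nat -> V.

Definition span n : set V := [set x | exists c : nat -> R, x = \sum_(i < n) c i *: v i].

Lemma span_lin n t x y : span n x -> span n y -> span n (t *: x + y).
Proof.
move=> [c ->] [d ->]; exists (fun i => t * c i + d i).
rewrite scaler_sumr -big_split /=; apply: eq_bigr => i _.
by rewrite scalerDl scalerA.
Qed.

Lemma span0 n : span n 0.
Proof. by exists (fun=> 0); rewrite big1// => i _; rewrite scale0r. Qed.

Lemma spanD n x y : span n x -> span n y -> span n (x + y).
Proof. by move=> hx hy; rewrite -(scale1r x); exact: span_lin. Qed.

Lemma spanZ n t x : span n x -> span n (t *: x).
Proof. by move=> hx; rewrite -(addr0 (_ *: _)); apply: span_lin => //; exact: span0. Qed.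

Lemma spanN n x : span n x -> span n (- x).
Proof. by rewrite -scaleN1r; exact: spanZ. Qed.

Lemma spanB n x y : span n x -> span n y -> span n (x - y).
Proof. by move=> hx /spanN; exact: spanD. Qed.

Lemma span_sum n (I : Type) (r : seq I) (P : pred I) (F : I -> V) :
  (forall i, P i -> span n (F i)) -> span n (\sum_(i <- r | P i) F i).
Proof. by move=> h; apply: big_ind => //; [exact: span0|exact: spanD]. Qed.

Lemma span_gen n i : (i < n)%N -> span n (v i).
Proof.
move=> i_n; exists (fun j => (j == i)%:R); rewrite (bigD1 (Ordinal i_n))//= eqxx scale1r.
rewrite big1 ?addr0// => j; rewrite -val_eqE /= => /negbTE ->.
by rewrite scale0r.
Qed.

Lemma span_mono m n : (m <= n)%N -> span m `<=` span n.
Proof.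
move=> mn _ [c ->]; apply: span_sum => i _; apply: spanZ; apply: span_gen.
exact: leq_trans mn.
Qed.

Lemma span_subseq n (u : nat -> V) (M : R) :
  (forall k, span n (u k)) -> (forall k, `|u k| <= M) ->
  exists2 phi : nat -> nat, {homo phi : m n / (m < n)%N} &
    exists2 l, span n l & u (phi k) @[k --> \oo] --> l.
Proof.
elim: n u M => [|n IH] u M us uM.
  exists id => //; exists 0; first exact: span0.
  rewrite (_ : u = cst 0); first exact: cvg_cst.
  by apply/funext => k; have [c ->] := us k; rewrite big_ord0.
have /choice[cc ccE] : forall k, exists ca : R * V, span n ca.2 /\ u k = ca.2 + ca.1 *: v n.
  move=> k; have [c ->] := us k; exists (c n, \sum_(i < n) c i *: v i).
  by rewrite big_ord_recr /=; split => //; exists c.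
pose c k := (cc k).1; pose a k := (cc k).2.
have aE k : a k = u k - c k *: v n by rewrite /a /c [u k](ccE k).2 addrK.
have [[C cC]|nC] := pselect (exists C, forall k, `|c k| <= C).
  have [phi hphi [l cl]] := bounded_subseq_cvg cC.
  have [||psi hpsi [w sw aw]] := IH (a \o phi) (M + C * `|v n|).
  - by move=> k; exact: (ccE _).1.
  - move=> k; rewrite /= aE (le_trans (ler_normB _ _))// lerD// normrZ.
    by rewrite ler_wpM2r.
  exists (phi \o psi); first by move=> i j ij; apply: hphi; exact: hpsi.
  exists (w + l *: v n).
    apply: spanD; first exact: span_mono sw.
    by apply: spanZ; exact: span_gen.
  rewrite (_ : (fun k => u ((phi \o psi) k)) =
    (fun k => (a \o phi) (psi k)) \+ (fun k => c (phi (psi k)) *: v n)); last first.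
    by apply/funext => k /=; rewrite aE subrK.
  by apply: cvgD => //; apply: cvgZr_tmp; exact: (cvg_subseq hpsi cl).
have hbig k N : exists2 i, (N <= i)%N & k.+1%:R <= `|c i|.
  apply: contrapT => H; apply: nC.
  exists (\sum_(i < N) `|c i| + k.+1%:R) => i.
  have [Ni|iN] := leqP N i.
    rewrite (@le_trans _ _ k.+1%:R)// ?lerDr ?sumr_ge0//.
    by rewrite leNgt; apply/negP => lt; apply: H; exists i => //; exact: ltW.
  rewrite (bigD1 (Ordinal iN))//= -addrA lerDl addr_ge0// sumr_ge0//.
have [phi hphi phiE] := extraction hbig.
pose w k := - (c (phi k))^-1 *: a (phi k).
have c0 k : 0 < `|c (phi k)| by apply: lt_le_trans (phiE k).
have wv k : `|v n - w k| <= M * k.+1%:R^-1.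
  have -> : v n - w k = (c (phi k))^-1 *: u (phi k).
    rewrite /w aE scaleNr opprK scalerBr scalerA mulVf -?normr_gt0// scale1r.
    by rewrite addrC subrK.
  rewrite normrZ normfV mulrC ler_pM// lef_pV2// posrE//.
have M0 : 0 <= M by apply: le_trans (uM 0%N).
have wv0 : w k @[k --> \oo] --> v n.
  apply/cvgrPdist_le => e e0.
  have /cvgrPdist_le/(_ _ e0) : M * k.+1%:R^-1 @[k --> \oo] --> (0 : R).
    by rewrite -(mulr0 M); apply: cvgMr; exact: cvg_harmonic.
  apply: filterS => k; rewrite sub0r normrN ger0_norm ?mulr_ge0//.
  exact: le_trans (wv k).
have [||psi hpsi [l sl wl]] := IH w (`|v n| + M).
- by move=> k; apply: spanZ; exact: (ccE _).1.
- move=> k; rewrite -{1}(subrK (v n) (w k)) addrC (le_trans (ler_normD _ _))// lerD2l.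
  rewrite distrC (le_trans (wv k))// ler_piMr// invf_le1//.
  by rewrite ler1n.
have vl : v n = l.
  exact: (cvg_unique (@norm_hausdorff R V) (cvg_subseq hpsi wv0) wl).
have us' k : span n (u k).
  by rewrite [u k](ccE k).2 vl; apply: spanD; [exact: (ccE k).1|exact: spanZ].
have [chi hchi [l' sl' ul']] := IH u M us' uM.
by exists chi => //; exists l' => //; exact: span_mono sl'.
Qed.

(** Compactness: counterexamples for d = 1 / (k + 1) have a subsequence of vectors converging to
    some l in the span; the functionals tend to 0 at l, while staying above e at the vectors. *)
Lemma span_uniform n (M e : R) : 0 < e ->
  exists2 d, 0 < d & forall w : dual V, `|w| <= M -> (forall i, (i < n)%N -> `|w (v i)| <= d) ->
    forall x, span n x -> `|x| <= 1 -> `|w x| <= e.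
Proof.
move=> e0; apply: contrapT => H.
have /choice[wx wxE] : forall k : nat, exists wx : dual V * V,
    [/\ `|wx.1| <= M, (forall i, (i < n)%N -> `|wx.1 (v i)| <= k.+1%:R^-1),
        span n wx.2, `|wx.2| <= 1 & e < `|wx.1 wx.2|].
  move=> k; apply: contrapT => Hk; apply: H; exists k.+1%:R^-1 => // w wM wd x sx x1.
  by rewrite leNgt; apply/negP => lt; apply: Hk; exists (w, x).
have M0 : 0 <= M by have [h _ _ _ _] := wxE 0%N; apply: le_trans h.
have [||phi hphi [l [c lE] xl]] := @span_subseq n (fun k => (wx k).2) 1.
- by move=> k; have [] := wxE k.
- by move=> k; have [] := wxE k.
have wl : `|(wx (phi k)).1 l| @[k --> \oo] --> (0 : R).
  pose C := \sum_(i < n) `|c i|.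
  apply: (@squeeze_cvgr _ _ _ _ (cst 0) (fun k => C * k.+1%:R^-1)); last 2 first.
  - exact: cvg_cst.
  - by rewrite -(mulr0 C); apply: cvgMr; exact: cvg_harmonic.
  apply: nearW => k; rewrite normr_ge0/= lE dapp_sum (le_trans (ler_norm_sum _ _ _))//.
  rewrite /C mulr_suml; apply: ler_sum => i _; rewrite dappZ normrM ler_wpM2l//.
  have [_ h _ _ _] := wxE (phi k); apply: (le_trans (h _ (ltn_ord i))).
  by rewrite lef_pV2 ?posrE// ler_nat ltnS; exact: homo_leq_id.
have xl' : M * `|(wx (phi k)).2 - l| @[k --> \oo] --> (0 : R).
  rewrite -(mulr0 M); apply: cvgMr; rewrite -(normr0 V) -(subrr l).
  by apply: cvg_norm; apply: cvgB => //; exact: cvg_cst.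
have /cvgrPdist_lt/(_ _ e0)[N _ /(_ N (leqnn N))] :
    (fun k => `|(wx (phi k)).1 l| + M * `|(wx (phi k)).2 - l|) @ \oo --> (0 : R).
  by rewrite -(addr0 (0 : R)); exact: cvgD.
rewrite sub0r normrN /= => lt.
have [wM _ _ _] := wxE (phi N); apply/negP; rewrite -leNgt; apply/ltW/(le_lt_trans _ lt).
rewrite [leRHS]ger0_norm ?addr_ge0 ?mulr_ge0//.
rewrite -{1}(subrKC l (wx (phi N)).2) dappD (le_trans (ler_normD _ _))// lerD2l.
by rewrite (le_trans (dual_ub _ _))// ler_wpM2r.
Qed.

End span.

Section annihilators.
Context {R : realType} {V : normedModType R}.
Variables (v : nat -> V) (d : nat -> dual V).

Definition common_ker m : set V := [set x | forall i, (i < m)%N -> d i x = 0].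

Lemma common_ker_lin m t x y : common_ker m x -> common_ker m y -> common_ker m (t *: x + y).
Proof. by move=> hx hy i im; rewrite dapp_linear hx// hy// mulr0 addr0. Qed.

Lemma common_ker0 m : common_ker m 0.
Proof. by move=> i _; exact: dapp0. Qed.

Lemma common_ker_mono m n : (m <= n)%N -> common_ker n `<=` common_ker m.
Proof. by move=> mn x hx i im; apply: hx; exact: leq_trans mn. Qed.

Lemma span_ker m (a : dual V) x : span d m a -> common_ker m x -> a x = 0.
Proof.
by move=> [c ->] hx; rewrite dual_sum big1// => i _; rewrite dualZ hx// mulr0.
Qed.

Definition annih n : set (dual V) := [set f : dual V | forall x, span v n x -> f x = 0].

Lemma annihB n (f g : dual V) : annih n f -> annih n g -> annih n (f - g).
Proof. by move=> hf hg x sx; rewrite dualB hf// hg// subr0. Qed.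

Lemma annih_mono m n : (m <= n)%N -> annih n `<=` annih m.
Proof. by move=> mn f hf x /(span_mono mn); exact: hf. Qed.

(** The columns of [cokermx D] are coefficients of vectors of [span v n] killed by the first m
    functionals, so f vanishes there. Hence the row of values of f is a combination of the rows of
    [D], and its coefficients define a. *)
Lemma annih_split m n (f : dual V) :
  (forall x, span v n x -> common_ker m x -> f x = 0) ->
  exists a b : dual V, [/\ f = a + b, span d m a & annih n b].
Proof.
move=> f0; pose D : 'M[R]_(m, n) := \matrix_(i < m, j < n) d i (v j).
pose F : 'rV[R]_n := \row_j f (v j).
have : (F <= D)%MS.
  rewrite submxE; apply/eqP/matrixP => i k; rewrite !mxE.
  pose x := \sum_(j < n) (cokermx D) j k *: v j.
  have -> : \sum_j F i j * (cokermx D) j k = f x.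
    by rewrite dapp_sum; apply: eq_bigr => j _; rewrite !mxE dappZ mulrC.
  apply: f0; first by apply: span_sum => j _; apply: spanZ; exact: span_gen.
  move=> l lm; rewrite dapp_sum.
  have /matrixP/(_ (Ordinal lm) k) := mulmx_coker D; rewrite !mxE; apply: etrans.
  by apply: eq_bigr => j _; rewrite !mxE dappZ mulrC.
move=> /submxP[C FC].
pose cc i : R := if insub i is Some j then C 0 j else 0.
pose a : dual V := \sum_(i < m) cc i *: d i.
exists a, (f - a); split; [by rewrite subrKC|by exists cc|].
move=> _ [c ->]; rewrite dapp_sum big1// => j _.
rewrite dappZ dualB dual_sum.
have /matrixP/(_ 0 j) := FC; rewrite !mxE => ->.
rewrite (_ : \sum_(k < m) C 0 k * D k j = \sum_(i < m) dapp (cc i *: d i) (v j)) ?subrr ?mulr0//.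
by apply: eq_bigr => i _; rewrite dualZ /cc valK !mxE.
Qed.

End annihilators.

(** * Small convex combinations of weakly Cauchy sequences *)

(** Reduces a limit to two separate inequalities, each of them needed at a single index of every
    subsequence. *)
Lemma cvgn_subseqs {R : realType} (a : nat -> R) (L : R) :
  (forall phi : nat -> nat, {homo phi : m n / (m < n)%N} -> forall e, 0 < e ->
    (exists k, a (phi k) <= L + e) /\ (exists k, L - e <= a (phi k))) ->
  a @ \oo --> L.
Proof.
move=> H; apply/cvgn_distP => e e0.
have side (P : nat -> Prop) : (forall phi : nat -> nat, {homo phi : m n / (m < n)%N} ->
    exists k, P (phi k)) -> exists N, forall n, (N <= n)%N -> P n.
  move=> HP; apply: contrapT => nP.
  have [k N|phi hphi nPphi] := @extraction (fun=> fun n => ~ P n).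
    apply: contrapT => h; apply: nP; exists N => n Nn; apply: contrapT => Pn.
    by apply: h; exists n.
  by have [k] := HP phi hphi; exact: nPphi.
have [N1 h1] := side (fun n => a n <= L + e) (fun phi h => (H phi h e e0).1).
have [N2 h2] := side (fun n => L - e <= a n) (fun phi h => (H phi h e e0).2).
exists (maxn N1 N2) => n; rewrite geq_max => /andP[/h1 n1 /h2 n2].
by rewrite ler_distl n1 n2.
Qed.

Section weak.
Context {R : realType}.
Variable V : normedModType R.

Definition wnull (u : nat -> V) := forall f : dual V, f (u n) @[n --> \oo] --> (0 : R).

Definition wcauchy (u : nat -> V) :=
  forall f : dual V, exists c : R, f (u n) @[n --> \oo] --> c.

(** Sequential form of (m_p), with a limit instead of an upper limit: after passing to a subsequence
    the norms of [u] converge. *)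
Definition asymptotic_lp (p : \bar R) := forall (x : V) (u : nat -> V) (t : R),
  wnull u -> `|u n| @[n --> \oo] --> t -> `|x + u n| @[n --> \oo] --> lp_norm2 p `|x| t.

Definition weak_cauchy_subseqs := forall (u : nat -> V) (M : R), (forall n, `|u n| <= M) ->
  exists2 phi : nat -> nat, {homo phi : m n / (m < n)%N} & wcauchy (u \o phi).

Definition asymptotic_dual_lp (p : \bar R) := forall (f : dual V) (fn : nat -> dual V) (t : R),
  (forall x, fn n x @[n --> \oo] --> (0 : R)) -> `|fn n| @[n --> \oo] --> t ->
  `|f + fn n| @[n --> \oo] --> lpd p `|f| t.

End weak.

Section iterated_limits.
Context {R : realType} {V : normedModType R} (p : \bar R) (p1s : (1 < p)%E).
Let p1 : (1 <= p)%E := ltW p1s.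
Local Notation lp := (lp_norm2 p).
Variable x : nat -> V.
Hypothesis x1 : forall n, `|x n| <= 1.
Implicit Types (l : seq R) (v w : V).

(** The iterated limit, over m_1, then m_2, and so on, of |v + a_1 x(m_1) + a_2 x(m_2) + ...|; the
    head of the list belongs to the outermost limit. *)
Fixpoint itlim l v : R :=
  if l is a :: l' then ulim (fun m => itlim l' (v + a *: x m)) else `|v|.

Lemma itlim_bound l v : 0 <= itlim l v <= `|v| + \sum_(a <- l) `|a|.
Proof.
elim: l v => [|a l IH] v /=; first by rewrite big_nil addr0 normr_ge0 lexx.
have B m : 0 <= itlim l (v + a *: x m) <= `|v| + \sum_(b <- a :: l) `|b|.
  have /andP[-> /le_trans] := IH (v + a *: x m); apply.
  rewrite big_cons addrA lerD2r (le_trans (ler_normD _ _))// lerD2l normrZ.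
  by rewrite ler_piMr.
have cv : itlim l (v + a *: x m) @[m --> ultra] --> ulim (fun m => itlim l (v + a *: x m)).
  apply: (@ulim_cvg _ _ (`|v| + \sum_(b <- a :: l) `|b|)) => m.
  by have /andP[h1 h2] := B m; rewrite ger0_norm.
have E := cvg_lim (@Rhausdorff R) cv.
apply/andP; split; rewrite -E.
  by apply: limr_ge; [exact: cvgP cv|apply: nearW => m; have /andP[] := B m].
by apply: limr_le; [exact: cvgP cv|apply: nearW => m; have /andP[] := B m].
Qed.

Lemma itlim_ge0 l v : 0 <= itlim l v.
Proof. by have /andP[] := itlim_bound l v. Qed.

Lemma itlim_cvg a l v : itlim l (v + a *: x m) @[m --> ultra] --> itlim (a :: l) v.
Proof.
apply: (@ulim_cvg _ _ (`|v| + \sum_(b <- a :: l) `|b|)) => m.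
rewrite ger0_norm ?itlim_ge0//.
have /andP[_ /le_trans] := itlim_bound l (v + a *: x m); apply.
rewrite big_cons addrA lerD2r (le_trans (ler_normD _ _))// lerD2l normrZ.
by rewrite ler_piMr.
Qed.

Lemma itlim_unique a l v c : itlim l (v + a *: x m) @[m --> ultra] --> c ->
  itlim (a :: l) v = c.
Proof. exact: ulimP. Qed.

Lemma ultra_le (a b : nat -> R) la lb : a @ ultra --> la -> b @ ultra --> lb ->
  (forall n, a n <= b n) -> la <= lb.
Proof.
move=> ca cb ab.
rewrite -(cvg_lim (@Rhausdorff R) ca) -(cvg_lim (@Rhausdorff R) cb).
by apply: ler_lim; [exact: cvgP ca|exact: cvgP cb|exact: nearW].
Qed.

Lemma itlim_last l v a b : itlim (rcons l (a + b)) v <= itlim (rcons l a) v + `|b|.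
Proof.
elim: l v => [|c l IH] v; rewrite ?rcons_cons.
  apply: (ultra_le (@itlim_cvg (a + b) [::] v) (cvgD (@itlim_cvg a [::] v) (cvg_cst `|b|))) => m /=.
  rewrite scalerDl addrA (le_trans (ler_normD _ _))// lerD2l normrZ.
  by rewrite ler_piMr.
apply: (ultra_le (@itlim_cvg c (rcons l (a + b)) v)
  (cvgD (@itlim_cvg c (rcons l a) v) (cvg_cst `|b|))) => m; exact: IH.
Qed.

Lemma itlimN l v : itlim (map -%R l) (- v) = itlim l v.
Proof.
elim: l v => [|a l IH] v /=; first by rewrite normrN.
congr ulim; apply/funext => m; rewrite -IH opprD scaleNr.
by [].
Qed.

Definition comb l (ms : seq nat) : V := \sum_(am <- zip l ms) am.1 *: x am.2.

(** The indices are chosen one by one in sets of the ultrafilter where both iterated limits are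
    almost attained, so that a single combination serves two purposes, once as it is and once
    multiplied by lam. *)
Lemma itlim_select l (l' l'' : seq R) v w (lam : R) (M : nat) (e : R) : 0 < e ->
  exists ms : seq nat, [/\ size ms = size l, all (leq M) ms,
    `|itlim l' (v + comb l ms) - itlim (l ++ l') v| <= e &
    `|itlim l'' (w + lam *: comb l ms) - itlim (map ( *%R lam) l ++ l'') w| <= e].
Proof.
elim: l v w e => [|a l IH] v w e e0.
  exists [::]; rewrite /comb /= big_nil scaler0 !addr0 !subrr normr0.
  by split => //; exact: ltW.
have e2 : 0 < e / 2 by rewrite divr_gt0.
have U1 := cvg_ultra_dist e2 (@itlim_cvg a (l ++ l') v).
have U2 := cvg_ultra_dist e2 (@itlim_cvg (lam * a) (map ( *%R lam) l ++ l'') w).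
have [m Mm [h1 h2]] := ultra_freq M (filterI U1 U2).
have [ms [sms ams H1 H2]] := IH (v + a *: x m) (w + (lam * a) *: x m) _ e2.
exists (m :: ms); split => //=; rewrite ?sms ?Mm//.
  rewrite /comb big_cons /= addrA [e]splitr.
  by rewrite -(subrKA (itlim (l ++ l') (v + a *: x m))) (le_trans (ler_normD _ _))// lerD.
rewrite /comb big_cons /= scalerDr scalerA addrA [e]splitr.
by rewrite -(subrKA (itlim (map ( *%R lam) l ++ l'') (w + (lam * a) *: x m))) (le_trans (ler_normD _ _))// lerD.
Qed.

Lemma comb_dual (f : dual V) (c e : R) (M : nat) l ms : size ms = size l ->
  all (leq M) ms -> (forall m, (M <= m)%N -> `|f (x m) - c| <= e) ->
  `|f (comb l ms) - (\sum_(a <- l) a) * c| <= (\sum_(a <- l) `|a|) * e.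
Proof.
move=> sz al fM; elim: l ms sz al => [|a l IH] [|m ms]//=.
  by rewrite /comb /= !big_nil dapp0 !mul0r subr0 normr0.
move=> [sz] /andP[Mm al]; rewrite /comb /= !big_cons /= dappD dappZ !mulrDl.
rewrite opprD addrACA -mulrBr (le_trans (ler_normD _ _))// lerD//.
  by rewrite normrM ler_wpM2l// fM.
exact: IH.
Qed.

Hypothesis xc : wcauchy x.
Hypothesis mV : asymptotic_lp V p.

(** Coefficients of sum 0 make weakly null combinations out of a weakly Cauchy sequence, and (m_p)
    applies to these. *)
Lemma itlim_null l v : \sum_(a <- l) a = 0 -> itlim l v = lp `|v| (itlim l 0).
Proof.
move=> l0; have /choice[ms msE] : forall k : nat, exists ms : seq nat,
    [/\ size ms = size l, all (leq k) ms, `| `|v + comb l ms| - itlim l v| <= k.+1%:R^-1 &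
    `| `|comb l ms| - itlim l 0| <= k.+1%:R^-1].
  move=> k; have k0 : 0 < k.+1%:R^-1 :> R by rewrite invr_gt0.
  have [ms [h1 h2 h3 h4]] := itlim_select l [::] [::] v 0 1 k k0.
  exists ms; split => //; move: h3 h4; rewrite !cats0 ?scale1r ?add0r//.
  by rewrite (_ : map _ l = l)// -[RHS]map_id; apply: eq_map => a; rewrite mul1r.
have H (a : nat -> R) c : (forall k, `|a k - c| <= k.+1%:R^-1) -> a @ \oo --> c.
  move=> h; apply/cvgrPdist_le => e e0.
  have /cvgrPdist_le/(_ _ e0) := @cvg_harmonic R; apply: filterS => k hk.
  rewrite distrC (le_trans (h k))// (le_trans _ hk)// sub0r normrN.
  exact: ler_norm.
have uN : wnull (fun k => comb l (ms k)).
  move=> f; have [c fc] := xc f; apply/cvgrPdist_le => e e0.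
  pose C : R := \sum_(a <- l) `|a|.
  have C0 : 0 <= C by apply: sumr_ge0.
  have C1 : 0 < C + 1 by rewrite ltr_wpDl.
  have /cvgn_distP/(_ _ (divr_gt0 e0 C1))[N HN] := fc.
  exists N => // k /= Nk; rewrite sub0r normrN.
  have [h1 h2 _ _] := msE k.
  have := @comb_dual f c _ N l (ms k) h1 _ HN; rewrite l0 mul0r subr0 => /(_ _)/le_trans; apply.
    by apply: sub_all h2 => i; exact: leq_trans.
  by rewrite mulrCA ger_pMr// ler_pdivrMr// mul1r lerDl.
have c1 : `|comb l (ms k)| @[k --> \oo] --> itlim l 0.
  by apply: H => k; have [] := msE k.
have c2 : `|v + comb l (ms k)| @[k --> \oo] --> itlim l v.
  by apply: H => k; have [] := msE k.
exact: (cvg_unique (@Rhausdorff R) c2 (mV uN c1)).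
Qed.

(** When the inner limits over [l2] are taken, the terms of [l1] are already fixed vectors; the
    final segment of sum 0 therefore splits off. *)
Lemma itlim_cat_null l1 l2 v : \sum_(a <- l2) a = 0 ->
  itlim (l1 ++ l2) v = lp (itlim l1 v) (itlim l2 0).
Proof.
move=> l20; elim: l1 v => [|a l1 IH] v; first exact: itlim_null.
apply: itlim_unique; under eq_fun do rewrite IH.
apply/cvgrPdist_le => e e0.
have /cvgrPdist_le/(_ _ e0) := @itlim_cvg a l1 v; apply: filterS => m h.
by rewrite (le_trans (lp_lip _ _ _ _ _))// subrr normr0 addr0.
Qed.

Local Notation up h := (nseq h (- 1 : R)).
Local Notation dn h := (nseq h (1 : R)).

(** A list is read as a walk whose height is the sum of the coefficients still to come: a
    coefficient -1 is a step up, a coefficient 1 a step down. *)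
Let peak h := up h ++ dn h.
Let well h := dn h ++ up h.
Let block h (b : bool) := if b then peak h else well h.
Let word h bs := flatten (map (block h) bs).

Let sum_nseq h (a : R) : \sum_(b <- nseq h a) b = h%:R * a.
Proof. by rewrite big_nseq iter_addr_0 mulr_natl. Qed.

Let block_sum h b : \sum_(a <- block h b) a = 0.
Proof.
by case: b; rewrite /block /peak /well big_cat/= !sum_nseq mulr1 mulrN1 ?subrr ?addNr.
Qed.

Let well_peak h : itlim (well h) 0 = itlim (peak h) 0.
Proof.
rewrite -itlimN oppr0; congr itlim.
by rewrite /well /peak map_cat !map_nseq opprK.
Qed.

(** The walk starts at height h, descends to 0, runs through the blocks, climbs back to h and ends
    with one jump. Without blocks it combines exactly the two quantities that the convex combination
    has to control. *)
Let walk h bs := itlim (dn h ++ word h bs ++ up h ++ [:: h%:R]) 0.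

(** A well is a peak with opposite sign, so all blocks contribute the same summand and only their
    number matters. *)
Let walkE h bs : walk h bs = lp (iter (size bs) (fun t => lp t (itlim (peak h) 0)) (itlim (dn h) 0))
  (itlim (up h ++ [:: h%:R]) 0).
Proof.
rewrite /walk catA itlim_cat_null; last first.
  by rewrite big_cat/= sum_nseq big_seq1 mulrN1 addNr.
congr lp; elim/last_ind: bs => [|bs b IH]; first by rewrite cats0.
rewrite /word map_rcons flatten_rcons catA itlim_cat_null ?block_sum// size_rcons /=.
by rewrite -IH; congr lp; case: b => //=; rewrite well_peak.
Qed.

Let flatten_nseq_rot (a b : seq R) k :
  a ++ flatten (nseq k (b ++ a)) = flatten (nseq k (a ++ b)) ++ a.
Proof. by elim: k => [|k IH] /=; rewrite ?cats0// -!catA IH. Qed.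

Let nseq_double h (a : R) : nseq (h + h) a = nseq h a ++ nseq h a.
Proof. by rewrite nseqD. Qed.

(* Folding: subtracting the constant path [h] from a walk of height [2 h] turns
   every descent to [0] into a well of depth [h]. *)
Let walk_double h k : walk (h + h) (nseq k true) <= walk h (nseq (k + k).+1 true) + h%:R.
Proof.
(* At scale h, a walk of height 2 h with k peaks consists of k pairs of a well and a peak, followed
   by a well. By [walkE] these 2 k + 1 blocks may be replaced by peaks. *)
pose bs := rcons (flatten (nseq k [:: false; true])) false.
have sbs : size bs = size (nseq (k + k).+1 true).
  rewrite size_rcons size_flatten /shape map_nseq sumn_nseq /= size_nseq.
  by rewrite mul2n addnn.
have -> : walk h (nseq (k + k).+1 true) = walk h bs by rewrite !walkE sbs.
have wbs : word h bs = flatten (nseq k (dn h ++ (up h ++ up h ++ dn h))) ++ dn h ++ up h.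
  rewrite /word /bs map_rcons flatten_rcons; congr cat.
  elim: k {bs sbs} => [//|k IH] /=.
  by rewrite IH /= /well /peak -!catA.
rewrite /walk wbs /word map_nseq /= /block /peak !nseq_double natrD -!catA.
have := flatten_nseq_rot (dn h) (up h ++ up h ++ dn h) k; rewrite -!catA => rot.
rewrite [in leLHS](catA (dn h) (flatten _)) rot -!catA !catA !cats1.
have := @itlim_last (dn h ++ flatten (nseq k (dn h ++ up h ++ up h ++ dn h)) ++ dn h ++ up h ++ up h) 0 h%:R h%:R.
by rewrite !catA ger0_norm.
Qed.

(** Each folding shortens the last jump by half of the height; the costs 2^(j-1), ..., 2, 1 add up
    to 2^j - 1, while the number of blocks roughly doubles each time. *)
Let walk_pow2 j k : walk (2 ^ j) (nseq k true) <=
  walk 1 (nseq (2 ^ j * k.+1).-1 true) + (2 ^ j)%:R - 1.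
Proof.
elim: j k => [|j IH] k; first by rewrite expn0 mul1n addrK.
rewrite expnS mul2n -addnn; apply: (le_trans (walk_double _ _)).
have := IH (k + k).+1; rewrite (_ : (2 ^ j * (k + k).+2)%N = ((2 ^ j + 2 ^ j) * k.+1)%N); last by lia.
by rewrite natrD; lra.
Qed.

Let iter_lp c t k : 0 <= c -> 0 <= t ->
  iter k (fun t => lp t c) t <= t + c * kappa p k.
Proof.
move=> c0 t0; have -> : iter k (fun t => lp t c) t = lp t (c * kappa p k).
  elim: k => [|k IH] /=; first by rewrite /kappa /= mulr0 lp0r ?ger0_norm.
  have -> : c * kappa p k.+1 = lp (c * kappa p k) c by rewrite /kappa /= -lpZ// mulr1.
  by rewrite IH lpA.
by rewrite (le_trans (lp_leD p1 _ _))// !ger0_norm// mulr_ge0// lps_ge0.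
Qed.

Let walk1_le K : walk 1 (nseq K true) <= 3 + 2 * kappa p K.
Proof.
rewrite walkE size_nseq (le_trans (lp_leD p1 _ _))//.
have b l : itlim l 0 <= \sum_(a <- l) `|a|.
  by have /andP[_] := itlim_bound l 0; rewrite normr0 add0r.
have b1 : itlim (peak 1) 0 <= 2.
  by apply: (le_trans (b _)); rewrite /= !big_cons big_nil normrN normr1 addr0.
have b2 : itlim (dn 1) 0 <= 1.
  by apply: (le_trans (b _)); rewrite /= !big_cons big_nil normr1 addr0.
have b3 : itlim (up 1 ++ [:: 1%:R]) 0 <= 2.
  by apply: (le_trans (b _)); rewrite /= !big_cons big_nil normrN normr1 addr0.
have i0 : 0 <= iter K (fun t => lp t (itlim (peak 1) 0)) (itlim (dn 1) 0).
  by case: K => [|K]; [exact: itlim_ge0|rewrite iterS; exact: lp_ge0].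
rewrite (ger0_norm i0) (ger0_norm (itlim_ge0 _ _)).
have := @iter_lp (itlim (peak 1) 0) (itlim (dn 1) 0) K (itlim_ge0 _ _) (itlim_ge0 _ _).
have := ler_wpM2r (lps_ge0 p1 K (fun=> 1)) b1; rewrite -/(kappa p K); lra.
Qed.

(** z replaces the missing weak limit of x in the asymptotic law. The first clause records what is
    used of z being a convex combination of terms of index at least M. *)
Lemma far_convex_combination (e : R) (M : nat) : 0 < e -> exists z : V,
  (forall (f : dual V) c d, (forall m, (M <= m)%N -> `|f (x m) - c| <= d) -> `|f z - c| <= d) /\
  lp `|z| (ulim (fun n => `|x n - z|)) <= 1 + e.
Proof.
move=> e0; have e7 : 0 < e / 7 by rewrite divr_gt0.
have [j kj] := kappa_small p1 p1s e7.
pose h := (2 ^ j)%N; have h0 : 0 < h%:R :> R by rewrite ltr0n expn_gt0.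
have kj1 : 1 <= kappa p h.
  have := @lps_coord _ _ p1 h (fun=> 1) 0%N; rewrite expn_gt0 normr1; exact.
(* Folding bounds this walk without blocks by h + 2 + 2 kappa, and 1 <= kappa <= h e / 7. Two more
   portions h e / 7 are kept for the selection of indices. *)
have wh : lp (itlim (dn h) 0) (itlim (up h ++ [:: h%:R]) 0) <= h%:R * (1 + e * (5 / 7)).
  have := walk_pow2 j 0; rewrite walkE /= muln1 => /le_trans; apply.
  have := walk1_le (2 ^ j).-1.
  have : kappa p (2 ^ j).-1 <= kappa p h by apply: lps_mono => //; exact: leq_pred.
  move: kj; rewrite -/h; lra.
have eh : 0 < h%:R * (e / 7) by rewrite mulr_gt0.
(* With lam = -1 the same sum S plays the descent, and its opposite the climb before the last jump;
   so |S| and the limit of |h x n - S| are controlled together, and z = S / h. *)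
have [ms [sms ams h1 h2]] := itlim_select (dn h) [::] [:: h%:R] 0 0 (-1) M eh.
set S := comb (dn h) ms in h1 h2.
exists (h%:R^-1 *: S); split.
  move=> f c d fM; have := comb_dual sms ams fM; rewrite sum_nseq mulr1 -/S.
  rewrite (_ : \sum_(a <- dn h) `|a| = h%:R); last by rewrite big_nseq iter_addr_0 normr1.
  rewrite dappZ => H; rewrite -(@ler_pM2l _ h%:R)// -{1}(gtr0_norm h0) -normrM.
  by rewrite mulrBr mulrA mulfV ?gt_eqF// mul1r.
have E : map ( *%R (-1)) (dn h) = up h by rewrite map_nseq mulr1.
rewrite cats0 add0r in h1; rewrite add0r scaleN1r E in h2.
have -> : ulim (fun n => `|x n - h%:R^-1 *: S|) = h%:R^-1 * itlim [:: h%:R] (- S).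
  have -> : (fun n => `|x n - h%:R^-1 *: S|) = (fun n => h%:R^-1 * `|- S + h%:R *: x n|).
    apply/funext => n; rewrite -[h%:R^-1 in RHS]gtr0_norm ?invr_gt0// -normrZ scalerDr scalerA.
    by rewrite mulVf ?gt_eqF// scale1r scalerN addrC.
  by apply: ulimP; apply: cvgMr; exact: (@itlim_cvg h%:R [::] (- S)).
have hi : 0 <= h%:R^-1 :> R by rewrite invr_ge0 ltW.
rewrite normrZ (ger0_norm hi) lpZ//.
rewrite ler_pdivrMl//.
have := lp_lip p1 `|S| (itlim [:: h%:R] (- S)) (itlim (dn h) 0) (itlim (up h ++ [:: h%:R]) 0).
move/(le_trans (ler_norm _)).
rewrite (_ : itlim [::] S = `|S|) in h1; last by [].
move: wh h1 h2.
move: (lp `|S| _) (lp (itlim _ _) _) `| `|S| - _| `|itlim _ (- S) - _| => a1 a2 a3 a4; lra.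
Qed.

End iterated_limits.

(** * Duality of the asymptotic condition *)

Section dual_asymptotics.
Context {R : realType} {V : normedModType R} (p : \bar R) (p1s : (1 < p)%E).
Let p1 : (1 <= p)%E := ltW p1s.
Local Notation lp := (lp_norm2 p).
Hypothesis mV : asymptotic_lp V p.
Hypothesis wcV : weak_cauchy_subseqs V.
Variables (f : dual V) (fn : nat -> dual V) (t : R).
Hypothesis fn0 : forall x, fn n x @[n --> \oo] --> (0 : R).
Hypothesis fnt : `|fn n| @[n --> \oo] --> t.

Let t0 : 0 <= t.
Proof.
rewrite -(cvg_lim (@Rhausdorff R) fnt); apply: limr_ge; first exact: cvgP fnt.
exact: nearW.
Qed.

Let near_ultra (u : nat -> R) (l e : R) (phi : nat -> nat) : {homo phi : m n / (m < n)%N} ->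
  0 < e -> u @ \oo --> l -> ultra [set n | `|u (phi n) - l| <= e].
Proof. by move=> hphi e0 /(cvg_subseq hphi)/cvg_ultra; exact: cvg_ultra_dist. Qed.

Let ulim_dist (y : nat -> V) (z : V) (e : R) : (forall n, `|y n| <= 1) -> 0 < e ->
  ultra [set n | `| `|y n - z| - ulim (fun n => `|y n - z|)| <= e].
Proof.
move=> y1 e0; apply: cvg_ultra_dist => //; apply: (@ulim_cvg _ _ (1 + `|z|)) => n.
by rewrite normr_id (le_trans (ler_normB _ _))// lerD2r.
Qed.

Let ulim_dist_ge0 (y : nat -> V) (z : V) : (forall n, `|y n| <= 1) ->
  0 <= ulim (fun n => `|y n - z|).
Proof.
move=> y1; apply: (@ultra_le R (fun=> 0) (fun n => `|y n - z|)) => //; first exact: cvg_cst.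
apply: (@ulim_cvg _ _ (1 + `|z|)) => n.
by rewrite normr_id (le_trans (ler_normB _ _))// lerD2r.
Qed.

(** Vectors y n that almost norm f + fn n are written z + (y n - z). The functional f sees only z,
    because f (y n) and f z are close to the same limit; fn n sees only y n - z, because fn n tends
    to 0 at z. *)
Lemma dual_asymptotics_upper (e : R) : 0 < e -> exists n, `|f + fn n| <= lpd p `|f| t + e.
Proof.
have t1 : 0 <= t by exact: t0.
move=> e0; set L := lpd p `|f| t.
have L0 : 0 <= L by exact: lpd_ge0.
pose e1 := Num.min 1 (e / (L + t + 10)).
have e10 : 0 < e1 by rewrite lt_min ltr01 divr_gt0//; lra.
have e11 : e1 <= 1 by rewrite ge_min lexx.
have e1e : e1 * (L + t + 10) <= e.
  by rewrite -ler_pdivlMr; [rewrite ge_min lexx orbT|lra].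
clearbody e1.
have /choice[x xE] : forall n, exists x : V, `|x| <= 1 /\ `|f + fn n| - e1 < dapp (f + fn n) x.
  by move=> n; have [x ? ?] := dual_adh (f + fn n) e10; exists x.
have [phi hphi yc] := wcV (fun n => (xE n).1).
pose y := x \o phi.
have y1 n : `|y n| <= 1 by exact: (xE _).1.
have [c fc] := yc f.
have /cvgn_distP/(_ _ e10)[M HM] := fc.
have [z [zf zlp]] := far_convex_combination p1s y1 yc mV M e10.
set rho := ulim _ in zlp.
have [n Mn [[h1 h2] h3]] := ultra_freq M (filterI (filterI (ulim_dist z y1 e10)
  (near_ultra hphi e10 (fn0 z))) (near_ultra hphi e10 fnt)).
rewrite -/rho in h1.
exists (phi n).
have hf : `|f (y n) - c| <= e1 by exact: HM.
have hz : `|f z - c| <= e1 by exact: zf HM.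
have rho0 : 0 <= rho by exact: ulim_dist_ge0.
have rho2 : rho <= 2.
  have := lp_ler p1 `|z| rho; rewrite (ger0_norm rho0).
  by move: zlp e11; move: (lp _ _) => a; lra.
have := (xE (phi n)).2; rewrite dualD -/(y n) => H.
have H1 : fn (phi n) (y n - z) <= (t + e1) * (rho + e1).
  apply: (le_trans (dual_le _ _)); apply: ler_pM => //.
    by move: h3; rewrite /= ler_distl => /andP[_]; lra.
  by move: h1; rewrite /= ler_distl => /andP[_]; lra.
have H2 := dual_le f z.
have H3 := lpd_ub p1 (normr_ge0 f) t0 (normr_ge0 z) rho0.
have H4 := ler_wpM2l L0 zlp.
have H5 : e1 * (t + rho + e1) <= e1 * (t + 3) by apply: ler_wpM2l; [exact: ltW|lra].
have H6 : fn (phi n) z <= e1 by move: h2; rewrite /= subr0 => /(le_trans (ler_norm _)).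
move: hf hz; rewrite !ler_distl => /andP[_ hf] /andP[hz _].
rewrite dappB in H1; rewrite -/L in H3.
lra.
Qed.

(** Subtracting the substitutes z from vectors that almost norm fn n gives a weakly null sequence,
    of norm at most 1 in the limit, on which fn n is still almost normed. By (m_p) the vectors s x +
    s' u lie almost in the unit ball when (s, s') almost attains [lpd], with x almost norming f. *)
Lemma dual_asymptotics_lower (e : R) : 0 < e -> exists n, lpd p `|f| t - e <= `|f + fn n|.
Proof.
have t1 : 0 <= t by exact: t0.
move=> e0; set L := lpd p `|f| t.
have L0 : 0 <= L by exact: lpd_ge0.
pose e1 := e / (L + 10).
have e10 : 0 < e1 by rewrite divr_gt0//; lra.
have e1e : e1 * (L + 10) = e by rewrite /e1 divfK// gt_eqF//; lra.
clearbody e1; have [x x1 fx] := dual_adh f e10.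
have /choice[xn xnE] : forall n, exists x : V, `|x| <= 1 /\ `|fn n| - e1 < fn n x.
  by move=> n; have [w ? ?] := dual_adh (fn n) e10; exists w.
have [phi hphi yc] := wcV (fun n => (xnE n).1).
pose y := xn \o phi.
have y1 n : `|y n| <= 1 by exact: (xnE _).1.
pose ek (k : nat) : R := k.+1%:R^-1.
have ek0 k : 0 < ek k by rewrite invr_gt0.
(* The index is chosen after z, so that the functional of that index is already small at z. *)
have /choice[zn znE] : forall k, exists zn : V * nat, [/\ (k <= zn.2)%N,
    (forall (f : dual V) c d, (forall m, (k <= m)%N -> `|f (y m) - c| <= d) -> `|f zn.1 - c| <= d),
    `|y zn.2 - zn.1| <= 1 + ek k + ek k & `|fn (phi zn.2) zn.1| <= ek k].
  move=> k; have [z [zf zlp]] := far_convex_combination p1s y1 yc mV k (ek0 k).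
  have [n kn [h1 h2]] := ultra_freq k (filterI (ulim_dist z y1 (ek0 k))
    (near_ultra hphi (ek0 k) (fn0 z))).
  exists (z, n); split => //=; last by move: h2; rewrite /= subr0.
  have := lp_ler p1 `|z| (ulim (fun n => `|y n - z|)).
  rewrite ger0_norm ?ulim_dist_ge0// => h3.
  by move: h1; rewrite /= ler_distl => /andP[_]; lra.
pose u k := y (zn k).2 - (zn k).1.
have ek_cvg : ek k @[k --> \oo] --> (0 : R) by exact: cvg_harmonic.
have un : wnull u.
  move=> g; have [c gc] := yc g; apply/cvgn_distP => d d0.
  have d2 : 0 < d / 2 by rewrite divr_gt0.
  have /cvgn_distP/(_ _ d2)[N HN] := gc; exists N => n Nn.
  have [h1 h2 _ _] := znE n.
  have k1 : `|g (y (zn n).2) - c| <= d / 2 by apply: HN; exact: leq_trans Nn h1.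
  have k2 : `|g (zn n).1 - c| <= d / 2 by apply: h2 => m nm; apply: HN; exact: leq_trans Nn nm.
  move: k1 k2; rewrite /u dappB !ler_distl => /andP[? ?] /andP[? ?].
  by apply/andP; split; lra.
have ub k : `|u k| <= 3.
  have [_ _ h _] := znE k; apply: (le_trans h).
  have : ek k <= 1 by rewrite /ek invf_le1// ler1n.
  lra.
have [|psi hpsi [tau utau]] := @bounded_subseq_cvg R (fun k => `|u k|) 3.
  by move=> k; rewrite normr_id.
have tau1 : tau <= 1.
  rewrite -(cvg_lim (@Rhausdorff R) utau).
  have c1 : 1 + ek (psi k) + ek (psi k) @[k --> \oo] --> (1 : R).
    rewrite -[X in _ --> X]addr0 -[X in _ --> X]addr0.
    by apply: cvgD; [apply: cvgD; [exact: cvg_cst|]|]; exact: cvg_subseq hpsi ek_cvg.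
  rewrite -(cvg_lim (@Rhausdorff R) c1); apply: ler_lim; [exact: cvgP utau|exact: cvgP c1|].
  by apply: nearW => k; have [] := znE (psi k).
have tau0 : 0 <= tau.
  rewrite -(cvg_lim (@Rhausdorff R) utau); apply: limr_ge; first exact: cvgP utau.
  exact: nearW.
have [s [s' [s0 s'0 ss' Hs]]] := lpd_adh p1 (normr_ge0 f) t0 e10.
have s1 : s <= 1 by rewrite (le_trans (ler_norm _))// (le_trans (lp_lel p1 s s')).
have s'1 : s' <= 1 by rewrite (le_trans (ler_norm _))// (le_trans (lp_ler p1 s s')).
have un' : wnull (fun k => s' *: u (psi k)).
  move=> g; rewrite (_ : (fun k => g (s' *: u (psi k))) = (fun k => s' * g (u (psi k)))); last first.
    by apply/funext => k; rewrite dappZ.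
  by rewrite -(mulr0 s'); apply: cvgMr; exact: cvg_subseq hpsi (un g).
have un't : `|s' *: u (psi k)| @[k --> \oo] --> s' * tau.
  rewrite (_ : (fun k => `|s' *: u (psi k)|) = (fun k => s' * `|u (psi k)|)); first exact: cvgMr.
  by apply/funext => k; rewrite normrZ (ger0_norm s'0).
have := @mV (s *: x) _ _ un' un't.
have lp1 : lp `|s *: x| (s' * tau) <= 1.
  apply: le_trans ss'; apply: lp_le => //.
    by rewrite normr_ge0 normrZ (ger0_norm s0) ler_piMr.
  by rewrite mulr_ge0//= ler_piMr.
move=> /cvgn_distP/(_ _ e10)[N1 HN1].
have /cvgn_distP/(_ _ e10)[N2 HN2] := cvg_subseq hpsi ek_cvg.
have /cvgn_distP/(_ _ e10)[N3 HN3] := cvg_subseq hpsi (un f).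
have fnx : fn (phi (zn (psi k)).2) x @[k --> \oo] --> (0 : R).
  apply/cvgn_distP => d d0; have /cvgn_distP/(_ _ d0)[N HN] := fn0 x.
  exists N => n Nn; apply: HN; apply: (leq_trans Nn); apply: (leq_trans (homo_leq_id hpsi n)).
  have [h _ _ _] := znE (psi n); apply: (leq_trans h); exact: homo_leq_id.
have fnn : `|fn (phi (zn (psi k)).2)| @[k --> \oo] --> t.
  apply/cvgn_distP => d d0; have /cvgn_distP/(_ _ d0)[N HN] := fnt.
  exists N => n Nn; apply: HN; apply: (leq_trans Nn); apply: (leq_trans (homo_leq_id hpsi n)).
  have [h _ _ _] := znE (psi n); apply: (leq_trans h); exact: homo_leq_id.
have /cvgn_distP/(_ _ e10)[N4 HN4] := fnx.
have /cvgn_distP/(_ _ e10)[N5 HN5] := fnn.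
have [k [k1 k2 k3 k4 k5]] :
    exists k, [/\ (N1 <= k)%N, (N2 <= k)%N, (N3 <= k)%N, (N4 <= k)%N & (N5 <= k)%N].
  by exists (N1 + N2 + N3 + N4 + N5)%N; clear; split; lia.
have {HN1 k1}h1 := HN1 k k1; have {HN2 k2}h2 := HN2 k k2; have {HN3 k3}h3 := HN3 k k3.
have {HN4 k4}h4 := HN4 k k4; have {HN5 k5}h5 := HN5 k k5.
set n := phi (zn (psi k)).2 in h4 h5.
exists n.
have [_ _ _ h6] := znE (psi k); rewrite -/n in h6.
have h7 := (xnE n).2.
have H1 := dual_le (f + fn n) (s *: x + s' *: u (psi k)).
have H2 : `|s *: x + s' *: u (psi k)| <= 1 + e1.
  by move: h1; rewrite /= ler_distl => /andP[_]; lra.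
have H3 := ler_wpM2l (normr_ge0 (f + fn n)) H2.
have H4 : s * (`|f| - e1) <= s * f x by rewrite ler_wpM2l// ltW.
have H5 : s' * - e1 <= s' * f (u (psi k)).
  by rewrite ler_wpM2l//; move: h3; rewrite /= subr0 ler_norml => /andP[].
have H6 : s * - e1 <= s * fn n x.
  by rewrite ler_wpM2l//; move: h4; rewrite /= subr0 ler_norml => /andP[].
have H7 : s' * (t - 3 * e1) <= s' * fn n (u (psi k)).
  rewrite ler_wpM2l// /u dappB; move: h2 h5 h6.
  rewrite /= subr0 (ger0_norm (ltW (ek0 _))) ler_distl => h2 /andP[h5 _] h6.
  have := le_trans (ler_norm _) h6; rewrite -/(y (zn (psi k)).2) in h7 *.
  by rewrite /y /= -/n; lra.
have H8 := ler_wpM2l (ltW e10) s1; have H9 := ler_wpM2l (ltW e10) s'1.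
rewrite dualD !dappD !dappZ in H1; rewrite -/L in Hs.
have [LA|AL] := leP L `|f + fn n|.
  by rewrite lerBlDr (le_trans LA)// lerDl ltW.
have H10 := ler_wpM2l (ltW e10) (ltW AL).
lra.
Qed.

End dual_asymptotics.

Theorem dual_asymptotics {R : realType} {V : normedModType R} (p : \bar R) (p1 : (1 < p)%E) :
  asymptotic_lp V p -> weak_cauchy_subseqs V -> asymptotic_dual_lp V p.
Proof.
move=> mV wcV f fn t fn0 fnt; apply: cvgn_subseqs => phi hphi e e0.
have h0 x := cvg_subseq hphi (fn0 x); have ht := cvg_subseq hphi fnt.
split; [exact: (dual_asymptotics_upper p1 mV wcV f h0 ht)|].
exact: (dual_asymptotics_lower p1 mV wcV f h0 ht).
Qed.

(** * Density of the dual and almost orthogonality *)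

Section dual_separable.
Context {R : realType} {V : normedModType R} (p : \bar R) (p1s : (1 < p)%E).
Let p1 : (1 <= p)%E := ltW p1s.
Variable v : nat -> V.
Hypothesis v_dense : forall x (e : R), 0 < e -> exists i, `|x - v i| <= e.
Hypothesis mdV : asymptotic_dual_lp V p.

(** Tested on the pair (kappa n, 1), the hypothesis gives kappa n + t <= kappa (n + 1). Hence n t <=
    kappa n, and [kappa_small] forces t = 0. *)
Lemma lpd_rigid (t : R) : 0 <= t -> lpd p 1 t <= 1 -> t = 0.
Proof.
move=> t0 lt1.
have step n : n%:R * t <= kappa p n.
  elim: n => [|n IH]; first by rewrite mul0r lps_ge0.
  have := lpd_ub p1 ler01 t0 (lps_ge0 p1 n (fun=> 1)) ler01.
  rewrite -[lp_norm2 _ _ _]/(kappa p n.+1) -/(kappa p n) => h.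
  have := ler_wpM2r (lps_ge0 p1 n.+1 (fun=> 1)) lt1; rewrite -/(kappa p n.+1) => h'.
  by rewrite -natr1; lra.
apply/eqP; rewrite eq_le t0 andbT; apply/ler_addgt0Pr => e e0; rewrite add0r.
have [k kk] := kappa_small p1 p1s e0.
have := le_trans (step _) kk; rewrite mulrC ler_pM2r// ltr0n expn_gt0//.
Qed.

Lemma dual_pointwise_dense (fn : nat -> dual V) (M : R) : (forall n, `|fn n| <= M) ->
  (forall i, fn n (v i) @[n --> \oo] --> (0 : R)) -> forall x, fn n x @[n --> \oo] --> (0 : R).
Proof.
move=> fM fv x; have M0 : 0 <= M by apply: le_trans (fM 0%N).
have M1 : 0 < 2 * (M + 1) by lra.
apply/cvgn_distP => e e0; have [i xi] := v_dense x (divr_gt0 e0 M1).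
have /cvgn_distP/(_ _ (divr_gt0 e0 (ltr0n R 2)))[N HN] := fv i.
exists N => n Nn; have := HN n Nn; rewrite !subr0 => h1.
rewrite -(subrKC (v i) x) dappD (le_trans (ler_normD _ _))// [e]splitr lerD//.
apply: (le_trans (dual_ub _ _)).
apply: (@le_trans _ _ ((M + 1) * (e / (2 * (M + 1))))).
  by apply: ler_pM => //; have := fM n; lra.
by have -> : (M + 1) * (e / (2 * (M + 1))) = e / 2 by field; rewrite gt_eqF//; lra.
Qed.

(** By [lpd_rigid], functionals of norm at most 1 converging weak* to a point f of the unit sphere
    converge to it in norm. So it is enough to choose countably many functionals that approximate f
    weak*. *)
Lemma dual_separable : exists d : nat -> dual V, forall f : dual V, `|f| = 1 ->
  forall e : R, 0 < e -> exists i, `|f - d i| <= e.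
Proof.
(* The index is a length n with prescribed integer parts of (n + 1) f (v i) for i < n; a functional
   of the unit ball with these data is chosen whenever one exists. *)
have /choice[D DE] : forall ns : nat * seq int, exists D : dual V,
    (exists f : dual V, `|f| <= 1 /\ (forall i, (i < ns.1)%N ->
      Num.floor (f (v i) * ns.1.+1%:R) = nth 0 ns.2 i)) ->
    `|D| <= 1 /\ (forall i, (i < ns.1)%N -> Num.floor (D (v i) * ns.1.+1%:R) = nth 0 ns.2 i).
  move=> ns; have [[f Hf]|H] := pselect (exists f : dual V, `|f| <= 1 /\ (forall i, (i < ns.1)%N ->
      Num.floor (f (v i) * ns.1.+1%:R) = nth 0 ns.2 i)).
    by exists f.
  by exists 0.
exists (fun n => if unpickle n is Some ns then D ns else 0) => f f1 e e0.
apply: contrapT => H.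
pose s n := [seq Num.floor (f (v i) * n.+1%:R) | i <- iota 0 n].
have sE n i : (i < n)%N -> nth 0 (s n) i = Num.floor (f (v i) * n.+1%:R).
  by move=> i_n; rewrite (nth_map 0%N) ?size_iota// nth_iota.
pose g n := D (n, s n).
have gE n : `|g n| <= 1 /\ forall i, (i < n)%N -> `|g n (v i) - f (v i)| <= n.+1%:R^-1.
  have [|g1 gv] := DE (n, s n); first by exists f; rewrite f1; split => // i i_n; rewrite sE.
  split => // i i_n; have := gv i i_n; rewrite /= sE// => fl.
  have n0 : 0 < n.+1%:R :> R by [].
  rewrite -(ler_pM2r n0) mulVf// -{1}(ger0_norm (ltW n0)) -normrM mulrBl.
  have := floor_itv (g n (v i) * n.+1%:R).
  have := floor_itv (f (v i) * n.+1%:R).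
  rewrite fl => /andP[h1 h2] /andP[h3 h4].
  by move: h2 h4; rewrite !intrD => h2 h4; rewrite ler_norml; apply/andP; split; lra.
pose fn n : dual V := g n - f.
have fn2 n : `|fn n| <= 2.
  by rewrite (le_trans (ler_normB _ _))// f1; have := (gE n).1; lra.
have fnv x : fn n x @[n --> \oo] --> (0 : R).
  apply: (dual_pointwise_dense fn2) => i; apply/cvgn_distP => d d0.
  have /cvgn_distP/(_ _ d0)[N HN] := @cvg_harmonic R.
  exists (maxn N i.+1) => n; rewrite geq_max => /andP[/HN + i_n].
  rewrite !subr0 dualB; apply: le_trans; apply: le_trans (ler_norm _).
  exact: (gE n).2.
have fne n : e <= `|fn n|.
  rewrite leNgt; apply/negP => lt; apply: H; exists (pickle (n, s n)).
  by rewrite pickleK -/(g n) distrC ltW.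
have [|phi hphi [t ct]] := @bounded_subseq_cvg R (fun n => `|fn n|) 2.
  by move=> n; rewrite normr_id.
have et : e <= t.
  rewrite -(cvg_lim (@Rhausdorff R) ct); apply: limr_ge; first exact: cvgP ct.
  by apply: nearW => k; exact: fne.
have := mdV (f := f) (fun x => cvg_subseq hphi (fnv x)) ct.
rewrite f1 => cl; have l1 : lpd p 1 t <= 1.
  rewrite -(cvg_lim (@Rhausdorff R) cl); apply: limr_le; first exact: cvgP cl.
  by apply: nearW => n; rewrite /fn subrKC; exact: (gE _).1.
have := lpd_rigid (le_trans (ltW e0) et) l1; move: et e0; lra.
Qed.

End dual_separable.

Section asymptotic_relation.
Context {R : realType} {Z : normedModType R}.
Variable Phi : R -> R -> R.
Hypothesis PhiZ : forall c a b : R, 0 <= c -> 0 <= a -> 0 <= b -> Phi (c * a) (c * b) = c * Phi a b.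
Hypothesis Phi_lip : forall a b a' b' : R, 0 <= a -> 0 <= b -> 0 <= a' -> 0 <= b' ->
  Phi a b <= Phi a' b' + `|a - a'| + `|b - b'|.
Hypothesis Phi_l : forall a b : R, 0 <= a -> 0 <= b -> a <= Phi a b.
Hypothesis Phi_r : forall a b : R, 0 <= a -> 0 <= b -> b <= Phi a b.
Variables (W : nat -> set Z).
Hypothesis W_mono : forall m n, (m <= n)%N -> W n `<=` W m.
Hypothesis WZ : forall n (c : R) h, W n h -> W n (c *: h).
Hypothesis W_asymp : forall (u : nat -> Z) (x : Z) (t : R), (forall k, W k (u k)) ->
  `|u k| @[k --> \oo] --> t -> `|x + u k| @[k --> \oo] --> Phi `|x| t.

(** One compactness argument for X with its kernels and for the dual with its annihilators.
    Counterexamples for all m, normalised to [Phi = 1], have a subsequence whose first components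
    converge and whose second components have convergent norms; this contradicts [W_asymp]. *)
Lemma asymptotic_relation (g : nat -> Z) n (th : R) : 1 < th -> exists m, forall x h,
  span g n x -> W m h -> `|x + h| <= th * Phi `|x| `|h| /\ Phi `|x| `|h| <= th * `|x + h|.
Proof.
move=> th1; apply: contrapT => H.
have Phi0 (a b : R) : 0 <= a -> 0 <= b -> 0 <= Phi a b.
  by move=> a0 b0; apply: le_trans (Phi_l a0 b0).
have /choice[xh xhE] : forall m, exists xh : Z * Z, [/\ span g n xh.1, W m xh.2,
    Phi `|xh.1| `|xh.2| = 1 & `|xh.1 + xh.2| <= th -> 1 <= th * `|xh.1 + xh.2| -> False].
  move=> m; apply: contrapT => Hm; apply: H; exists m => x h sx Wh.
  set P := Phi `|x| `|h|.
  have [P0|P0] := eqVneq P 0.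
    have x0 : x = 0 by apply/eqP; rewrite -normr_le0 -P0 Phi_l.
    have h0 : h = 0 by apply/eqP; rewrite -normr_le0 -P0 Phi_r.
    by rewrite P0 x0 h0 addr0 normr0 mulr0.
  have Pp : 0 < P by rewrite lt_neqAle eq_sym P0 Phi0.
  have iP : 0 <= P^-1 by rewrite invr_ge0 ltW.
  apply: contrapT => nh; apply: Hm; exists (P^-1 *: x, P^-1 *: h); split => /=.
  - exact: spanZ.
  - exact: WZ.
  - by rewrite !normrZ !(ger0_norm iP) PhiZ// mulVf.
  rewrite -scalerDr normrZ (ger0_norm iP) => h1 h2; apply: nh; split.
    by move: h1; rewrite ler_pdivrMl// mulrC.
  by move: h2; rewrite mulrCA ler_pdivlMl// mulr1.
have nx k : `|(xh k).1| <= 1 by have [_ _ <- _] := xhE k; exact: Phi_l.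
have nh k : `|(xh k).2| <= 1 by have [_ _ <- _] := xhE k; exact: Phi_r.
have [phi hphi [x sx cx]] := span_subseq (fun k => (let: And4 h _ _ _ := xhE k in h)) nx.
have [|psi hpsi [t ct]] := @bounded_subseq_cvg R (fun k => `|(xh (phi k)).2|) 1.
  by move=> k; rewrite normr_id.
pose chi := phi \o psi.
have hchi : {homo chi : m n / (m < n)%N} by move=> i j ij; apply: hphi; exact: hpsi.
have t0 : 0 <= t.
  rewrite -(cvg_lim (@Rhausdorff R) ct); apply: limr_ge; first exact: cvgP ct.
  exact: nearW.
have cx' : (xh (chi k)).1 @[k --> \oo] --> x := cvg_subseq hpsi cx.
have dx : `|(xh (chi k)).1 - x| @[k --> \oo] --> (0 : R).
  rewrite -(normr0 Z) -(subrr x); apply: cvg_norm; apply: cvgB => //; exact: cvg_cst.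
have ca := @W_asymp (fun k => (xh (chi k)).2) x t _ ct.
have {}ca : `|x + (xh (chi k)).2| @[k --> \oo] --> Phi `|x| t.
  apply: ca => k; have [_ h _ _] := xhE (chi k); apply: W_mono h.
  exact: homo_leq_id.
pose d := Num.min (th - 1) (1 - th^-1) / 4.
have thi : th^-1 < 1 by rewrite invf_lt1//; lra.
have d0 : 0 < d by rewrite divr_gt0// lt_min; apply/andP; split; lra.
have d1 : 4 * d <= th - 1 by rewrite /d mulrC divfK// ge_min lexx.
have d2 : 4 * d <= 1 - th^-1 by rewrite /d mulrC divfK// ge_min lexx orbT.
clearbody d.
have /cvgn_distP/(_ _ d0)[N1 H1] := dx; have /cvgn_distP/(_ _ d0)[N2 H2] := ct.
have /cvgn_distP/(_ _ d0)[N3 H3] := ca.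
have [k [k1 k2 k3]] : exists k, [/\ (N1 <= k)%N, (N2 <= k)%N & (N3 <= k)%N].
  by exists (N1 + N2 + N3)%N; clear; split; lia.
have {H1}h1 := H1 k k1; have {H2}h2 := H2 k k2; have {H3}h3 := H3 k k3.
rewrite subr0 normr_id in h1.
have [_ _ P1 nP] := xhE (chi k).
set y := (xh (chi k)).1 in h1 P1 nP *; set h := (xh (chi k)).2 in h3 P1 nP *.
have h2' : `| `|h| - t| <= d by exact: h2.
have e1 := Phi_lip (normr_ge0 x) t0 (normr_ge0 y) (normr_ge0 h).
have e2 := Phi_lip (normr_ge0 y) (normr_ge0 h) (normr_ge0 x) t0.
have e3 : `| (`|y| - `|x|) | <= d by apply: le_trans h1; exact: ler_dist_dist.
have e3' : `| (`|x| - `|y|) | <= d by rewrite distrC.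
have e4 : `|t - `|h| | <= d by rewrite distrC.
have e5 : `|y + h| <= `|x + h| + d.
  rewrite -(subrK x y) -addrA addrC (le_trans (ler_normD _ _))// lerD2l//.
have e6 : `|x + h| <= `|y + h| + d.
  rewrite -(subrK y x) -addrA addrC (le_trans (ler_normD _ _))// lerD2l// distrC.
  exact: h1.
rewrite P1 in e1 e2.
move: h3; rewrite ler_distl => /andP[h3 h4].
have th0 : 0 < th by lra.
apply: nP; first by lra.
by rewrite -ler_pdivrMl// mulr1; lra.
Qed.

End asymptotic_relation.

(** * Regrouping sums and l_p norms by residue classes *)

Section residues.
Context {R : realType} (p : \bar R) (p1 : (1 <= p)%E).

Lemma sum_residues (V : nmodType) N K (F : nat -> V) :
  \sum_(i < K * N) F i = \sum_(j < N) \sum_(k < K) F (k * N + j)%N.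
Proof.
elim: K => [|K IH].
  by rewrite mul0n big_ord0 big1// => j _; rewrite big_ord0.
rewrite mulSnr big_split_ord /= IH -big_split /=; apply: eq_bigr => j _.
by rewrite big_ord_recr.
Qed.

Lemma lps_residue N K j (a : nat -> R) : (j < N)%N ->
  lps p (K * N) (fun i => if (i %% N == j)%N then a i else 0) =
  lps p K (fun k => a (k * N + j)%N).
Proof.
move=> jN; elim: K => [//|K IH]; rewrite mulSnr lps_cat// IH /=.
rewrite -[RHS]lp_abs// -[LHS]lp_abs//; congr lp_norm2.
rewrite (@eq_lps _ p N _ (fun i => if i == j then a (K * N + j)%N else 0)); last first.
  move=> i iN; rewrite modnMDl modn_small//.
  by case: eqP => // ->.
have jN' : (j.+1 <= N)%N by [].
rewrite (lps_widen p1 jN'); last by move=> i /andP[ji _]; rewrite gtn_eqF.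
rewrite /= eqxx (_ : lps p j _ = 0).
  by rewrite lp0l// normr_id.
rewrite (lps_widen p1 (leq0n j))// => i /andP[_ ij].
by rewrite ltn_eqF.
Qed.

Lemma lps_residues N K (a : nat -> R) : (0 < N)%N ->
  lps p (K * N) a = lps p N (fun j => lps p K (fun k => a (k * N + j)%N)).
Proof.
by move=> N0; rewrite (lps_classes p1 _ _ N0); apply: eq_lps => j jN; exact: lps_residue.
Qed.

End residues.

Section relations.
Context {R : realType} {V : normedModType R} (p : \bar R) (p1 : (1 <= p)%E).
Local Notation lp := (lp_norm2 p).
Variables (v : nat -> V) (d : nat -> dual V).

Definition primal_rel n m (th : R) := forall x h, span v n x -> common_ker d m h ->
  `|x + h| <= th * lp `|x| `|h| /\ lp `|x| `|h| <= th * `|x + h|.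

Definition dual_rel m n (th : R) := forall a b : dual V, span d m a -> annih v n b ->
  `|a + b| <= th * lpd p `|a| `|b| /\ lpd p `|a| `|b| <= th * `|a + b|.

Lemma primal_rel_mono n m m' (th th' : R) : (m <= m')%N -> th <= th' ->
  primal_rel n m th -> primal_rel n m' th'.
Proof.
move=> mm tt H x h sx /(common_ker_mono mm) /(H x h sx)[h1 h2]; split.
  by apply: (le_trans h1); rewrite ler_wpM2r// lp_ge0.
by apply: (le_trans h2); rewrite ler_wpM2r.
Qed.

Lemma dual_rel_mono m n n' (th th' : R) : (n <= n')%N -> th <= th' ->
  dual_rel m n th -> dual_rel m n' th'.
Proof.
move=> mm tt H x h sx /(annih_mono mm) /(H x h sx)[h1 h2]; split.
  by apply: (le_trans h1); rewrite ler_wpM2r// lpd_ge0.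
by apply: (le_trans h2); rewrite ler_wpM2r.
Qed.

Lemma dual_rel0 n (th : R) : 1 <= th -> dual_rel 0 n th.
Proof.
move=> th1 a b [c ->] _; rewrite big_ord0 normr0 add0r lpd0l//.
by split; rewrite ler_peMl.
Qed.

(** Let G be the intersection of [span v n'] and [common_ker d mp], and la the norm of a on G.
    Extending the restriction of a from G with norm la changes a by a' + b', with a' in [span d mp]
    and b' in [annih v n']. The first relation discards b'; the second shows that removing a' cannot
    make a much smaller. *)
Lemma block_norm (a : dual V) mp np m n' (th1 th2 delta : R) : 0 <= th1 -> 0 <= th2 ->
  dual_rel m n' th1 -> dual_rel mp np th2 -> (mp <= m)%N -> span d m a -> annih v np a ->
  0 < delta ->
  exists g, [/\ span v n' g, common_ker d mp g, `|g| <= 1, 0 <= a g & `|a| <= th1 * th2 * a g + delta].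
Proof.
move=> th10 th20 H1 H2 mpm sa aa d0.
pose P := [set g | span v n' g /\ common_ker d mp g].
have P0 : P 0 by split; [exact: span0|exact: common_ker0].
have Pl t x y : P x -> P y -> P (t *: x + y).
  by move=> [? ?] [? ?]; split; [exact: span_lin|exact: common_ker_lin].
pose A := [set a g | g in [set g | P g /\ `|g| <= 1]].
have A0 : A 0 by exists 0; [rewrite /= normr0 ler01|rewrite dapp0].
have As : has_sup A.
  split; first by exists 0.
  by exists `|a| => _ [g [Pg g1] <-]; rewrite (le_trans (dual_le _ _))// ler_piMr.
pose la := sup A.
have la0 : 0 <= la by apply: ub_le_sup => //; exact: As.2.
have al g : P g -> a g <= la * `|g|.
  move=> Pg; have [->|g0] := eqVneq g 0; first by rewrite dapp0 normr0 mulr0.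
  have n0 : 0 < `|g| by rewrite normr_gt0.
  rewrite -ler_pdivrMr// mulrC -dappZ; apply: ub_le_sup; first exact: As.2.
  exists (`|g|^-1 *: g) => //; split; first by rewrite -(addr0 (_ *: _)); exact: Pl.
  by rewrite normrZ normfV normr_id mulVf// gt_eqF.
have [gt [gta gtl]] := dual_extend la0 P0 Pl al.
have gt0 x : span v n' x -> common_ker d mp x -> dapp (a - gt) x = 0.
  by move=> sx kx; rewrite dualB gta ?subrr.
have [a' [b' [E sa' ab']]] := annih_split gt0.
have ab'N : annih v n' (- b') by move=> x sx; rewrite dualN ab'// oppr0.
have [_ h1] := H1 (a - a') (- b') (spanB sa (span_mono mpm sa')) ab'N.
have gE : a - a' - b' = gt.
  by rewrite -addrA -opprD -E opprB addrC subrK.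
rewrite gE in h1.
have k1 : `|a - a'| <= th1 * la.
  apply: (le_trans (lpd_lel p1 (normr_ge0 (a - a')) (normr_ge0 (- b')))).
  by apply: (le_trans h1); rewrite ler_wpM2l.
have [_ h2] := H2 (- a') a (spanN sa') aa.
have k2 : `|a| <= th2 * `|a - a'|.
  apply: (le_trans (lpd_ler p1 (normr_ge0 (- a')) (normr_ge0 a))).
  by apply: (le_trans h2); rewrite addrC.
have k3 : `|a| <= th1 * th2 * la.
  by apply: (le_trans k2); rewrite -mulrA mulrCA ler_wpM2l.
have tt0 : 0 <= th1 * th2 by rewrite mulr_ge0.
have tt1 : 0 < th1 * th2 + 1 by lra.
have [_ [g [[sg kg] g1] <-] lt] := sup_adherent (divr_gt0 d0 tt1) As.
have {lt}lt : la <= a g + delta / (th1 * th2 + 1) by rewrite -/la in lt; lra.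
have k4 : th1 * th2 * (delta / (th1 * th2 + 1)) <= delta.
  by rewrite mulrCA ger_pMr// ler_pdivrMr//; lra.
have k5 := ler_wpM2l tt0 lt.
have [ag|ag] := leP 0 (a g).
  by exists g; split => //; lra.
exists 0; rewrite normr0 dapp0; split; [exact: span0|exact: common_ker0|by []|by []|].
have k6 := ler_wpM2l tt0 (ltW ag); lra.
Qed.

Hypothesis v_dense : forall x (e : R), 0 < e -> exists i, `|x - v i| <= e.
Hypothesis d_dense : forall f : dual V, `|f| = 1 -> forall e : R, 0 < e -> exists i, `|f - d i| <= e.
Hypothesis mV : asymptotic_lp V p.
Hypothesis mdV : asymptotic_dual_lp V p.

Let cvg_bounded (u : nat -> R) (t : R) : u @ \oo --> t -> exists M, forall n, `|u n| <= M.
Proof.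
move=> ut; have /cvg_seq_bounded [M [Mr H]] := cvgP _ ut.
exists (M + 1) => n; apply: H => //; first by rewrite ltrDl.
Qed.

(** A bounded sequence running through the successive kernels is weakly null, because [d] is dense
    on the unit sphere of the dual. *)
Lemma primal_rel_ex n (th : R) : 1 < th -> exists m, primal_rel n m th.
Proof.
move=> th1; apply: (@asymptotic_relation _ V lp _ _ _ _ (common_ker d)) => //.
- by move=> c a b c0 _ _; exact: lpZ.
- move=> a b a' b' _ _ _ _; rewrite -addrA addrC -lerBlDr.
  exact: le_trans (ler_norm _) (lp_lip p1 _ _ _ _).
- by move=> a b a0 b0; have := lp_lel p1 a b; rewrite ger0_norm.
- by move=> a b a0 b0; have := lp_ler p1 a b; rewrite ger0_norm.
- by move=> m k mk; exact: common_ker_mono.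
- by move=> k c h kh; rewrite -(addr0 (_ *: _)); apply: common_ker_lin => //; exact: common_ker0.
move=> u x t uk ut; apply: mV => // f.
have [M uM] := cvg_bounded ut.
have M0 : 0 <= M by apply: le_trans (uM 0%N).
have {}uM k : `|u k| <= M by have := uM k; rewrite normr_id.
have [->|f0] := eqVneq f 0; first by rewrite (_ : (fun k => _) = cst 0); [exact: cvg_cst|exact/funext].
have fn0 : 0 < `|f| by rewrite normr_gt0.
apply/cvgn_distP => e e0.
have M1 : 0 < `|f| * (M + 1) by rewrite mulr_gt0//; lra.
have [|i fi] := @d_dense (`|f|^-1 *: f) _ _ (divr_gt0 e0 M1).
  by rewrite normrZ normfV normr_id mulVf// gt_eqF.
exists i.+1 => k ik; rewrite subr0.
have -> : f (u k) = `|f| * dapp (`|f|^-1 *: f - d i) (u k).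
  by rewrite dualB dualZ (uk k i ik) subr0 mulrA mulfV ?mul1r// gt_eqF.
rewrite normrM normr_id.
apply: (@le_trans _ _ (`|f| * (e / (`|f| * (M + 1)) * (M + 1)))).
  rewrite ler_wpM2l// (le_trans (dual_ub _ _))// ler_pM//.
  by have := uM k; lra.
have -> : `|f| * (e / (`|f| * (M + 1)) * (M + 1)) = e; last by [].
by field; rewrite !gt_eqF//; lra.
Qed.

(** A bounded sequence running through the successive annihilators is weak* null, because [v] is
    dense. *)
Lemma dual_rel_ex m (th : R) : 1 < th -> exists n, dual_rel m n th.
Proof.
move=> th1; apply: (@asymptotic_relation _ (dual V) (lpd p) _ _ _ _ (annih v)) => //.
- by move=> c a b c0 a0 b0; exact: lpdZ.
- by move=> a b a' b'; exact: lpd_lip.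
- by move=> a b; exact: lpd_lel.
- by move=> a b; exact: lpd_ler.
- by move=> i j ij; exact: annih_mono.
- by move=> k c h kh x sx; rewrite dualZ kh// mulr0.
move=> u x t uk ut; apply: mdV => //.
have [M uM] := cvg_bounded ut.
have {}uM k : `|u k| <= M by have := uM k; rewrite normr_id.
apply: (dual_pointwise_dense v_dense uM) => i.
apply/cvgn_distP => e e0; exists i.+1 => k ik; rewrite (uk k); first by rewrite subrr normr0 ltW.
exact: span_gen.
Qed.

End relations.

(** * Blocks *)

Section blocks.
Context {R : realType} {V : normedModType R} (p : \bar R) (p1 : (1 <= p)%E).
Local Notation lp := (lp_norm2 p).
Variables (v : nat -> V) (d : nat -> dual V).
Variables (s : nat -> nat) (c : nat -> R) (C : R) (N : nat).
Hypothesis s_mono : {homo s : i j / (i < j)%N}.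
Hypothesis c1 : forall i, 1 <= c i.
Hypothesis c_mono : forall i j, (i <= j)%N -> c i <= c j.
Hypothesis cC : forall i, c i <= C.
Hypothesis s_primal : forall i j, (i < j)%N -> primal_rel p v d (s i) (s j) (c i.+1 / c i).
Hypothesis s_dual : forall i j, (i < j)%N -> dual_rel p v d (s i) (s j) (c i.+1 / c i).
Hypothesis d_dense : forall f : dual V, `|f| = 1 -> forall e : R, 0 < e -> exists i, `|f - d i| <= e.
Hypothesis N0 : (0 < N)%N.

Let c0 i : 0 < c i. Proof. exact: lt_le_trans (c1 i). Qed.
Let C1 : 1 <= C. Proof. exact: le_trans (c1 0) (cC 0). Qed.

Let lpsS K (a : nat -> R) : lps p K.+1 a = lp (lps p K a) (a K). Proof. by []. Qed.

(** The factors c (i + 1) / c i telescope: by monotonicity of c, only c (b K) has been spent once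
    the terms up to K are added, and this is at most C. *)
Lemma chain_estimate (g : nat -> V) (a b : nat -> nat) : (forall k, span v (s (b k)) (g k)) ->
  (forall k, common_ker d (s (a k)) (g k.+1)) -> (forall k, (b k < a k)%N) ->
  (forall k, (b k < b k.+1)%N) -> forall K,
  `|\sum_(k < K) g k| <= C * lps p K (fun k => `|g k|) /\
  lps p K (fun k => `|g k|) <= C * `|\sum_(k < K) g k|.
Proof.
move=> sg kg ba bb.
have H K : [/\ span v (s (b K)) (\sum_(k < K.+1) g k),
    `|\sum_(k < K.+1) g k| <= c (b K) * lps p K.+1 (fun k => `|g k|) &
    lps p K.+1 (fun k => `|g k|) <= c (b K) * `|\sum_(k < K.+1) g k|].
  elim: K => [|K [IH1 IH2 IH3]].
    rewrite big_ord1 /= lp0l// normr_id; split; [exact: sg|rewrite ler_peMl//|rewrite ler_peMl//].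
  rewrite big_ord_recr lpsS; set L := lps p K.+1 _ in IH2 IH3 *.
  have L0 : 0 <= L by exact: lps_ge0.
  rewrite /=; set S := \sum_(i < K.+1) g i in IH1 IH2 IH3 *.
  have [h1 h2] := s_primal (ba K) IH1 (kg K).
  have sbm : (s (b K) <= s (b K.+1))%N by apply: ltnW; exact: s_mono.
  have cm : c (b K).+1 <= c (b K.+1) by apply: c_mono.
  have cb := c0 (b K).
  split.
  - by apply: spanD => //; exact: span_mono sbm _ IH1.
  - apply: (le_trans h1).
    apply: (@le_trans _ _ (c (b K).+1 / c (b K) * (c (b K) * lp L `|g K.+1|))).
      rewrite ler_wpM2l ?divr_ge0 ?(ltW (c0 _))//.
      rewrite -lpZ ?(ltW cb)//; apply: lp_le; rewrite ?normr_ge0//=.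
      by rewrite ler_peMl.
    by rewrite mulrA divfK ?gt_eqF// ler_wpM2r// lp_ge0.
  - apply: (@le_trans _ _ (c (b K) * lp `|S| `|g K.+1|)).
      rewrite -lpZ ?(ltW cb)//; apply: lp_le; rewrite ?L0 ?normr_ge0//=.
      by rewrite ler_peMl.
    apply: (@le_trans _ _ (c (b K) * (c (b K).+1 / c (b K) * `|S + g K.+1|))).
      by rewrite ler_wpM2l ?(ltW cb).
    by rewrite mulrA mulrCA mulfV ?gt_eqF// mulr1 ler_wpM2r.
case=> [|K]; first by rewrite big_ord0 normr0 /= mulr0.
have [_ h2 h3] := H K; split.
  by apply: (le_trans h2); rewrite ler_wpM2r// lps_ge0.
by apply: (le_trans h3); rewrite ler_wpM2r.
Qed.

(** The gap i occupies the positions 4 i to 4 i + 3 of the scale s. One position separates it from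
    the gap i + 1, so the gaps of all residue classes together form a single chain. *)
Definition gap i : set V := [set x | span v (s (4 * i + 3)) x /\ common_ker d (s (4 * i)) x].

(** The block i starts inside the gap i - N, its predecessor in the residue class modulo N, and ends
    at 4 i + 1, inside the gap i; for i < N it starts at the very beginning. Within a class the
    blocks are separated, and together with the gaps they leave no hole. *)
Definition block_start i := if (i < N)%N then 0%N else s (4 * (i - N) + 2).

Definition block i : set V :=
  [set x | span v (s (4 * i + 1)) x /\ common_ker d (block_start i) x].

Lemma gap_lin i t x y : gap i x -> gap i y -> gap i (t *: x + y).
Proof. by move=> [? ?] [? ?]; split; [exact: span_lin|exact: common_ker_lin]. Qed.
Lemma gap0 i : gap i 0.
Proof. by split; [exact: span0|exact: common_ker0]. Qed.
Lemma block_lin i t x y : block i x -> block i y -> block i (t *: x + y).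
Proof. by move=> [? ?] [? ?]; split; [exact: span_lin|exact: common_ker_lin]. Qed.
Lemma block0 i : block i 0.
Proof. by split; [exact: span0|exact: common_ker0]. Qed.
Lemma blockZ i t x : block i x -> block i (t *: x).
Proof. by move=> bx; rewrite -(addr0 (_ *: _)); apply: block_lin => //; exact: block0. Qed.
Lemma gapZ i t x : gap i x -> gap i (t *: x).
Proof. by move=> bx; rewrite -(addr0 (_ *: _)); apply: gap_lin => //; exact: gap0. Qed.

Lemma gap_chain (g : nat -> V) : (forall i, gap i (g i)) -> forall K,
  `|\sum_(k < K) g k| <= C * lps p K (fun k => `|g k|).
Proof.
move=> gg K; have [||||h _] := @chain_estimate g (fun k => 4 * k.+1)%N (fun k => 4 * k + 3)%N _ _ _ _ K => //.
- by move=> k; have [] := gg k.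
- by move=> k; have [] := gg k.+1.
- by move=> k; lia.
- by move=> k; lia.
Qed.

Section residue.
Variable j : nat.
Hypothesis jN : (j < N)%N.
Let idx k := (k * N + j)%N.

Let idx_lt k l : (k < l)%N -> (idx k < idx l)%N.
Proof. by rewrite /idx => kl; rewrite ltn_add2r ltn_pmul2r. Qed.

Let idx4 k : (4 * idx k + 3 < 4 * idx k.+1)%N.
Proof. by have := idx_lt (ltnSn k); move: (idx k) (idx k.+1) => a b; lia. Qed.

Let idx_ge k : (k <= idx k)%N.
Proof. by rewrite /idx (leq_trans _ (leq_addr _ _))// leq_pmulr. Qed.

Let block_start_idx k : block_start (idx k) =
  if k is k'.+1 then s (4 * idx k' + 2) else 0%N.
Proof.
rewrite /block_start /idx; case: k => [|k]; first by rewrite mul0n add0n jN.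
rewrite mulSn -addnA ltnNge leq_addr /=; congr (s (4 * _ + 2)).
by rewrite addnC addnK.
Qed.

Lemma gap_residue (g : nat -> V) : (forall k, gap (idx k) (g k)) -> forall K,
  `|\sum_(k < K) g k| <= C * lps p K (fun k => `|g k|) /\
  lps p K (fun k => `|g k|) <= C * `|\sum_(k < K) g k|.
Proof.
move=> gg K; have [||||h h'] := @chain_estimate g (fun k => 4 * idx k.+1)%N (fun k => 4 * idx k + 3)%N _ _ _ _ K => //.
- by move=> k; have [] := gg k.
- by move=> k; have [] := gg k.+1.
- by move=> k; have := idx_lt (ltnSn k); move: (idx k) (idx k.+1) => a b; lia.
Qed.

Lemma block_residue (g : nat -> V) : (forall k, block (idx k) (g k)) -> forall K,
  `|\sum_(k < K) g k| <= C * lps p K (fun k => `|g k|).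
Proof.
move=> gg K; have [||||h _] := @chain_estimate g (fun k => 4 * idx k + 2)%N (fun k => 4 * idx k + 1)%N _ _ _ _ K => //.
- by move=> k; have [] := gg k.
- by move=> k; have [_] := gg k.+1; rewrite block_start_idx.
- by move=> k; move: (idx k) => a; lia.
- by move=> k; have := idx_lt (ltnSn k); move: (idx k) (idx k.+1) => a b; lia.
Qed.

Section vanishing.
Variable f : dual V.
Hypothesis f_gap : forall k x, gap (idx k) x -> f x = 0.

Let ms k := if k is k'.+1 then s (4 * idx k') else 0%N.
Let ns k := if k is k'.+1 then s (4 * idx k' + 3) else 0%N.

(** State of the peeling of f: the remainder b vanishes on an initial span, and the part already
    removed lies in a finite span of [d]. *)
Let inv k (b : dual V) := annih v (ns k) b /\ span d (ms k) (f - b).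

Let ms_le k : (ms k <= block_start (idx k))%N.
Proof.
rewrite block_start_idx; case: k => [//|k] /=; apply: ltnW; apply: s_mono.
by rewrite -[ltnLHS]addn0 ltn_add2l.
Qed.

Let start_le k : (block_start (idx k) <= s (4 * idx k))%N.
Proof.
rewrite block_start_idx; case: k => [//|k] /=; apply: ltnW; apply: s_mono.
by have := idx_lt (ltnSn k); move: (idx k) (idx k.+1) => a b; lia.
Qed.

Let ns_le k : (ns k <= ns k.+1)%N.
Proof.
case: k => [//|k] /=; apply: ltnW; apply: s_mono.
by have := idx_lt (ltnSn k); move: (idx k) (idx k.+1) => a b; lia.
Qed.

(** On the gap both f and f - b vanish, so b vanishes there and splits. The part a is a dual block
    that lives between the previous gap of the class and this one. *)
Let inv_step k (b : dual V) : inv k b -> exists a b' : dual V,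
  [/\ b = a + b', span d (ms k.+1) a, annih v (ns k) a & inv k.+1 b'].
Proof.
move=> [ab sfb]; have [|a [b' [E sa ab']]] := @annih_split _ _ v d (ms k.+1) (ns k.+1) b.
  move=> x sx kx; have fx : f x = 0 by apply: (f_gap (k := k)).
  have := span_ker sfb; move=> /(_ x); rewrite dualB fx sub0r => h.
  apply/eqP; rewrite -oppr_eq0; apply/eqP/h; apply: common_ker_mono kx.
  exact: leq_trans (ms_le k) (start_le k).
exists a, b'; split => //.
  have -> : a = b - b' by rewrite E addrK.
  by apply: annihB => //; exact: annih_mono (ns_le k) _ ab'.
split => //; have -> : f - b' = (f - b) + a by rewrite E opprD addrA [RHS]addrAC subrK.
apply: spanD => //; apply: span_mono sfb.
exact: leq_trans (ms_le k) (start_le k).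
Qed.

Let cc_le i : c i.+1 / c i <= C.
Proof. by rewrite ler_pdivrMr// (le_trans (cC _))// ler_peMr// (le_trans _ C1). Qed.

(** The block sticks out of the dual block by one position of the scale at each end; these two
    margins carry the two relations that [block_norm] requires. *)
Let block_step k (a : dual V) (delta : R) : span d (ms k.+1) a -> annih v (ns k) a -> 0 < delta ->
  exists g, [/\ block (idx k) g, `|g| <= 1, 0 <= a g & `|a| <= C * C * a g + delta].
Proof.
move=> sa aa d0; have C0 : 0 <= C by apply: le_trans C1.
have D1 : dual_rel p v d (ms k.+1) (s (4 * idx k + 1)) C.
  by apply: (dual_rel_mono p1 (leqnn _) (cc_le _)); apply: s_dual; rewrite addn1.
have D2 : dual_rel p v d (block_start (idx k)) (ns k) C.
  rewrite block_start_idx; case: (k) => [|k'] /=; first exact: dual_rel0.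
  apply: (dual_rel_mono p1 (leqnn _) (cc_le _)); apply: s_dual.
  by rewrite ltn_add2l.
have [g [sg kg g1 ag ale]] := block_norm p1 C0 C0 D1 D2 (start_le k) sa aa d0.
by exists g.
Qed.

(** C^4 is ample for norming one dual block, which costs C^2; dividing by c lets the constants of
    the successive splittings telescope, as [thE] below shows. *)
Let E k := C ^+ 4 / c (4 * idx k).

(** The head a is normed by one block, the rest by induction. Weights x and y that almost attain the
    dual norm of (|a|, |b1|) keep the [lps] norm at most 1. The final remainder b' is carried
    along. *)
Let block_induction K k (b : dual V) : inv k b -> forall delta : R, 0 < delta -> exists (h : nat -> V) (b' : dual V),
  [/\ forall l, block (idx (k + l)) (h l), lps p K (fun l => `|h l|) <= 1,
      0 <= f (\sum_(l < K) h l), inv (k + K) b' &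
      `|b| <= E k * (f (\sum_(l < K) h l) + `|b'|) + delta].
Proof.
elim: K k b => [|K IH] k b Ib delta d0.
  exists (fun=> 0), b; rewrite big_ord0 dapp0 addn0 add0r; split => //.
    by move=> l; exact: block0.
  have : `|b| <= E k * `|b|; last by lra.
  rewrite ler_peMl// /E ler_pdivlMr// mul1r (le_trans (cC _))//.
  by rewrite exprS ler_peMr ?(le_trans _ C1)// exprn_ege1.
have [a [b1 [bE sa aa Ib1]]] := inv_step Ib.
have C0 : 0 < C by apply: lt_le_trans C1.
have d1 : 0 < delta / (4 * C) by rewrite divr_gt0// mulr_gt0.
set del := delta / (4 * C) in d1.
have delE : C * del = delta / 4 by rewrite /del; field; rewrite gt_eqF.
clearbody del.
have [g [bg g1 ag0 ag]] := block_step sa aa d1.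
have [h [b' [bh lh fh0 Ib' b1le]]] := IH k.+1 b1 Ib1 del d1.
have [x [y [x0 y0 xy ab1]]] := lpd_adh p1 (normr_ge0 a) (normr_ge0 b1) d1.
have x1 : x <= 1 by rewrite (le_trans (ler_norm _))// (le_trans (lp_lel p1 x y)).
have y1 : y <= 1 by rewrite (le_trans (ler_norm _))// (le_trans (lp_ler p1 x y)).
have lt43 : (4 * idx k < 4 * idx k + 3)%N by rewrite -[ltnLHS]addn0 ltn_add2l.
have [blk _] := s_dual lt43 sa Ib1.1.
set th := c (4 * idx k).+1 / c (4 * idx k) in blk.
have th0 : 0 <= th by rewrite divr_ge0 ?(ltW (c0 _)).
have thC : th <= C by exact: cc_le.
have Ek0 : 0 <= E k by rewrite divr_ge0 ?exprn_ge0 ?(ltW C0) ?(ltW (c0 _)).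
have thE : th * E k.+1 <= E k.
  have -> : th * E k.+1 = E k * (c (4 * idx k).+1 / c (4 * idx k.+1)).
    by rewrite /th /E; field; rewrite !gt_eqF.
  rewrite ler_piMr// ler_pdivrMr// mul1r; apply: c_mono.
  by apply: leq_trans (ltnW (idx4 k)); rewrite -addn1 leq_add2l.
have thCC : th * (C * C) <= E k.
  rewrite /E ler_pdivlMr// mulrC.
  have -> : C ^+ 4 = C * (C * (C * C)) by rewrite !exprS expr0 mulr1.
  have CC0 : 0 <= C * C by rewrite mulr_ge0// ltW.
  apply: ler_pM; [exact: ltW|exact: (mulr_ge0 th0 CC0)|exact: cC|].
  by rewrite ler_wpM2r.
(* On the block the functionals f and a agree: f - b is killed by the kernel condition on g, and b1
   by the span condition. *)
have fga : f g = a g.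
  have [sg kg] := bg.
  have h1 : dapp (f - b) g = 0.
    by apply: (span_ker Ib.2); apply: common_ker_mono kg; exact: ms_le.
  have h2 : b1 g = 0.
    apply: Ib1.1; apply: span_mono sg; apply: ltnW; apply: s_mono.
    by rewrite ltn_add2l.
  by move: h1; rewrite dualB bE dualD h2 addr0 => /eqP; rewrite subr_eq0 => /eqP.
exists (fun l => if l is l'.+1 then y *: h l' else x *: g), b'.
have sumE : \sum_(l < K.+1) (if (l : nat) is l'.+1 then y *: h l' else x *: g) =
    x *: g + y *: \sum_(l < K) h l.
  by rewrite big_ord_recl/= scaler_sumr.
rewrite sumE dappD !dappZ fga addnS -addSn; split => //.
- case=> [|l]; first by rewrite addn0; exact: blockZ.
  by rewrite addnS -addSn; exact: blockZ.
- rewrite -add1n lps_cat//; apply: le_trans xy.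
  rewrite (@eq_lps _ p K _ (fun l => y * `|h l|)); last first.
    by move=> l _; rewrite add1n normrZ ger0_norm.
  rewrite lpsZ//= lp0l// normr_id normrZ (ger0_norm x0).
  apply: lp_le => //; first by rewrite mulr_ge0//= ler_piMr.
  by rewrite mulr_ge0 ?lps_ge0//= ler_piMr.
- by rewrite addr_ge0// mulr_ge0.
set F := f (\sum_(l < K) h l) in fh0 b1le *.
rewrite -bE in blk.
have q1 : x * `|a| <= x * (C * C * a g + del) by rewrite ler_wpM2l.
have q2 : y * `|b1| <= y * (E k.+1 * (F + `|b'|) + del) by rewrite ler_wpM2l.
have q3 : lpd p `|a| `|b1| <= x * (C * C * a g + del) + y * (E k.+1 * (F + `|b'|) + del) + del.
  by move: ab1; lra.
have q4 := ler_wpM2l th0 q3.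
have q5 : th * (C * C) * (x * a g) <= E k * (x * a g) by rewrite ler_wpM2r// mulr_ge0.
have q6 : th * E k.+1 * (y * (F + `|b'|)) <= E k * (y * (F + `|b'|)).
  by rewrite ler_wpM2r// mulr_ge0// addr_ge0.
have q7 : E k * (y * `|b'|) <= E k * `|b'| by rewrite ler_wpM2l// ler_piMl.
have xd : x * del <= del by rewrite ler_piMl// ltW.
have yd : y * del <= del by rewrite ler_piMl// ltW.
have q8 := ler_pM th0 (mulr_ge0 x0 (ltW d1)) thC xd.
have q9 := ler_pM th0 (mulr_ge0 y0 (ltW d1)) thC yd.
have q10 : th * del <= C * del by rewrite ler_wpM2r// ltW.
apply: (le_trans blk); apply: (le_trans q4).
clear q1 q2 q3 q4 ab1 b1le blk; lra.
Qed.

Lemma dual_approx_span (f0 : dual V) (e : R) : 0 < e -> exists M (a : dual V), span d M a /\ `|f0 - a| <= e.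
Proof.
move=> e0; have [->|n0] := eqVneq f0 0.
  by exists 0%N, 0; rewrite subrr normr0 (ltW e0); split => //; exact: span0.
have p0 : 0 < `|f0| by rewrite normr_gt0.
have [|i fi] := @d_dense (`|f0|^-1 *: f0) _ _ (divr_gt0 e0 p0).
  by rewrite normrZ normfV normr_id mulVf// gt_eqF.
exists i.+1, (`|f0| *: d i); split; first by apply: spanZ; exact: span_gen.
have -> : f0 - `|f0| *: d i = `|f0| *: (`|f0|^-1 *: f0 - d i).
  by rewrite scalerBr scalerA mulfV ?gt_eqF// scale1r.
by rewrite normrZ normr_id -ler_pdivlMl// mulrC.
Qed.

(** The remainder is removed here: f is close to some a in a finite span of [d], and once the
    peeling has passed this span the dual relation bounds b' by C |f - a|. *)
Lemma vanishing_normed (delta : R) : 0 < delta -> exists K (h : nat -> V),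
  [/\ forall k, block (idx k) (h k), lps p K (fun k => `|h k|) <= 1 &
      `|f| <= C ^+ 4 * f (\sum_(k < K) h k) + delta].
Proof.
move=> d0; have C0 : 0 < C by apply: lt_le_trans C1.
pose del := delta / (2 * C ^+ 5).
have C5 : 0 < C ^+ 5 by rewrite exprn_gt0.
have del0 : 0 < del by rewrite divr_gt0// mulr_gt0.
have [M [a [sa fa]]] := dual_approx_span f del0.
have i0 : inv 0 f by split; [move=> x [? ->]; rewrite big_ord0 dapp0|rewrite subrr; exact: span0].
have [h [b' [bh lh fh0 [ab' sb'] fle]]] := @block_induction M.+1 0%N f i0 _ (divr_gt0 d0 (ltr0n R 2)).
rewrite add0n in ab' sb' *.
exists M.+1, h; split => //.
have lt03 : (4 * idx M < 4 * idx M + 3)%N by rewrite -[ltnLHS]addn0 ltn_add2l.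
have sa' : span d (s (4 * idx M)) (f - b' - a).
  apply: spanB => //; apply: span_mono sa; apply: leq_trans (homo_leq_id s_mono _).
  by apply: leq_trans (idx_ge M) _; rewrite leq_pmull.
have [_ r2] := dual_rel_mono p1 (leqnn _) (cc_le _) (s_dual lt03) sa' ab'.
have b'le : `|b'| <= C * del.
  apply: (le_trans (lpd_ler p1 (normr_ge0 (f - b' - a)) (normr_ge0 b'))).
  apply: (le_trans r2); rewrite ler_wpM2l ?(ltW C0)//.
  by have -> : f - b' - a + b' = f - a by rewrite addrAC subrK.
apply: (le_trans fle).
have EC : E 0 <= C ^+ 4.
  by rewrite /E ler_pdivrMr// ler_peMr// exprn_ge0// ltW.
have E00 : 0 <= E 0 by rewrite divr_ge0 ?exprn_ge0 ?(ltW C0) ?(ltW (c0 _)).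
set F := f _ in fh0 *.
have q1 : E 0 * F <= C ^+ 4 * F by rewrite ler_wpM2r.
have q2 : E 0 * `|b'| <= C ^+ 4 * (C * del) by apply: ler_pM.
have q3 : C ^+ 4 * (C * del) = delta / 2.
  by rewrite /del; field; rewrite gt_eqF.
lra.
Qed.

End vanishing.
(** If f is small on the gaps of the class, some g of norm at most eta C agrees with f on their
    span, and f - g vanishes on the gaps. Putting g back costs eta C in the norm of f and C^4 (eta
    C) C in the value on the blocks, whence 2 C^6 eta. *)
Lemma residue_normed (f : dual V) (eta : R) : 0 <= eta ->
  (forall K (t : nat -> V), (forall k, gap (idx k) (t k)) -> lps p K (fun k => `|t k|) <= 1 ->
    f (\sum_(k < K) t k) <= eta) ->
  forall delta : R, 0 < delta -> exists K (h : nat -> V),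
  [/\ forall k, block (idx k) (h k), lps p K (fun k => `|h k|) <= 1 &
      `|f| <= C ^+ 4 * f (\sum_(k < K) h k) + 2 * C ^+ 6 * eta + delta].
Proof.
move=> eta0 Heta delta d0; have C0 : 0 <= C by apply: le_trans C1.
pose P := [set x | exists K (t : nat -> V), (forall k, gap (idx k) (t k)) /\ x = \sum_(k < K) t k].
have gext K (t : nat -> V) M : (K <= M)%N -> 
    \sum_(k < K) t k = \sum_(k < M) (if (k < K)%N then t k else 0).
  by move=> KM; rewrite (big_ord_widen M t KM) big_mkcond.
have P0 : P 0 by exists 0%N, (fun=> 0); rewrite big_ord0; split => // k; exact: gap0.
have Pl a x y : P x -> P y -> P (a *: x + y).
  move=> [K [t [gt ->]]] [M [u [gu ->]]].
  exists (maxn K M), (fun k => a *: (if (k < K)%N then t k else 0) + (if (k < M)%N then u k else 0)).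
  split; first by move=> k; apply: gap_lin; case: ifP => _ //; exact: gap0.
  by rewrite big_split /= -scaler_sumr -!gext// ?leq_maxl ?leq_maxr.
have eC : 0 <= eta * C by rewrite mulr_ge0.
have fP x : P x -> f x <= eta * C * `|x|.
  move=> [K [t [gt ->]]]; have := (gap_residue gt K).2; set S := \sum_(k < K) t k => lS.
  apply: (@le_trans _ _ (eta * lps p K (fun k => `|t k|))); last first.
    by rewrite -mulrA ler_wpM2l.
  set L := lps _ _ _ in lS *; have L0 : 0 <= L by exact: lps_ge0.
  have [L00|Ln] := eqVneq L 0.
    have -> : S = 0.
      apply: big1 => k _; apply/eqP; rewrite -normr_le0 -L00.
      by have := lps_coord p1 (fun k => `|t k|) (ltn_ord k); rewrite normr_id.
    by rewrite dapp0 L00 mulr0.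
  have Lp : 0 < L by rewrite lt_neqAle eq_sym Ln.
  have iL : 0 <= L^-1 by rewrite invr_ge0.
  have := Heta K (fun k => L^-1 *: t k) (fun k => gapZ _ (gt k)).
  rewrite -scaler_sumr dappZ -/S ler_pdivrMl// mulrC; apply.
  rewrite (@eq_lps _ p K _ (fun l => L^-1 * `|t l|)); last first.
    by move=> l _; rewrite normrZ ger0_norm.
  by rewrite lpsZ// mulVf.
have [g [gf gC]] := dual_extend eC P0 Pl fP.
have fg0 k x : gap (idx k) x -> dapp (f - g) x = 0.
  move=> gx; rewrite dualB gf ?subrr//.
  exists k.+1, (fun l => if l == k then x else 0); split.
    by move=> l; case: eqP => [->//|_]; exact: gap0.
  rewrite big_ord_recr /= eqxx big1 ?add0r// => l _.
  by rewrite ltn_eqF.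
have [K [h [bh lh fgle]]] := vanishing_normed fg0 d0.
exists K, h; split => //.
set S := \sum_(k < K) h k in fgle *.
have S1 : `|S| <= C.
  by apply: (le_trans (block_residue bh K)); rewrite ler_piMr.
have gS : - g S <= eta * C * C.
  rewrite -dappN (le_trans (dual_le _ _))// normrN ler_pM//.
have f1 : `|f| <= `|f - g| + `|g| by rewrite -{1}(subrK g f) ler_normD.
rewrite dualB in fgle.
have C4 : 0 <= C ^+ 4 by rewrite exprn_ge0.
have q1 : C ^+ 4 * - g S <= C ^+ 6 * eta.
  have -> : C ^+ 6 * eta = C ^+ 4 * (eta * C * C) by ring.
  by rewrite ler_wpM2l.
have q2 : eta * C <= C ^+ 6 * eta.
  by rewrite mulrC ler_wpM2r// -[leLHS]expr1 ler_weXn2l.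
lra.
Qed.

End residue.

(** Sequences of norm at most 1, one for each class, are interleaved; the norm of the result is at
    most that of N ones. *)
Lemma merge_residues (T : nat -> set V) (K : nat -> nat) (u : nat -> nat -> V) :
  (forall i, T i 0) -> (forall j k, (j < N)%N -> T (k * N + j)%N (u j k)) ->
  (forall j, (j < N)%N -> lps p (K j) (fun k => `|u j k|) <= 1) ->
  exists L w, [/\ forall i, T i (w i), lps p L (fun i => `|w i|) <= kappa p N &
    \sum_(i < L) w i = \sum_(j < N) \sum_(k < K j) u j k].
Proof.
move=> T0 Tu lu; pose M := \max_(j < N) K j.
have KM j : (j < N)%N -> (K j <= M)%N by move=> jN; exact: (leq_bigmax (Ordinal jN)).
pose u' j k := if (k < K j)%N then u j k else 0.
exists (M * N)%N, (fun i => u' (i %% N)%N (i %/ N)%N).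
have mN k j : (j < N)%N -> ((k * N + j) %% N = j)%N /\ ((k * N + j) %/ N = k)%N.
  by move=> jN; rewrite modnMDl modn_small// divnMDl// divn_small// addn0.
split.
- move=> i; rewrite /u'; case: ifP => // _; rewrite {1}(divn_eq i N).
  exact: Tu (ltn_pmod _ N0).
- rewrite lps_residues//; apply: lps_le => // j jN; rewrite lps_ge0//=.
  apply: le_trans (lu j jN).
  rewrite (lps_widen p1 (KM j jN)); last first.
    move=> k /andP[Kk _]; have [-> ->] := mN k j jN.
    by rewrite /u' ltnNge Kk normr0.
  apply: lps_le => // k kK; have [-> ->] := mN k j jN.
  by rewrite /u' kK normr_ge0 lexx.
- rewrite (@sum_residues _ N M (fun i => u' (i %% N)%N (i %/ N)%N)); apply: eq_bigr => j _.
  rewrite [RHS](big_ord_widen M (u j) (KM j (ltn_ord j))) [RHS]big_mkcond /=.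
  by apply: eq_bigr => k _; have [-> ->] := mN k j (ltn_ord j).
Qed.

(** The l_p estimate inside each class, the triangle inequality over the classes and Hoelder's
    inequality between the N partial norms: together they dictate the weight kappa N / N. *)
Lemma blocks_upper k : N = (2 ^ k)%N -> forall L (g : nat -> V), (forall i, block i (g i)) ->
  kappa p N / N%:R * `|\sum_(i < L) g i| <= C * lps p L (fun i => `|g i|).
Proof.
move=> Nk L g bg.
have N0' : 0 < N%:R :> R by rewrite ltr0n.
have LN : (L <= L * N)%N by rewrite leq_pmulr.
pose g' i := if (i < L)%N then g i else 0.
have bg' i : block i (g' i) by rewrite /g'; case: ifP => // _; exact: block0.
have -> : \sum_(i < L) g i = \sum_(j < N) \sum_(m < L) g' (m * N + j)%N.
  by rewrite -(@sum_residues _ N L g') (big_ord_widen _ g LN) big_mkcond.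
pose b j := lps p L (fun m => `|g' (m * N + j)%N|).
have -> : lps p L (fun i => `|g i|) = lps p N b.
  rewrite -(lps_residues p1 L (fun i => `|g' i|) N0) (lps_widen p1 LN); last first.
    by move=> i /andP[Li _]; rewrite /g' ltnNge Li normr0.
  by apply: eq_lps => i iL; rewrite /g' iL.
have b0 j : 0 <= b j by exact: lps_ge0.
rewrite mulrAC ler_pdivrMr// mulrAC -mulrA [kappa p N * _]mulrC.
apply: (@le_trans _ _ (C * (\sum_(j < N) b j) * kappa p N)).
  rewrite ler_wpM2r ?lps_ge0// mulr_sumr (le_trans (ler_norm_sum _ _ _))//.
  by apply: ler_sum => j _; apply: block_residue.
rewrite -!mulrA ler_wpM2l ?(le_trans _ C1)//.
by rewrite Nk; apply: le_trans (sum_kappa_le p1 k b0) _; rewrite mulrC.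
Qed.

(** [eta j] measures f on the gaps of class j. All gaps form one chain, so merging almost optimal
    choices bounds the sum of the [eta j] by about |f| C kappa N. Averaging [residue_normed] over j
    leaves a small multiple of |f|, and absorbing it costs one more factor C. *)
Lemma blocks_lower (f : dual V) (delta : R) : 2 * C ^+ 7 * (kappa p N / N%:R) <= 1 - C^-1 ->
  0 < delta -> exists L g, [/\ forall i, block i (g i), lps p L (fun i => `|g i|) <= 1 &
    `|f| <= C ^+ 5 * (kappa p N / N%:R * f (\sum_(i < L) g i)) + delta].
Proof.
move=> HN d0; have C0 : 0 < C by apply: lt_le_trans C1.
have N0' : 0 < N%:R :> R by rewrite ltr0n.
have k0 : 0 < kappa p N by exact: kappa_gt0.
pose A j := [set x : R | exists K (t : nat -> V), [/\ forall k, gap (k * N + j)%N (t k),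
  lps p K (fun k => `|t k|) <= 1 & x = f (\sum_(k < K) t k)]].
have A0 j : A j 0.
  by exists 0%N, (fun=> 0); rewrite big_ord0 dapp0; split => // k; exact: gap0.
have As j : (j < N)%N -> has_sup (A j).
  move=> jN; split; first by exists 0.
  exists (`|f| * C) => _ [K [t [gt lt ->]]]; rewrite (le_trans (dual_le _ _))// ler_wpM2l//.
  by apply: (le_trans (gap_residue jN gt K).1); rewrite ler_piMr// ltW.
pose eta j := sup (A j).
have eta0 j : (j < N)%N -> 0 <= eta j by move=> jN; apply: ub_le_sup => //; exact: (As j jN).2.
pose del := delta / (4 * C ^+ 7).
have del0 : 0 < del by rewrite divr_gt0// mulr_gt0// exprn_gt0.
have /choice[tt ttE] : forall j, exists Kt : nat * (nat -> V), (j < N)%N ->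
    [/\ forall k, gap (k * N + j)%N (Kt.2 k), lps p Kt.1 (fun k => `|Kt.2 k|) <= 1 &
      eta j - del <= f (\sum_(k < Kt.1) Kt.2 k)].
  move=> j; have [jN|jN] := ltnP j N; last by exists (0%N, fun=> 0).
  have [_ [K [t [gt lt ->]]] h] := sup_adherent del0 (As j jN).
  by exists (K, t) => _; split => //; exact: ltW.
have [L [w [gw lw sw]]] := @merge_residues gap (fun j => (tt j).1) (fun j => (tt j).2) gap0
  (fun j k jN => let: And3 h _ _ := ttE j jN in h k) (fun j jN => let: And3 _ h _ := ttE j jN in h).
have sum_eta : \sum_(j < N) eta j <= `|f| * (C * kappa p N) + N%:R * del.
  have : \sum_(j < N) (eta j - del) <= f (\sum_(i < L) w i).
    rewrite sw dapp_sum; apply: ler_sum => j _.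
    by have [] := ttE j (ltn_ord j).
  rewrite sumrB sumr_const card_ord -[del *+ N]mulr_natl lerBlDr => /le_trans; apply.
  rewrite lerD2r (le_trans (dual_le _ _))// ler_wpM2l// (le_trans (gap_chain gw L))//.
  by rewrite ler_wpM2l// ltW.
have /choice[hh hhE] : forall j, exists Kt : nat * (nat -> V), (j < N)%N ->
    [/\ forall k, block (k * N + j)%N (Kt.2 k), lps p Kt.1 (fun k => `|Kt.2 k|) <= 1 &
      `|f| <= C ^+ 4 * f (\sum_(k < Kt.1) Kt.2 k) + 2 * C ^+ 6 * eta j + delta / (4 * C)].
  move=> j; have [jN|jN] := ltnP j N; last by exists (0%N, fun=> 0).
  have [||K [h [bh lh fh]]] := residue_normed jN (f := f) (eta0 j jN) _ (delta := delta / (4 * C)).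
  - by move=> K t gt lt; apply: ub_le_sup; [exact: (As j jN).2|exists K, t].
  - by rewrite divr_gt0// mulr_gt0.
  by exists (K, h).
have [M [u [bu lu su]]] := @merge_residues block (fun j => (hh j).1) (fun j => (hh j).2) block0
  (fun j k jN => let: And3 h _ _ := hhE j jN in h k) (fun j jN => let: And3 _ h _ := hhE j jN in h).
(* The merged blocks have [lps] norm up to kappa N. After division by it, the weighted value of f is
   the plain average F / N over the classes. *)
exists M, (fun i => (kappa p N)^-1 *: u i); split.
- by move=> i; exact: blockZ.
- rewrite (@eq_lps _ p M _ (fun i => (kappa p N)^-1 * `|u i|)); last first.
    by move=> i _; rewrite normrZ ger0_norm// invr_ge0 ltW.
  have ik : 0 <= (kappa p N)^-1 by rewrite invr_ge0 ltW.
  by rewrite lpsZ// ler_pdivrMl// mulr1.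
rewrite -scaler_sumr dappZ; set F := f _.
have -> : kappa p N / N%:R * ((kappa p N)^-1 * F) = F / N%:R by field; rewrite !gt_eqF.
have S : N%:R * `|f| <= C ^+ 4 * F + 2 * C ^+ 6 * (\sum_(j < N) eta j) + N%:R * (delta / (4 * C)).
  have : \sum_(j < N) `|f| <= \sum_(j < N) (C ^+ 4 * f (\sum_(k < (hh j).1) (hh j).2 k) +
      2 * C ^+ 6 * eta j + delta / (4 * C)).
    by apply: ler_sum => j _; have [] := hhE j (ltn_ord j).
  by rewrite !big_split/= !sumr_const card_ord -[`|f| *+ N]mulr_natl -[(_ / _) *+ N]mulr_natl -!mulr_sumr /F su dapp_sum.
have C6 : 0 <= 2 * C ^+ 6 by rewrite mulr_ge0// exprn_ge0// ltW.
have S2 := ler_wpM2l C6 sum_eta.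
have S3 : `|f| <= C ^+ 4 * (F / N%:R) + 2 * C ^+ 7 * (kappa p N / N%:R) * `|f| + 2 * C ^+ 6 * del + delta / (4 * C).
  rewrite -(ler_pM2l N0') !mulrDr.
  have -> : N%:R * (C ^+ 4 * (F / N%:R)) = C ^+ 4 * F by field; rewrite gt_eqF.
  have -> : N%:R * (2 * C ^+ 7 * (kappa p N / N%:R) * `|f|) = 2 * C ^+ 6 * (`|f| * (C * kappa p N)).
    by field; rewrite gt_eqF.
  lra.
have S4 := ler_wpM2r (normr_ge0 f) HN.
have delE : 2 * C ^+ 6 * del + delta / (4 * C) = 3 * delta / (4 * C).
  by rewrite /del; field; rewrite gt_eqF.
have S5 : C^-1 * `|f| <= C ^+ 4 * (F / N%:R) + 3 * delta / (4 * C) by lra.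
have S6 := ler_wpM2l (ltW C0) S5.
have E : C * (C^-1 * `|f|) = `|f| by rewrite mulrA mulfV ?gt_eqF// mul1r.
rewrite E in S6; apply: (le_trans S6).
have E5 : C ^+ 5 * (F / N%:R) = C * (C ^+ 4 * (F / N%:R)) by field; rewrite gt_eqF.
rewrite E5 mulrDr lerD2l.
have -> : C * (3 * delta / (4 * C)) = 3 / 4 * delta by field; rewrite gt_eqF.
lra.
Qed.

End blocks.

Section blocks_existence.
Context {R : realType} {V : normedModType R} (p : \bar R) (p1s : (1 < p)%E).
Let p1 : (1 <= p)%E := ltW p1s.
Variables (v : nat -> V) (d : nat -> dual V).
Hypothesis v_dense : forall x (e : R), 0 < e -> exists i, `|x - v i| <= e.
Hypothesis d_dense : forall f : dual V, `|f| = 1 -> forall e : R, 0 < e -> exists i, `|f - d i| <= e.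
Hypothesis mV : asymptotic_lp V p.
Hypothesis mdV : asymptotic_dual_lp V p.

(* The lengths [_.*2] are even because, over the complex numbers, the blocks have
   to be complex subspaces: see [jay_closed_seq] below. *)
Theorem blocks_existence (C : R) : 1 < C -> exists (n m : nat -> nat) (w : R),
  let B i := [set x | span v (n i).*2 x /\ common_ker d (m i).*2 x] in
  [/\ 0 < w, (forall L (g : nat -> V), (forall i, B i (g i)) ->
      w * `|\sum_(i < L) g i| <= C * lps p L (fun i => `|g i|)) &
    (forall (f : dual V) (delta : R), 0 < delta -> exists L g,
      [/\ forall i, B i (g i), lps p L (fun i => `|g i|) <= 1 &
        `|f| <= C ^+ 5 * (w * f (\sum_(i < L) g i)) + delta])].
Proof.
(* The sequence increases from 1 and stays below C, so each ratio c (i + 1) / c i exceeds 1 while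
   all their products remain bounded by C. *)
move=> C1; pose c i : R := 1 + (C - 1) * (1 - i.+1%:R^-1).
have ii i : 0 < i.+1%:R^-1 :> R by rewrite invr_gt0.
have c_lt i : c i < c i.+1.
  rewrite /c ltrD2l ltr_pM2l ?subr_gt0// ltrD2l ltrN2 ltf_pV2 ?posrE//.
  by rewrite ltr_nat.
have c_mono i j : (i <= j)%N -> c i <= c j.
  move=> ij; rewrite -(subnKC ij); elim: (j - i)%N => [|k IH]; first by rewrite addn0.
  by rewrite addnS (le_trans IH)// ltW.
have cC i : c i <= C.
  have h : 0 < C - 1 by rewrite subr_gt0.
  by have := mulr_gt0 h (ii i); rewrite /c; move: (i.+1%:R^-1) => x; rewrite mulrBr; move: (_ * x) => y; lra.
have c_ge1 i : 1 <= c i.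
  apply: le_trans (c_mono 0%N i (leq0n _)).
  by rewrite /c invr1 subrr mulr0 addr0.
have c_gt0 i : 0 < c i by exact: lt_le_trans (c_ge1 i).
have th1 i : 1 < c i.+1 / c i by rewrite ltr_pdivlMr// mul1r.
have next i n : exists m, [/\ (n < m)%N, primal_rel p v d n.*2 m.*2 (c i.+1 / c i) &
    dual_rel p v d n.*2 m.*2 (c i.+1 / c i)].
  have [m1 h1] := primal_rel_ex p1 v d_dense mV n.*2 (th1 i).
  have [m2 h2] := dual_rel_ex p1 d v_dense mdV n.*2 (th1 i).
  exists (n + m1 + m2).+1; split; first by lia.
  - by apply: (primal_rel_mono p1 _ (lexx _)) h1; lia.
  - by apply: (dual_rel_mono p1 _ (lexx _)) h2; lia.
have /choice[F FE] : forall i_n : nat * nat, exists m, [/\ (i_n.2 < m)%N,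
    primal_rel p v d i_n.2.*2 m.*2 (c i_n.1.+1 / c i_n.1) &
    dual_rel p v d i_n.2.*2 m.*2 (c i_n.1.+1 / c i_n.1)].
  by move=> [i n]; exact: next.
pose t := fix t i := if i is i'.+1 then F (i', t i') else 0%N.
have t_lt i : (t i < t i.+1)%N by have [] := FE (i, t i).
have t_mono : {homo t : i j / (i < j)%N} by apply: homo_ltn => //; exact: ltn_trans.
have t_le : {homo t : i j / (i <= j)%N} by apply: ltW_homo.
pose s i := (t i).*2.
have s_mono : {homo s : i j / (i < j)%N} by move=> i j /t_mono; rewrite /s ltn_double.
have s_primal i j : (i < j)%N -> primal_rel p v d (s i) (s j) (c i.+1 / c i).
  move=> ij; have [_ h _] := FE (i, t i).
  by apply: (primal_rel_mono p1 _ (lexx _)) h; rewrite /s leq_double; exact: (t_le i.+1 j).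
have s_dual i j : (i < j)%N -> dual_rel p v d (s i) (s j) (c i.+1 / c i).
  move=> ij; have [_ _ h] := FE (i, t i).
  by apply: (dual_rel_mono p1 _ (lexx _)) h; rewrite /s leq_double; exact: (t_le i.+1 j).
have C0 : 0 < C by lra.
have C7 : 0 < 2 * C ^+ 7 by rewrite mulr_gt0// exprn_gt0.
have Ci : 0 < 1 - C^-1 by rewrite subr_gt0 invf_lt1.
have [k kk] := kappa_small p1 p1s (divr_gt0 Ci C7).
pose N := (2 ^ k)%N; have N0 : (0 < N)%N by rewrite expn_gt0.
have N0' : 0 < N%:R :> R by rewrite ltr0n.
exists (fun i => t (4 * i + 1)%N), (fun i => if (i < N)%N then 0%N else t (4 * (i - N) + 2)%N), (kappa p N / N%:R).
have BE i x : (span v (t (4 * i + 1)%N).*2 x /\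
    common_ker d (if (i < N)%N then 0%N else t (4 * (i - N) + 2)%N).*2 x) = block v d s N i x.
  by rewrite /block /block_start /s; case: ifP.
split.
- by rewrite divr_gt0// kappa_gt0.
- move=> L g gB; apply: (blocks_upper p1 s_mono c_ge1 c_mono cC s_primal N0 (erefl N)) => i.
  by rewrite -BE; exact: gB.
- move=> f delta d0.
  have [|L [g [bg lg fg]]] := blocks_lower p1 s_mono c_ge1 c_mono cC s_primal s_dual d_dense N0 f _ d0.
    by rewrite mulrC -ler_pdivlMr// ler_pdivrMr.
  by exists L, g; split => // i; have := bg i; rewrite -BE; exact.
Qed.

End blocks_existence.

(** * Real structure of a normed module over the scalars *)

Section scalar_parts.
Context {R : realType} {s : scalars}.
Local Notation K := (scalar_field R s).

(** The imaginary unit, or 1 over the reals. Its modulus is 1 in both cases, and closing a real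
    subspace under it is harmless over the reals, so the same arguments serve both fields. *)
Definition jay : K := match s return scalar_field R s with
  | RealScalars => 1 | ComplexScalars => 'i%C end.

Definition im_part : K -> R := match s return scalar_field R s -> R with
  | RealScalars => fun=> 0 | ComplexScalars => @complex.Im R end.

Lemma scalar_parts (k : K) : k = of_real (re_part k) + of_real (im_part k) * jay.
Proof.
rewrite /of_real /re_part /im_part /jay; move: k; case: s => /= k; first by rewrite mul0r addr0.
by rewrite [LHS]complexE mulrC.
Qed.

Lemma re_partD (a b : K) : re_part (a + b) = re_part a + re_part b.
Proof. by rewrite /re_part; move: a b; case: s => //= -[a a'] [b b']. Qed.

Lemma re_partZ (r : R) (a : K) : re_part (of_real r * a) = r * re_part a.
Proof.
rewrite /re_part /of_real; move: a; case: s => //= -[a a'] /=.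
by rewrite mul0r subr0.
Qed.

Lemma of_realN (r : R) : @of_real R s (- r) = - of_real r.
Proof. by rewrite -mulN1r of_realM -[RHS]mulN1r; congr (_ * _); apply: (addrI (of_real 1)); rewrite -of_realD !subrr ?of_real0 ?of_real1 ?subrr. Qed.

Lemma ler_re_part (a b : K) : a <= b -> re_part a <= re_part b.
Proof.
rewrite /re_part; move: a b; case: s => //= -[a a'] [b b'].
by rewrite lecE /= => /andP[].
Qed.

Lemma re_part_norm (a : K) : `|re_part a| <= rnorm (a : K^o).
Proof.
rewrite /rnorm; suff : of_real `|re_part a| <= `|a|.
  by move=> /ler_re_part; rewrite of_realK.
rewrite /re_part /of_real; move: a; case: s => //= a.
exact: normc_ge_Re.
Qed.

Lemma rnorm_of_real (r : R) : rnorm (of_real r : K^o) = `|r|.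
Proof.
rewrite /rnorm /of_real /re_part; case: s => //=.
apply: (etrans (congr1 (@complex.Re R) (normc_def (r%:C)%C))).
by rewrite /= expr0n addr0 sqrtr_sqr.
Qed.

Lemma rnorm_jay : rnorm (jay : K^o) = 1.
Proof.
rewrite /rnorm /jay /re_part; case: s => /=; first by rewrite normr1.
apply: (etrans (congr1 (@complex.Re R) (normc_def 'i%C))).
by rewrite /= expr0n add0r expr1n sqrtr1.
Qed.

Lemma rnormM (a b : K) : rnorm (a * b : K^o) = rnorm (a : K^o) * rnorm (b : K^o).
Proof.
apply: (can_inj (@of_realK R s)); rewrite of_realM.
by rewrite (rnormE (a * b : K^o)) (rnormE (a : K^o)) (rnormE (b : K^o)) normrM.
Qed.

Lemma rnorm_parts (k : K) : rnorm (k : K^o) <= `|re_part k| + `|im_part k|.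
Proof.
rewrite {1}(scalar_parts k) (le_trans (ler_rnormD _ _))// rnormM rnorm_jay mulr1.
by rewrite !rnorm_of_real.
Qed.

End scalar_parts.

Section rnorm_theory.
Context {R : realType} {s : scalars}.
Local Notation K := (scalar_field R s).
Variables X : normedModType K.

Lemma rnormZE (a : K) (x : X) : rnorm (a *: x) = rnorm (a : K^o) * rnorm x.
Proof. exact: rnormZ. Qed.

Lemma rnormN (x : X) : rnorm (- x) = rnorm x.
Proof. by rewrite /rnorm normrN. Qed.

Lemma cvg_rnormP (u : nat -> X) (l : X) : u @ \oo --> l <->
  forall e : R, 0 < e -> exists N, forall n, (N <= n)%N -> rnorm (u n - l) <= e.
Proof.
split=> [/cvgrPdist_le h e e0|h].
  have e0' : 0 < (of_real e : K) by rewrite -(@of_real0 R s) ltr_of_real.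
  have [N _ HN] := h _ e0'; exists N => n Nn; have := HN n Nn; rewrite distrC /= => k.
  by rewrite -(@ler_of_real _ s) rnormE.
apply/cvgrPdist_le => e e0.
have e0' : 0 < re_part e by rewrite -(@ltr_of_real _ s) of_real0 re_partK// ltW.
have [N HN] := h _ e0'; exists N => // n Nn; have := HN n Nn => /= k.
by rewrite distrC -rnormE -(re_partK (ltW e0)) ler_of_real.
Qed.

Lemma closed_rnormP (A : set X) : closed A <->
  forall x, (forall e : R, 0 < e -> exists2 a, A a & rnorm (x - a) <= e) -> A x.
Proof.
split=> [cA x xA|H x cx].
  apply: cA => B /nbhs_normP[e /= e0 xeB].
  have e0' : 0 < re_part e by rewrite -(@ltr_of_real _ s) of_real0 re_partK// ltW.
  have [a Aa xa] := xA _ (divr_gt0 e0' (ltr0n R 2)); exists a; split => //; apply: xeB => /=.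
  rewrite -rnormE -(re_partK (ltW e0)) ltr_of_real (le_lt_trans xa)//.
  by rewrite ltr_pdivrMr// ltr_pMr// ltr1n.
apply: H => e e0; have e0' : 0 < (of_real e : K) by rewrite -(@of_real0 R s) ltr_of_real.
have [|a [Aa xa]] := cx [set y | `|x - y| < of_real e].
  by apply/nbhs_normP; exists (of_real e).
by exists a => //; apply: ltW; rewrite -(@ltr_of_real _ s) rnormE.
Qed.

Lemma dense_rnormP (A : set X) : dense A <->
  forall x (e : R), 0 < e -> exists2 a, A a & rnorm (x - a) <= e.
Proof.
split=> [dA x e e0|H O [x Ox] oO].
  have e0' : 0 < (of_real e : K) by rewrite -(@of_real0 R s) ltr_of_real.
  have [|a [xa Aa]] := dA ((ball x (of_real e : K))^°) _ (@open_interior _ _).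
    by exists x; exact: nbhsx_ballx.
  exists a => //; have := interior_subset xa; rewrite -ball_normE /= => h.
  by apply: ltW; rewrite -(@ltr_of_real _ s) rnormE.
have /nbhs_normP[e /= e0 xeO] := open_nbhs_nbhs (conj oO Ox).
have e0' : 0 < re_part e by rewrite -(@ltr_of_real _ s) of_real0 re_partK// ltW.
have [a Aa xa] := H x _ (divr_gt0 e0' (ltr0n R 2)); exists a; split => //; apply: xeO => /=.
rewrite -rnormE -(re_partK (ltW e0)) ltr_of_real (le_lt_trans xa)//.
by rewrite ltr_pdivrMr// ltr_pMr// ltr1n.
Qed.

Lemma continuous_linearP (Y : normedModType K) (f : {linear X -> Y}) : continuous f <->
  exists2 C : R, 0 <= C & forall x, rnorm (f x) <= C * rnorm x.
Proof.
rewrite -linear_bounded_continuous; split.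
  move=> /linear_boundedP/pinfty_ex_gt0[r r0 fr].
  exists (re_part r); first by rewrite -(@ler_of_real _ s) of_real0 re_partK ltW.
  by move=> x; rewrite -(@ler_of_real _ s) of_realM (re_partK (ltW r0)) !rnormE.
move=> [C C0 fC]; apply/linear_boundedP; exists (of_real C); split.
  by apply: ger0_real; rewrite -(@of_real0 R s) ler_of_real.
move=> r Cr x; rewrite -!rnormE (@le_trans _ _ (of_real (C * rnorm x)))//.
  by rewrite ler_of_real.
by rewrite of_realM ler_wpM2r ?(ltW Cr)// -(@of_real0 R s) ler_of_real rnorm_ge0.
Qed.

End rnorm_theory.

Lemma cauchy_rnorm {R : realType} {s : scalars} (X : completeNormedModType (scalar_field R s))
    (u : nat -> X) :
  (forall e : R, 0 < e -> exists N, forall m n, (N <= m)%N -> (N <= n)%N -> rnorm (u m - u n) <= e) ->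
  exists l : X, u @ \oo --> l.
Proof.
move=> H; apply/cvg_ex; apply/cauchy_cvgP/cauchy_exP => e e0.
have e0' : 0 < re_part e by rewrite -(@ltr_of_real _ s) of_real0 re_partK// ltW.
have [N HN] := H _ (divr_gt0 e0' (ltr0n R 2)).
exists (u N), N => // n /= Nn; rewrite -ball_normE /=.
rewrite -rnormE -(re_partK (ltW e0)) ltr_of_real (le_lt_trans (HN _ _ _ Nn))//.
by rewrite ltr_pdivrMr// ltr_pMr// ltr1n.
Qed.

Section realify.
Context {R : realType} {s : scalars}.
Local Notation K := (scalar_field R s).
Variable X : normedModType K.

(** Restriction of scalars to the reals, with the norm valued in R: the preceding results on real
    spaces apply to it. *)
Definition realify : Type := X.

HB.instance Definition _ := GRing.Zmodule.on realify.

Let rscale (r : R) (x : realify) : realify := (of_real r : K) *: (x : X).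

Let rscaleA a b x : rscale a (rscale b x) = rscale (a * b) x.
Proof. by rewrite /rscale scalerA of_realM. Qed.
Let rscale1 : left_id 1 rscale.
Proof. by move=> x; rewrite /rscale of_real1 scale1r. Qed.
Let rscaleDr : right_distributive rscale +%R.
Proof. by move=> a x y; rewrite /rscale scalerDr. Qed.
Let rscaleDl x : {morph rscale^~ x : a b / a + b}.
Proof. by move=> a b; rewrite /rscale of_realD scalerDl. Qed.

HB.instance Definition _ := GRing.Zmodule_isLmodule.Build R realify
  rscaleA rscale1 rscaleDr rscaleDl.

Let rn (x : realify) : R := rnorm (x : X).
Let rnD x y : rn (x + y) <= rn x + rn y. Proof. exact: ler_rnormD. Qed.
Let rnZ (a : R) x : rn (a *: x) = `|a| * rn x.
Proof. by rewrite /rn rnormZE rnorm_of_real. Qed.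
Let rn_eq0 x : rn x = 0 -> x = 0. Proof. exact: rnorm_eq0. Qed.

HB.instance Definition _ := Lmodule_isNormed.Build R realify rnD rnZ rn_eq0.

Lemma realify_norm (x : X) : `|x : realify| = rnorm x. Proof. by []. Qed.
Lemma realifyZ (r : R) (x : X) : r *: (x : realify) = (of_real r : K) *: x. Proof. by []. Qed.

End realify.

Section limsup.
Context {R : realType}.
Implicit Types a : nat -> R.

Let bounded_of a (M : R) : (forall n, `|a n| <= M) -> bounded_fun a.
Proof.
move=> aM; exists M; split; first exact: num_real.
by move=> y My n _; apply: le_trans (aM n) (ltW My).
Qed.

Let sdrop_has_sup a (M : R) k : (forall n, `|a n| <= M) -> has_sup (sdrop a k).
Proof.
move=> aM; split; first by exists (a k), k => //=.
by exists M => _ [n _ <-]; apply: le_trans (ler_norm _) (aM n).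
Qed.

Let limsup_props a (M : R) : (forall n, `|a n| <= M) ->
  (forall e : R, 0 < e -> exists N, forall n, (N <= n)%N -> a n <= limn_sup a + e) /\
  (forall (e : R) N, 0 < e -> exists2 n, (N <= n)%N & limn_sup a - e <= a n).
Proof.
move=> aM; rewrite (limn_supE (bounded_of aM)).
have hi : has_inf (range (sups a)).
  split; first by exists (sups a 0), 0%N.
  exists (- M) => _ [n _ <-]; rewrite /sups /=; apply: le_trans (_ : a n <= _).
    by have := aM n; rewrite ler_norml => /andP[].
  by apply: ub_le_sup; [exact: (sdrop_has_sup n aM).2|exists n => /=].
split=> [e e0|e N e0].
  have [_ [N _ <-] h] := inf_adherent e0 hi; exists N => n Nn.
  apply: le_trans (ltW h); apply: ub_le_sup; first exact: (sdrop_has_sup N aM).2.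
  by exists n.
have [_ [n /= Nn <-] h] := sup_adherent e0 (sdrop_has_sup N aM); exists n => //.
apply: le_trans (ltW h); rewrite lerD2r; apply: ge_inf; first exact: hi.2.
by exists N.
Qed.

Lemma limn_sup_subseq a (M : R) : (forall n, `|a n| <= M) ->
  exists2 phi : nat -> nat, {homo phi : m n / (m < n)%N} & a (phi n) @[n --> \oo] --> limn_sup a.
Proof.
move=> aM; have [h1 h2] := limsup_props aM.
have [k N|phi hphi Hphi] := @extraction (fun k n => `|a n - limn_sup a| <= k.+1%:R^-1).
  have k0 : 0 < k.+1%:R^-1 :> R by rewrite invr_gt0.
  have [N1 HN1] := h1 _ k0; have [n Nn an] := h2 _ (maxn N N1) k0.
  move: Nn; rewrite geq_max => /andP[Nn /HN1 an']; exists n => //.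
  by rewrite ler_distl an an'.
exists phi => //; apply/cvgn_distP => e e0.
have /cvgn_distP/(_ _ e0)[N HN] := @cvg_harmonic R; exists N => n Nn.
by apply: (le_trans (Hphi n)); have := HN n Nn; rewrite subr0 => /(le_trans (ler_norm _)).
Qed.

Lemma limn_sup_ge a (M l : R) (phi : nat -> nat) : (forall n, `|a n| <= M) ->
  {homo phi : m n / (m < n)%N} -> a (phi n) @[n --> \oo] --> l -> l <= limn_sup a.
Proof.
move=> aM hphi al; have [h1 _] := limsup_props aM; apply/ler_addgt0Pr => e e0.
have e2 : 0 < e / 2 by rewrite divr_gt0.
have [N HN] := h1 _ e2; have /cvgn_distP/(_ _ e2)[N' HN'] := al.
have := HN (phi (maxn N N')) (leq_trans (leq_maxl _ _) (homo_leq_id hphi _)).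
have := HN' (maxn N N') (leq_maxr _ _); rewrite ler_distl => /andP[h _]; lra.
Qed.

End limsup.

Section functionals.
Context {R : realType} {s : scalars}.
Local Notation K := (scalar_field R s).
Variable X : normedModType K.
Local Notation Xr := (realify X).

Lemma im_partD (a b : K) : im_part (a + b) = im_part a + im_part b.
Proof. by rewrite /im_part; move: a b; case: s => //= [? ?|[a a'] [b b']]; rewrite ?addr0. Qed.

Lemma im_partZ (r : R) (a : K) : im_part (of_real r * a) = r * im_part a.
Proof.
rewrite /im_part /of_real; move: a; case: s => //= [?|[a a'] /=]; first by rewrite mulr0.
by rewrite mul0r addr0.
Qed.

Lemma im_part_norm (a : K) : `|im_part a| <= rnorm (a : K^o).
Proof.
have -> : rnorm (a : K^o) = rnorm (jay * a : K^o) by rewrite rnormM rnorm_jay mul1r.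
apply: le_trans (re_part_norm _).
rewrite /im_part /re_part /jay; move: a; case: s => /= a; first by rewrite normr0.
by case: a => a b /=; rewrite mul0r mul1r sub0r normrN.
Qed.

Lemma real_part_functional (f : {linear X -> K^o}) (C : R) : 0 <= C ->
  (forall x, rnorm (f x) <= C * rnorm x) ->
  exists phi : dual Xr, (forall x, phi x = re_part (f x)) /\ `|phi| <= C.
Proof.
move=> C0 fC; have [||phi [phiE phiC]] := @dual_make R Xr (fun x => re_part (f x)) C _ C0.
- by move=> t x y; rewrite linearD/= linearZ/= re_partD re_partZ.
- by move=> x; apply: le_trans (ler_norm _) (le_trans (re_part_norm _) (fC x)).
by exists phi.
Qed.

Lemma im_part_functional (f : {linear X -> K^o}) (C : R) : 0 <= C ->
  (forall x, rnorm (f x) <= C * rnorm x) ->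
  exists phi : dual Xr, (forall x, phi x = im_part (f x)) /\ `|phi| <= C.
Proof.
move=> C0 fC; have [||phi [phiE phiC]] := @dual_make R Xr (fun x => im_part (f x)) C _ C0.
- by move=> t x y; rewrite linearD/= linearZ/= im_partD im_partZ.
- by move=> x; apply: le_trans (ler_norm _) (le_trans (im_part_norm _) (fC x)).
by exists phi.
Qed.

End functionals.

(** Over the complex numbers f x = phi x - i phi (i x). The factor 2 comes from bounding the modulus
    by the sum of the two parts; boundedness is all that matters. *)
Lemma functional_of_real_part {R : realType} {s : scalars} (X : normedModType (scalar_field R s))
    (phi : dual (realify X)) :
  exists f : {linear X -> (scalar_field R s)^o},
    (forall x, re_part (f x) = phi x) /\ (forall x, rnorm (f x) <= 2 * `|phi| * rnorm x).
Proof.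
have key : exists f : X -> (scalar_field R s)^o, [/\ linear f, (forall x, re_part (f x) = phi x) &
    forall x, `|im_part (f x)| <= `|phi| * rnorm x].
  move: X phi; case: s => X phi.
    exists (phi : X -> R); split => // [a x y|x].
      exact: (dapp_linear phi a x y).
    by rewrite normr0 mulr_ge0// rnorm_ge0.
  pose i : R[i] := 'i%C.
  exists (fun x => (phi x +i* - phi (i *: x))%C); split => // [a x y|x] /=.
    have E (b : R[i]) (z : X) : phi (b *: z) = complex.Re b * phi z + complex.Im b * phi (i *: z).
      rewrite -!(dappZ phi) -dappD; congr (dapp phi).
      by rewrite {1}[b]complexE scalerDl mulrC -scalerA.
    rewrite scalerDr scalerA !dappD.
    rewrite (E a x) (E (i * a) x); case: a => a b.
    rewrite /i /= !mul0r !mul1r; simpc; congr Complex; ring.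
  rewrite normrN (le_trans (dual_ub _ _))// ler_wpM2l//.
  rewrite realify_norm rnormZE.
  by have := @rnorm_jay R ComplexScalars; rewrite /jay -/i => ->; rewrite mul1r.
have [f [fl fr fi]] := key.
pose fL : {linear X -> (scalar_field R s)^o} := HB.pack f (GRing.isLinear.Build _ _ _ _ _ fl).
exists fL; split => // x; rewrite (le_trans (rnorm_parts _))// -mulrA mulr_natl mulr2n lerD//.
by rewrite /= fr; exact: dual_ub.
Qed.

Section weak_conversion.
Context {R : realType} {s : scalars}.
Local Notation K := (scalar_field R s).
Variable X : normedModType K.
Local Notation Xr := (realify X).

Lemma weakly_nullP (u : nat -> X) : weakly_null u <-> wnull (u : nat -> Xr).
Proof.
split=> [H phi|H f /continuous_linearP[C C0 fC]].
  have [f [fr fn]] := functional_of_real_part phi.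
  have fc : continuous f by apply/continuous_linearP; exists (2 * `|phi|) => //; rewrite mulr_ge0.
  apply/cvgn_distP => e e0; have /cvg_rnormP/(_ _ e0)[N HN] := H f fc.
  exists N => n Nn; have := HN n Nn; rewrite !subr0 -fr.
  exact: le_trans (re_part_norm _).
have [f1 [f1E _]] := real_part_functional C0 fC.
have [f2 [f2E _]] := im_part_functional C0 fC.
apply/cvg_rnormP => e e0; have e2 : 0 < e / 2 by rewrite divr_gt0.
have /cvgn_distP/(_ _ e2)[N1 H1] := H f1; have /cvgn_distP/(_ _ e2)[N2 H2] := H f2.
exists (maxn N1 N2) => n; rewrite geq_max => /andP[/H1 h1 /H2 h2].
rewrite subr0 (le_trans (rnorm_parts _))// [e]splitr lerD//.
  by move: h1; rewrite subr0 f1E.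
by move: h2; rewrite subr0 f2E.
Qed.

Lemma separable_seq : separable X -> exists v : nat -> X,
  forall x (e : R), 0 < e -> exists i, rnorm (x - v i) <= e.
Proof.
move=> [A [cA dA]].
have /countable_injP[f finj] := cA.
have /choice[v vE] : forall n, exists a, (exists2 b, A b & f b = n) -> A a /\ f a = n.
  move=> n; have [[b Ab fb]|H] := pselect (exists2 b, A b & f b = n); first by exists b.
  by exists 0.
exists v => x e e0; have [a Aa xa] := (dense_rnormP A).1 dA x e e0.
exists (f a); have [|Av fv] := vE (f a); first by exists a.
by rewrite (finj _ _ _ _ fv)// inE.
Qed.

(** Every subsequence falls under (m_p) again, so the upper limit of |x + u n| has the same value
    along all of them, and this forces convergence. *)
Lemma property_m_asymptotic (p : \bar R) : property_m p X -> asymptotic_lp Xr p.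
Proof.
move=> mX x u t un ut.
have [M uM] : exists M, forall n, `|u n| <= M.
  have /cvg_seq_bounded [M [Mr H]] := cvgP _ ut.
  exists (M + 1) => n; rewrite -(normr_id (u n)); apply: H => //; first by rewrite ltrDl.
apply: cvgn_subseqs => phi hphi e e0.
have un' : weakly_null ((u : nat -> X) \o phi).
  by apply/weakly_nullP => f; exact: cvg_subseq hphi (un f).
have := mX x _ un'; rewrite (cvg_limn_inf_sup (cvg_subseq hphi ut)).2 => E.
have bd n : `| `|x + u (phi n)| | <= `|x| + M.
  by rewrite normr_id (le_trans (ler_normD _ _))// lerD2l.
have [psi hpsi] := limn_sup_subseq bd.
rewrite [limn_sup _]E => /cvgn_distP/(_ _ e0)[N /(_ N (leqnn N))].
rewrite ler_distl => /andP[h1 h2].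
by split; exists (psi N).
Qed.

(** For bounded sequences [limn_sup] is the true upper limit. A subsequence attaining it on the left
    side gives one inequality, and one attaining it on the right side gives the other. *)
Lemma asymptotic_property_m (p : \bar R) : (1 <= p)%E ->
  (forall u : nat -> X, weakly_null u -> exists M : R, forall n, rnorm (u n) <= M) ->
  asymptotic_lp Xr p -> property_m p X.
Proof.
move=> p1 bdd mX x u un; have [M uM] := bdd u un.
have /weakly_nullP un' := un.
have b1 n : `|rnorm (u n)| <= M by rewrite ger0_norm ?rnorm_ge0.
have b2 n : `|rnorm (x + u n)| <= rnorm x + M.
  by rewrite ger0_norm ?rnorm_ge0// (le_trans (ler_rnormD _ _))// lerD2l.
apply/eqP; rewrite eq_le; apply/andP; split.
  have [phi hphi cphi] := limn_sup_subseq b2.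
  have [|psi hpsi [t ct]] := @bounded_subseq_cvg R (fun n => rnorm (u (phi n))) M.
    by move=> n.
  have hc : {homo (phi \o psi) : m n / (m < n)%N} by move=> i j ij; apply: hphi; exact: hpsi.
  have := @mX x (u \o (phi \o psi)) t (fun f => cvg_subseq hc (un' f)) ct => c1.
  have c2 := cvg_subseq hpsi cphi.
  rewrite (cvg_unique (@Rhausdorff R) c2 c1) realify_norm; apply: lp_le => //.
    by rewrite rnorm_ge0 lexx.
  apply/andP; split; last exact: limn_sup_ge b1 hc ct.
  rewrite -(cvg_lim (@Rhausdorff R) ct); apply: limr_ge; first exact: cvgP ct.
  by apply: nearW => k; exact: rnorm_ge0.
have [phi hphi cphi] := limn_sup_subseq b1.
have := @mX x (u \o phi) _ (fun f => cvg_subseq hphi (un' f)) cphi => c1.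
exact: limn_sup_ge b2 hphi c1.
Qed.

End weak_conversion.

(** * The sums lp_sum *)

Section lp_norm_partial.
Context {R : realType} (p : \bar R) (p1 : (1 <= p)%E).
Local Notation mu := (@counting nat R).

Let counting_ae (P : nat -> Prop) :
  (\forall n \near almost_everywhere mu, P n) -> forall n, P n.
Proof.
move=> [A [_ A0 PA]] n; apply: contrapT => Pn.
have {Pn}An : A n by exact: PA.
move: A0; rewrite [LHS]/counting; case: ifPn => [/asboolP finA|_] //.
move=> /eqP; rewrite eqe pnatr_eq0 finmap.cardfs_eq0 => /eqP /(fset_set_set0 finA) A0.
by rewrite A0 in An.
Qed.

Lemma lps_pow (r : R) L (a : nat -> R) : 1 <= r -> (forall i, 0 <= a i) ->
  lps r%:E L a `^ r = \sum_(i < L) a i `^ r.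
Proof.
move=> r1 a0; have r0 : r != 0 by rewrite gt_eqF//; lra.
elim: L => [|L IH]; first by rewrite big_ord0 /= powR0.
rewrite big_ord_recr/= -IH.
have p0 : 0 <= lps r%:E L a by apply: lps_ge0; rewrite lee_fin.
rewrite (ger0_norm p0) (ger0_norm (a0 L)) -powRrM (mulVf r0) powRr1//.
by apply: addr_ge0; apply: powR_ge0.
Qed.

(** Reduces the norm of an infinite sequence to its finite segments, which makes the calculus of
    [lps] available in the sums. *)
Lemma Lnorm_counting_leP (b : nat -> R) (M : R) : (forall n, 0 <= b n) -> 0 <= M ->
  ('N[mu]_p[EFin \o b] <= M%:E)%E <-> forall L, lps p L b <= M.
Proof.
move=> b0 M0; case: p p1 => [r r1|_|//]; last first.
  have mu0 : (0 < mu [set: nat])%E.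
    by rewrite /counting asboolF ?lt0y//; exact: infinite_nat.
  rewrite unlock mu0; split.
    move=> /ess_supP/counting_ae H; elim=> [//|L IH] /=.
    rewrite ger0_norm ?lps_ge0 ?leey// ge_max IH /=.
    by have := H L; rewrite lee_fin.
  move=> H; apply/ess_supP; apply: nearW => n; rewrite /= lee_fin.
  by apply: le_trans (H n.+1) => /=; rewrite le_max lexx orbT.
rewrite lee_fin in r1; have r0 : 0 < r by lra.
have rn : r != 0 by rewrite gt_eqF.
have ri : 0 <= r^-1 by rewrite invr_ge0 ltW.
rewrite (Lnorm_counting _ r0).
pose c k : \bar R := (b k `^ r)%:E.
have cE k : (`|(EFin \o b) k| `^ r)%E = c k.
  by rewrite -[(EFin \o b) k]/((b k)%:E) abse_EFin poweR_EFin ger0_norm.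
have c0 k : (0 <= c k)%E by rewrite lee_fin powR_ge0.
under eq_eseriesr => k _ do rewrite cE.
set S := (\sum_(k <oo) c k)%E.
have S0 : (0 <= S)%E by apply: nneseries_ge0 => k _ _; exact: c0.
have partial L : (\sum_(0 <= k < L) c k = (lps r%:E L b `^ r)%:E)%E.
  by rewrite lps_pow// sumEFin big_mkord.
have l0 L : 0 <= lps r%:E L b by apply: lps_ge0; rewrite lee_fin.
have powK (x : R) : 0 <= x -> (((x `^ r)%:E) `^ r^-1)%E = x%:E.
  by move=> x0; rewrite poweR_EFin -powRrM (mulfV rn) (powRr1 x0).
have I (x : \bar R) : (0 <= x)%E -> x \in `[0, +oo]%E by move=> x0; rewrite in_itv /= x0 leey.
split=> [H L|H].
  rewrite -lee_fin -(powK _ (l0 L)); apply: le_trans H.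
  have p0 : (0 <= (lps r%:E L b `^ r)%:E)%E by rewrite lee_fin; exact: powR_ge0.
  apply: gt0_ler_poweR; [exact: ri|exact: (I _ p0)|exact: (I _ S0)|].
  by rewrite -partial; apply: nneseries_lim_ge => k _ _; exact: c0.
have p0 : (0 <= (M `^ r)%:E)%E by rewrite lee_fin; exact: powR_ge0.
rewrite -(powK _ M0); apply: gt0_ler_poweR; [exact: ri|exact: (I _ S0)|exact: (I _ p0)|].
apply: lime_le; first by apply: is_cvg_nneseries => k _ _; exact: c0.
apply: nearW => L; rewrite partial lee_fin.
by apply: ge0_ler_powR; rewrite ?nnegrE ?(ltW r0)//.
Qed.

End lp_norm_partial.

Section lp_sum_theory.
Context {R : realType} {s : scalars}.
Local Notation K := (scalar_field R s).
Variables (E : nat -> normedModType K) (p : \bar R) (p1 : (1 <= p)%E).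
Local Notation C := (lp_sum E p1).
Implicit Types (f g : dprod E) (y z : C).

Lemma val_lin a y z n : val (a *: y + z) n = a *: val y n + val z n.
Proof. by []. Qed.

Lemma valD y z n : val (y + z) n = val y n + val z n. Proof. by []. Qed.

Lemma valB y z n : val (y - z) n = val y n - val z n. Proof. by []. Qed.

Definition coords f n : R := rnorm (f n).

Let coords_ge0 f n : 0 <= coords f n. Proof. exact: rnorm_ge0. Qed.

Lemma lp_sum_leP y (M : R) : 0 <= M -> rnorm y <= M <-> forall L, lps p L (coords (val y)) <= M.
Proof.
move=> M0; rewrite rnorm_lp_sum -(Lnorm_counting_leP p1 (coords_ge0 (val y)) M0).
rewrite -lee_fin lp_norm_fin//.
by have /lp_predP[] := valP y.
Qed.

Lemma lps_le_rnorm y L : lps p L (coords (val y)) <= rnorm y.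
Proof. by move: L; apply/lp_sum_leP => //; exact: rnorm_ge0. Qed.

Lemma coord_le_rnorm y n : rnorm (val y n) <= rnorm y.
Proof.
apply: le_trans (lps_le_rnorm y n.+1).
by have := lps_coord p1 (coords (val y)) (ltnSn n); rewrite ger0_norm.
Qed.

Lemma lp_sum_make f (M : R) : (forall L, lps p L (coords f) <= M) ->
  (p = +oo%E -> coords f n @[n --> \oo] --> (0 : R)) ->
  exists y : C, val y = f /\ rnorm y <= M.
Proof.
move=> fM f0; have M0 : 0 <= M by exact: fM 0%N.
have fP : f \in lp_pred p.
  apply/lp_predP; split; last exact: f0.
  by apply: (@le_lt_trans _ _ M%:E); [apply/(Lnorm_counting_leP p1 (coords_ge0 f) M0)|rewrite ltry].
by exists (exist _ f fP); split => //; apply/lp_sum_leP.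
Qed.

Lemma lp_sum_finite f L : (forall n, (L <= n)%N -> f n = 0) ->
  exists y : C, val y = f /\ rnorm y <= lps p L (coords f).
Proof.
move=> f0; apply: lp_sum_make => [M|_].
  have [LM|ML] := leqP L M; last by apply: lps_mono => //; exact: ltnW.
  by rewrite (lps_widen p1 LM)// => i /andP[Li _]; rewrite /coords f0// rnorm0.
apply/cvgn_distP => e e0; exists L => n Ln.
by rewrite /coords f0// rnorm0 subrr normr0 ltW.
Qed.

Lemma trunc_key y L : exists z : C, (val z = (fun n => if (n < L)%N then val y n else 0)) /\
  rnorm z <= lps p L (coords (val y)).
Proof.
have [|z [zE zl]] := @lp_sum_finite (fun n => if (n < L)%N then val y n else 0) L.
  by move=> n Ln; rewrite ltnNge Ln.
exists z; split => //; apply: (le_trans zl).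
by apply: lps_le => // i iL; rewrite /coords iL rnorm_ge0 lexx.
Qed.

Definition trunc L y : C := projT1 (cid (trunc_key y L)).

Lemma truncE L y n : val (trunc L y) n = if (n < L)%N then val y n else 0.
Proof. by rewrite /trunc; case: cid => z [/= -> _]. Qed.

Lemma tailE L y n : val (y - trunc L y) n = if (n < L)%N then 0 else val y n.
Proof.
rewrite valB truncE.
by case: ifP; rewrite ?subrr ?subr0.
Qed.

Lemma trunc_rnorm L y : rnorm (trunc L y) <= lps p L (coords (val y)).
Proof. by rewrite /trunc; case: cid => z []. Qed.

Lemma lp_sum_eq y z : (forall n, val y n = val z n) -> y = z.
Proof. by move=> yz; apply/val_inj; apply: functional_extensionality_dep. Qed.

Lemma lps_tail L M y : lps p M (coords (val (y - trunc L y))) =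
  lps p (M - L) (fun i => coords (val y) (L + i)).
Proof.
have c0 i : (i < L)%N -> coords (val (y - trunc L y)) i = 0.
  by move=> iL; rewrite /coords tailE iL rnorm0.
have [LM|ML] := leqP L M; last first.
  rewrite (eqP (ltnW ML)) /= (lps_widen p1 (leq0n M))// => i /andP[_ iM].
  exact: c0 (ltn_trans iM ML).
rewrite -{1}(subnKC LM) lps_cat// (lps_widen p1 (leq0n L)); last by move=> i /andP[_]; exact: c0.
rewrite lp0l// ger0_norm ?lps_ge0//; apply: eq_lps => i _.
by rewrite /coords tailE ltnNge leq_addr.
Qed.

(** For p = +oo this is the c_0 condition; for finite p it is the convergence of the series of p-th
    powers. *)
Lemma tail_cvg y (e : R) : 0 < e -> exists N, forall L, (N <= L)%N -> rnorm (y - trunc L y) <= e.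
Proof.
move=> e0; have [pE|pn] := eqVneq p +oo%E.
  have /lp_predP[_ /(_ pE)/cvgn_distP/(_ _ e0)[N HN]] := valP y.
  exists N => L NL; apply/lp_sum_leP => [|M]; first exact: ltW.
  rewrite lps_tail; set b := fun i => _.
  have be i : 0 <= b i <= e.
    rewrite /b coords_ge0 /=; have := HN (L + i)%N (leq_trans NL (leq_addr _ _)).
    by rewrite subr0 ger0_norm ?rnorm_ge0.
  clearbody b; rewrite pE; elim: (M - L)%N => [|k IH] /=; first exact: ltW.
  have /andP[bk0 bke] := be k.
  rewrite ger0_norm ?lps_ge0 ?leey// ger0_norm// ge_max IH /=; exact: bke.
have [r [r1 pE]] : exists r, 1 <= r /\ p = r%:E.
  by move: p1 pn; case: p => [r r1 _|_ /eqP//|//]; exists r.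
have r0 : 0 <= r by lra.
have rn : r != 0 by rewrite gt_eqF//; lra.
pose a := coords (val y).
pose S L := \sum_(i < L) a i `^ r.
have Snd : nondecreasing_seq S.
  apply/nondecreasing_seqP => n; rewrite /S big_ord_recr /= lerDl; exact: powR_ge0.
have Sub L : S L <= rnorm y `^ r.
  rewrite /S -(lps_pow L r1 (coords_ge0 (val y))).
  have -> : lps r%:E L (coords (val y)) = lps p L (coords (val y)).
    by move: (coords (val y)) => b; rewrite pE.
  apply: (ge0_ler_powR r0); rewrite ?nnegrE; [exact: lps_ge0|exact: rnorm_ge0|exact: lps_le_rnorm].
have Scv : cvgn S.
  by apply: nondecreasing_is_cvgn => //; exists (rnorm y `^ r) => _ [n _ <-].
have er : 0 < e `^ r by exact: powR_gt0.
have /cvgn_distP/(_ _ er)[N HN] := Scv.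
exists N => L NL; apply/lp_sum_leP => [|M]; first exact: ltW.
rewrite lps_tail -/a; set k := (M - L)%N.
have h : lps p k (fun i => a (L + i)%N) `^ r <= e `^ r.
  have -> : lps p k (fun i => a (L + i)%N) = lps r%:E k (fun i => a (L + i)%N).
    by move: (fun i => a (L + i)%N) => b; rewrite pE.
  rewrite (lps_pow k r1 (fun i => coords_ge0 _ _)).
  have -> : \sum_(i < k) a (L + i)%N `^ r = S (L + k)%N - S L.
    by rewrite /S big_split_ord /= addrAC subrr add0r.
  have := HN L NL; rewrite ler_distl => /andP[h _].
  have := nondecreasing_cvgn_le Snd Scv (L + k)%N; lra.
have := @ge0_ler_powR R r^-1 _ _ _ _ _ h.
rewrite !nnegrE !powR_ge0 -!powRrM (mulfV rn) !powRr1 ?(ltW e0) ?lps_ge0//; apply => //.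
by rewrite invr_ge0.
Qed.

(** The two vectors have disjoint supports. [lp_sum_split] gives the opposite inequality when both
    come from the same vector. *)
Lemma lp_sum_join L y z : rnorm (trunc L y + (z - trunc L z)) <=
  lp_norm2 p (rnorm (trunc L y)) (rnorm (z - trunc L z)).
Proof.
apply/lp_sum_leP => [|M]; first exact: lp_ge0.
have [ML|LM] := leqP M L.
  apply: le_trans (lp_lel p1 _ _); rewrite ger0_norm ?rnorm_ge0//.
  apply: le_trans (lps_le_rnorm (trunc L y) M); apply: lps_le => // i iM.
  apply/andP; split; [exact: coords_ge0|rewrite /coords valD].
  by rewrite tailE (leq_trans iM ML) addr0.
rewrite -(subnKC (ltnW LM)) lps_cat//; apply: lp_le => //; apply/andP; split; rewrite ?lps_ge0//.
  apply: le_trans (lps_le_rnorm (trunc L y) L); apply: lps_le => // i iL.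
  apply/andP; split; [exact: coords_ge0|rewrite /coords valD].
  by rewrite tailE iL addr0.
apply: le_trans (lps_le_rnorm (z - trunc L z) M); rewrite lps_tail.
apply: lps_le => // i _; apply/andP; split; [exact: coords_ge0|rewrite /coords valD].
by rewrite tailE truncE ltnNge leq_addr /= add0r.
Qed.

Lemma lp_sum_split L y :
  lp_norm2 p (rnorm (trunc L y)) (rnorm (y - trunc L y)) <= rnorm y.
Proof.
apply/ler_addgt0Pr => e e0.
have [M HM] : exists M, rnorm (y - trunc L y) - e <= lps p M (coords (val (y - trunc L y))).
  apply: contrapT => H.
  have [h|h] := leP e (rnorm (y - trunc L y)).
    have : rnorm (y - trunc L y) <= rnorm (y - trunc L y) - e.
      apply/lp_sum_leP => [|M]; first by rewrite subr_ge0.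
      by rewrite leNgt; apply/negP => lt; apply: H; exists M; exact: ltW.
    lra.
  apply: H; exists 0%N => /=; lra.
rewrite lps_tail in HM; set k := (M - L)%N in HM.
set t := lps p k _ in HM.
have t0 : 0 <= t by exact: lps_ge0.
apply: (@le_trans _ _ (lp_norm2 p (lps p L (coords (val y))) (t + e))).
  apply: lp_le => //; first by rewrite rnorm_ge0 trunc_rnorm.
  by rewrite rnorm_ge0/=; lra.
have := lpD p1 (lps p L (coords (val y))) t 0 e; rewrite addr0 => /le_trans; apply.
rewrite lp0l// (ger0_norm (ltW e0)) lerD2r -lps_cat//.
exact: lps_le_rnorm.
Qed.

End lp_sum_theory.

Section complete.
Context {R : realType} {s : scalars}.
Local Notation K := (scalar_field R s).

Definition rcauchy (X : normedModType K) (u : nat -> X) := forall e : R, 0 < e ->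
  exists N, forall m n, (N <= m)%N -> (N <= n)%N -> rnorm (u m - u n) <= e.

Definition rcomplete (X : normedModType K) :=
  forall u : nat -> X, rcauchy u -> exists l : X, u @ \oo --> l.

Lemma scalar_complete : rcomplete (K^o : normedModType K).
Proof.
move=> u uc.
have part (h : K -> R) : (forall a b, h (a - b) = h a - h b) ->
    (forall a, `|h a| <= rnorm (a : K^o)) -> exists l : R, h (u n) @[n --> \oo] --> l.
  move=> hB hn; apply/cvg_ex; apply/cauchy_cvgP/cauchy_exP => e e0.
  have [N HN] := uc _ (divr_gt0 e0 (ltr0n R 2)).
  exists (h (u N)), N => // n /= Nn; rewrite -ball_normE /= -hB.
  by apply: (le_lt_trans (hn _)); apply: (le_lt_trans (HN _ _ _ Nn)) => //; lra.
have rN (a : K) : re_part (- a) = - re_part a.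
  by apply: (addrI (re_part a)); rewrite -re_partD !subrr -(@of_real0 R s) of_realK.
have iN (a : K) : im_part (- a) = - im_part a.
  apply: (addrI (im_part a)); rewrite -im_partD !subrr.
  by have := @im_partZ R s 0 0; rewrite mulr0 mul0r.
have [a ua] : exists l : R, re_part (u n) @[n --> \oo] --> l.
  by apply: part => [x y|x]; [rewrite re_partD rN|exact: re_part_norm].
have [b ub] : exists l : R, im_part (u n) @[n --> \oo] --> l.
  by apply: part => [x y|x]; [rewrite im_partD iN|exact: im_part_norm].
exists (of_real a + of_real b * jay); apply/cvg_rnormP => e e0.
have e2 : 0 < e / 2 by lra.
have /cvgn_distP/(_ _ e2)[N1 H1] := ua; have /cvgn_distP/(_ _ e2)[N2 H2] := ub.
exists (maxn N1 N2) => n; rewrite geq_max => /andP[/H1 h1 /H2 h2].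
have -> : u n - (of_real a + of_real b * jay) =
    of_real (re_part (u n) - a) + of_real (im_part (u n) - b) * jay.
  rewrite {1}(scalar_parts (u n)) !of_realD !of_realN mulrBl opprD addrACA.
  by congr (_ + (_ - _)).
rewrite (le_trans (ler_rnormD (_ : K^o) (_ : K^o)))// rnormM rnorm_jay mulr1 !rnorm_of_real; lra.
Qed.

Variables (E : nat -> normedModType K) (p : \bar R) (p1 : (1 <= p)%E).
Local Notation C := (lp_sum E p1).

Lemma lps_le_sum L (a : nat -> R) : lps p L a <= \sum_(i < L) `|a i|.
Proof.
elim: L => [|L IH]; first by rewrite big_ord0.
rewrite big_ord_recr /=; apply: le_trans (lp_leD p1 _ _) _.
by apply: lerD => //; rewrite ger0_norm ?lps_ge0.
Qed.

(** The limit is taken coordinate by coordinate and estimated on finite segments; its c_0 condition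
    is inherited from a nearby term u N. *)
Lemma lp_sum_complete : (forall n, rcomplete (E n)) -> rcomplete (C : normedModType K).
Proof.
move=> Ec u uc.
have lim n : exists l : E n, (fun m => val (u m) n) @ \oo --> l.
  apply: Ec => e e0; have [N HN] := uc _ e0; exists N => m k Nm Nk.
  by rewrite -valB; apply: le_trans (coord_le_rnorm _ n) (HN _ _ Nm Nk).
pose f : dprod E := fun n => projT1 (cid (lim n)).
have flim n : (fun m => val (u m) n) @ \oo --> f n by rewrite /f; case: cid.
have fu (e : R) : 0 < e -> exists N, forall k, (N <= k)%N ->
    forall L, lps p L (fun n => rnorm (f n - val (u k) n)) <= e.
  move=> e0; have e2 : 0 < e / 2 by lra.
  have [N HN] := uc _ e2; exists N => k Nk L.
  have eL : 0 < e / 2 / L.+1%:R by rewrite divr_gt0.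
  have /boolp.choice[M HM] : forall n, exists N, forall m, (N <= m)%N ->
      rnorm (val (u m) n - f n) <= e / 2 / L.+1%:R.
    by move=> n; have /cvg_rnormP/(_ _ eL) := flim n.
  pose m := maxn N (\max_(n < L) M n).
  have Hm n : (n < L)%N -> rnorm (f n - val (u m) n) <= e / 2 / L.+1%:R.
    move=> nL; rewrite -rnormN opprB; apply: HM; rewrite leq_max; apply/orP; right.
    exact: (@leq_bigmax _ (fun i : 'I_L => M i) (Ordinal nL)).
  apply: (@le_trans _ _ (lps p L (fun n => rnorm (f n - val (u m) n) + rnorm (val (u m) n - val (u k) n)))).
    apply: lps_le => // n _; rewrite rnorm_ge0 /=.
    by rewrite -[in leLHS](subrKA (val (u m) n)) ler_rnormD.
  apply: le_trans (lpsD p1 _ _ _) _; rewrite [e]splitr; apply: lerD.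
    apply: le_trans (lps_le_sum _ _) _.
    apply: (@le_trans _ _ (\sum_(i < L) (e / 2 / L.+1%:R))).
      by apply: ler_sum => i _; rewrite ger0_norm ?rnorm_ge0// Hm.
    rewrite sumr_const card_ord -[leLHS]mulr_natl mulrCA ger_pMr// ler_pdivrMr// mul1r ler_nat.
    exact: leqnSn.
  apply: le_trans (HN m k (leq_maxl _ _) Nk).
  exact: (lps_le_rnorm (u m - u k) L).
have [N0 HN0] := fu 1 ltr01.
have [y [yE _]] : exists y : C, val y = f /\ rnorm y <= 1 + rnorm (u N0).
  apply: lp_sum_make => [L|pE].
    apply: (@le_trans _ _ (lps p L (fun n => rnorm (f n - val (u N0) n) + rnorm (val (u N0) n)))).
      apply: lps_le => // n _; rewrite rnorm_ge0 /=.
      by rewrite /coords -[in leLHS](subrK (val (u N0) n) (f n)) ler_rnormD.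
    apply: le_trans (lpsD p1 _ _ _) _; apply: lerD; first exact: HN0.
    exact: (lps_le_rnorm (u N0) L).
  apply/cvgn_distP => e e0; have e2 : 0 < e / 2 by lra.
  have [N HN] := fu _ e2.
  have /lp_predP[_ /(_ pE)/cvgn_distP/(_ _ e2)[N' HN']] := valP (u N).
  exists N' => n N'n; rewrite subr0 ger0_norm ?rnorm_ge0// /coords.
  rewrite -(subrK (val (u N) n) (f n)) (le_trans (ler_rnormD _ _))// [e]splitr lerD//.
    have := lps_coord p1 (fun n => rnorm (f n - val (u N) n)) (ltnSn n).
    rewrite ger0_norm ?rnorm_ge0// => /le_trans; apply.
    exact: HN.
  by have := HN' n N'n; rewrite subr0 ger0_norm ?rnorm_ge0.
exists y; apply/cvg_rnormP => e e0; have [N HN] := fu _ e0; exists N => k Nk.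
rewrite -rnormN opprB; apply/lp_sum_leP => [|L]; first exact: ltW.
apply: le_trans (HN k Nk L); apply: lps_le => // n _.
by rewrite rnorm_ge0 /coords valB yE lexx.
Qed.

Variables (X : normedModType K) (A : forall i, {linear E i -> X}) (M : R).
Hypothesis Xc : rcomplete X.
Hypothesis M0 : 0 <= M.
Hypothesis AM : forall L (f : dprod E), rnorm (\sum_(i < L) A i (f i)) <= M * lps p L (coords f).

(** The partial sums form a Cauchy sequence, because the bound on their differences involves only a
    tail of y. *)
Lemma sum_operator : exists U : {linear C -> X}, (forall y, rnorm (U y) <= M * rnorm y) /\
  forall y L, (forall n, (L <= n)%N -> val y n = 0) -> U y = \sum_(i < L) A i (val y i).
Proof.
pose S (y : C) L := \sum_(i < L) A i (val y i).
have split (g : dprod E) m n : (m <= n)%N -> \sum_(i < n) A i (g i) =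
    \sum_(i < m) A i (g i) + \sum_(i < n - m) A (m + i)%N (g (m + i)%N).
  by move=> mn; rewrite -[in LHS](subnKC mn) big_split_ord.
have lim y : exists l : X, S y @ \oo --> l.
  apply: Xc => e e0; have M1 : 0 < M + 1 by rewrite ltr_wpDl.
  have [N HN] := tail_cvg y (divr_gt0 e0 M1).
  have main m n : (N <= m)%N -> (m <= n)%N -> rnorm (S y n - S y m) <= e.
    move=> Nm mn.
    have -> : S y n - S y m = \sum_(i < n) A i (val (y - trunc m y) i).
      rewrite /S !(split _ _ _ mn) addrAC subrr add0r.
      rewrite [X in _ = X + _]big1 ?add0r; last by move=> i _; rewrite tailE ltn_ord linear0.
      by apply: eq_bigr => i _; rewrite tailE ltnNge leq_addr.
    apply: (le_trans (AM _ _)); apply: (@le_trans _ _ (M * (e / (M + 1)))).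
      by apply: (ler_wpM2l M0); apply: le_trans (lps_le_rnorm _ _) (HN _ Nm).
    by rewrite mulrCA ger_pMr// ler_pdivrMr// mul1r lerDl.
  exists N => m n Nm Nn; have [mn|nm] := leqP m n.
    by rewrite -rnormN opprB; exact: main.
  exact: main (ltnW nm).
pose U y := projT1 (cid (lim y)).
have SU y : S y @ \oo --> U y by rewrite /U; case: cid.
have uniq y l : S y @ \oo --> l -> U y = l by move=> /(cvg_unique (@norm_hausdorff _ _) (SU y)).
have Ulin : linear U.
  move=> a x y; apply: uniq.
  have -> : S (a *: x + y) = fun L => a *: S x L + S y L.
    apply/funext => L; rewrite /S scaler_sumr -big_split; apply: eq_bigr => i _.
    by rewrite val_lin linearP.
  by apply: cvgD (SU y); apply: cvgZr; exact: SU.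
pose UL : {linear C -> X} := HB.pack U (GRing.isLinear.Build _ _ _ _ _ Ulin).
exists UL; split=> [y|y L y0].
  apply/ler_addgt0Pr => e e0; have /cvg_rnormP/(_ _ e0)[N /(_ N (leqnn N)) HN] := SU y.
  rewrite -(subrK (S y N) (UL y)) (le_trans (ler_rnormD _ _))// addrC lerD//; last first.
    by rewrite -rnormN opprB.
  apply: (le_trans (AM _ _)); apply: (ler_wpM2l M0); exact: lps_le_rnorm.
apply: uniq; apply/cvg_rnormP => e e0; exists L => n Ln.
rewrite (_ : S y n = \sum_(i < L) A i (val y i)) ?subrr ?rnorm0 ?ltW//.
rewrite /S (split _ _ _ Ln) [X in _ + X]big1 ?addr0// => i _.
by rewrite y0 ?linear0 ?leq_addr.
Qed.

End complete.

(** * Rosenthal's theorem *)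

Definition unbounded (M : set nat) := forall N, exists2 n, (N <= n)%N & M n.

Lemma pigeonhole (T : finType) (c : nat -> T) : exists t, unbounded [set k | c k = t].
Proof.
apply: contrapT => H.
have /boolp.choice[N HN] : forall t, exists N, forall n, (N <= n)%N -> c n <> t.
  move=> t; apply: contrapT => Ht; apply: H; exists t => N; apply: contrapT => HN.
  by apply: Ht; exists N => n Nn cn; apply: HN; exists n.
pose k := \max_t N t; apply: (HN (c k) k) => //.
exact: (leq_bigmax (c k)).
Qed.

Section independence.
Variables (F : Type) (C : bool -> nat -> set F).

Definition oscillates (M : set nat) (f : F) := forall c, unbounded [set n | M n /\ C c n f].

(** Every attempt at stabilisation fails: no infinite subset of M stops all members of D from
    oscillating. *)
Definition bad (M : set nat) (D : set F) := forall M', M' `<=` M -> unbounded M' ->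
  exists2 f, D f & oscillates M' f.

(** Otherwise each stage k yields an index n k, a pair (t, c) and a smaller infinite set on which no
    member of D t in C c (n k) oscillates. Some pair recurs infinitely often. Badness along the
    corresponding indices gives an oscillating member of D t; it lies in one of these C c (n k), yet
    almost all of the indices belong to the set of the next stage, a contradiction. *)
Lemma bad_split (T : finType) (D : T -> set F) (M : set nat) :
  unbounded M -> (forall t, bad M (D t)) ->
  exists n M', unbounded M' /\ forall t c, bad M' (D t `&` C c n).
Proof.
move=> uM bM; apply: contrapT => H.
have step : forall (S : {M : set nat | unbounded M}) (n : nat),
    exists (tcS' : T * bool * {M : set nat | unbounded M}),
      sval tcS'.2 `<=` sval S /\
      forall f, D tcS'.1.1 f -> C tcS'.1.2 n f -> ~ oscillates (sval tcS'.2) f.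
  move=> [S uS] n; apply: contrapT => H'; apply: H; exists n, S; split => // t c S' S'S uS'.
  apply: contrapT => H''; apply: H'; exists (t, c, exist _ S' uS'); split => //= f Df Cf osc.
  by apply: H''; exists f.
have /boolp.choice[g Hg] : forall Sn : {M : set nat | unbounded M} * nat,
    exists (tcS' : T * bool * {M : set nat | unbounded M}),
      sval tcS'.2 `<=` sval Sn.1 /\
      forall f, D tcS'.1.1 f -> C tcS'.1.2 Sn.2 f -> ~ oscillates (sval tcS'.2) f.
  by move=> [S n]; exact: step.
have /boolp.choice[pick Hpick] : forall Sk : {M : set nat | unbounded M} * nat,
    exists n, (Sk.2 <= n)%N /\ sval Sk.1 n.
  by move=> [[S uS] k]; have [n kn Sn] := uS k; exists n.
pose fix St (k : nat) : {M : set nat | unbounded M} :=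
  if k is k'.+1 then (g (St k', pick (St k', k'))).2 else exist _ M uM.
pose n k := pick (St k, k).
pose tc k := (g (St k, n k)).1.
have nk k : (k <= n k)%N by have [] := Hpick (St k, k).
have Sn k : sval (St k) (n k) by have [] := Hpick (St k, k).
have StS k : sval (St k.+1) `<=` sval (St k) by have [] := Hg (St k, n k).
have Stm i j : (i <= j)%N -> sval (St j) `<=` sval (St i).
  move=> ij; rewrite -(subnKC ij); elim: (j - i)%N => [|l IH]; first by rewrite addn0.
  by rewrite addnS => x /StS; exact: IH.
have nosc k f : D (tc k).1 f -> C (tc k).2 (n k) f -> ~ oscillates (sval (St k.+1)) f.
  by have [_] := Hg (St k, n k); exact.
have [t ut] := pigeonhole tc.
have [|N|f Df osc] := bM t.1 [set m | exists2 k, tc k = t & m = n k].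
- by move=> _ [k _ ->]; apply: (Stm 0%N k (leq0n _)).
- by have [k Nk tk] := ut N; exists (n k); [exact: leq_trans Nk (nk k)|exists k].
have [m _ [[k tk mk] Ckf]] := osc t.2 0%N.
rewrite mk -tk in Ckf.
apply: (@nosc k f) => //; first by rewrite tk.
move=> c N.
have [m' Nm' [[l tl m'l] Cm']] := osc c (maxn N (\max_(i < k.+1) n i).+1).
move: Nm'; rewrite geq_max => /andP[Nm' km'].
exists m' => //; split => //; rewrite m'l; apply: (Stm k.+1 l) => //.
rewrite ltnNge; apply/negP => lk; move: km'; rewrite m'l ltnNge => /negP; apply.
by rewrite -ltnS in lk; exact: (@leq_bigmax _ (fun i : 'I_k.+1 => n i) (Ordinal lk)).
Qed.

(** Each use of [bad_split] doubles the finite family of sets, one set for each pattern of choices,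
    and keeps all of them bad. *)
Lemma independent_sequence (M : set nat) (D : set F) : unbounded M -> bad M D ->
  exists n : nat -> nat, forall (s : nat -> bool) L,
    exists2 f, D f & forall j, (j < L)%N -> C (s j) (n j) f.
Proof.
move=> uM bM.
pose state := {T : finType & {DM : (T -> set F) * set nat |
  unbounded DM.2 /\ forall t, bad DM.2 (DM.1 t)}}.
pose Dof (S : state) : tag S -> set F := (sval (tagged S)).1.
have step : forall S : state, exists nS' : nat * state, forall (t : tag S) c,
    exists t', Dof nS'.2 t' `<=` Dof S t `&` C c nS'.1.
  move=> [T [[D' M'] /= [uM' bM']]].
  have [n [M'' [uM'' bM'']]] := bad_split uM' bM'.
  have inv : unbounded (fun (tc : T * bool) => D' tc.1 `&` C tc.2 n, M'').2 /\
      forall t, bad M'' ((fun (tc : T * bool) => D' tc.1 `&` C tc.2 n) t).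
    by split => // -[t c].
  exists (n, existT _ (T * bool : finType)%type (exist _ (fun (tc : T * bool) => D' tc.1 `&` C tc.2 n, M'') inv)).
  by move=> t c; exists (t, c).
have /boolp.choice[g Hg] := step.
pose S0 : state := existT _ (unit : finType) (exist _ (fun=> D, M) (conj uM (fun=> bM))).
pose fix S k : state := if k is k'.+1 then (g (S k')).2 else S0.
exists (fun k => (g (S k)).1) => s L.
have [t Ht] : exists t, Dof (S L) t `<=` D `&` [set f | forall j, (j < L)%N -> C (s j) (g (S j)).1 f].
  elim: L => [|L [t Ht]]; first by exists tt => f Df; split.
  have [t' Ht'] := Hg (S L) t (s L); exists t' => f /Ht'[/Ht[Df Hf] Cf]; split => // j.
  by rewrite ltnS leq_eqVlt => /predU1P[->//|]; exact: Hf.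
have [uS bS] := svalP (tagged (S L)).
have [f /Ht[Df Hf] _] := bS t _ (@subset_refl _ _) uS.
by exists f.
Qed.

End independence.

Section weak_cauchy.
Context {R : realType} {s : scalars}.
Local Notation K := (scalar_field R s).

Lemma scalar_dense : exists q : nat -> K, forall (z : K) (e : R), 0 < e ->
  exists m, rnorm (z - q m : K^o) <= e.
Proof.
pose q m : K := if unpickle m is Some (a, b) then of_real (ratr a) + of_real (ratr b) * jay else 0.
exists q => z e e0.
have rat_near (x : R) : exists a : rat, `|x - ratr a| <= e / 2.
  have [|a] := @rat_in_itvoo R (x - e / 2) (x + e / 2); first by lra.
  by rewrite in_itv /= => /andP[h1 h2]; exists a; rewrite ler_distl; lra.
have [a ha] := rat_near (re_part z); have [b hb] := rat_near (im_part z).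
exists (pickle (a, b)); rewrite /q pickleK.
have -> : z - (of_real (ratr a) + of_real (ratr b) * jay) =
    of_real (re_part z - ratr a) + of_real (im_part z - ratr b) * jay.
  rewrite {1}(scalar_parts z) !of_realD !of_realN mulrBl opprD addrACA.
  by congr (_ + (_ - _)).
rewrite (le_trans (ler_rnormD (_ : K^o) (_ : K^o)))// rnormM rnorm_jay mulr1 !rnorm_of_real; lra.
Qed.

Lemma bounded_scalar_cluster (y : nat -> K) (M : R) : (forall n, rnorm (y n : K^o) <= M) ->
  exists2 phi : nat -> nat, {homo phi : m n / (m < n)%N} &
    exists z : K, forall e : R, 0 < e -> exists N, forall n, (N <= n)%N ->
      rnorm (y (phi n) - z : K^o) <= e.
Proof.
move=> yM.
have [|phi hphi [a ca]] := @bounded_subseq_cvg R (fun n => re_part (y n)) M.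
  by move=> n; apply: le_trans (re_part_norm _) (yM n).
have [|psi hpsi [b cb]] := @bounded_subseq_cvg R (fun n => im_part (y (phi n))) M.
  by move=> n; apply: le_trans (im_part_norm _) (yM _).
exists (phi \o psi); first by move=> i j ij; apply: hphi; exact: hpsi.
exists (of_real a + of_real b * jay) => e e0; have e2 : 0 < e / 2 by lra.
have /cvgn_distP/(_ _ e2)[N1 H1] := cvg_subseq hpsi ca.
have /cvgn_distP/(_ _ e2)[N2 H2] := cb.
exists (maxn N1 N2) => n; rewrite geq_max => /andP[/H1 h1 /H2 h2] /=.
have -> : y (phi (psi n)) - (of_real a + of_real b * jay) =
    of_real (re_part (y (phi (psi n))) - a) + of_real (im_part (y (phi (psi n))) - b) * jay.
  rewrite {1}(scalar_parts (y (phi (psi n)))) !of_realD !of_realN mulrBl opprD addrACA.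
  by congr (_ + (_ - _)).
rewrite (le_trans (ler_rnormD (_ : K^o) (_ : K^o)))// rnormM rnorm_jay mulr1 !rnorm_of_real; lra.
Qed.

Lemma scalar_two_clusters (y : nat -> K) (M : R) : (forall n, rnorm (y n : K^o) <= M) ->
  (exists z : K, y n @[n --> \oo] --> (z : K^o)) \/
  exists a b : K, a != b /\ forall z, z = a \/ z = b -> forall e : R, 0 < e ->
    unbounded [set n | rnorm (y n - z : K^o) <= e].
Proof.
move=> yM; have [phi hphi [a ca]] := bounded_scalar_cluster yM.
have [cva|ncva] := pselect (y n @[n --> \oo] --> (a : K^o)); first by left; exists a.
right.
have [e e0 He] : exists2 e : R, 0 < e & forall N, exists2 n, (N <= n)%N & e < rnorm (y n - a : K^o).
  apply: contrapT => H; apply: ncva; apply/cvg_rnormP => e e0; apply: contrapT => He.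
  apply: H; exists e => // N; apply: contrapT => HN; apply: He; exists N => n Nn.
  by rewrite leNgt; apply/negP => h; apply: HN; exists n.
have [k N|psi hpsi Hpsi] := @extraction (fun k n => e < rnorm (y n - a : K^o)).
  exact: He.
have [chi hchi [b cb]] := @bounded_scalar_cluster (y \o psi) M (fun n => yM _).
exists a, b; split.
  apply/negP => /eqP ab; have [N /(_ N (leqnn N))] := cb _ e0.
  by rewrite -ab leNgt Hpsi.
move=> z [->|->] d d0 N.
  have [N' HN'] := ca _ d0; exists (phi (maxn N N')).
    exact: leq_trans (leq_maxl _ _) (homo_leq_id hphi _).
  exact: HN' (leq_maxr _ _).
have [N' HN'] := cb _ d0; exists (psi (chi (maxn N N'))).
  apply: leq_trans (homo_leq_id hpsi _).
  exact: leq_trans (leq_maxl _ _) (homo_leq_id hchi _).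
exact: HN' (leq_maxr _ _).
Qed.

Variables (X : normedModType K) (u : nat -> X) (M : R).
Hypothesis uM : forall n, rnorm (u n) <= M.

Definition contraction (f : {linear X -> K^o}) := forall x, rnorm (f x) <= rnorm x.

(** The ratio 50 leaves a margin both for replacing cluster values by values of a countable dense
    set and for the lower l_1 estimate. *)
Definition near_value (c : bool -> K) (b : bool) n : set {linear X -> K^o} :=
  [set f | rnorm (f (u n) - c b : K^o) <= rnorm (c true - c false : K^o) / 50].

(** A diagonal subsequence stops every contraction from oscillating between any two values of a
    countable dense set. Two distinct cluster values of some f along it could be approximated by
    such values. *)
Lemma weak_cauchy_or_bad : (forall c : bool -> K, c true != c false ->
    forall S, unbounded S -> ~ bad (near_value c) S contraction) ->
  exists2 phi : nat -> nat, {homo phi : m n / (m < n)%N} & wcauchy ((u : nat -> realify X) \o phi).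
Proof.
move=> good; have [q Hq] := scalar_dense.
pose c m (b : bool) : K := if unpickle m is Some (i, j) then (if b then q i else q j) else 0.
have step : forall Sm : {S : set nat | unbounded S} * nat, exists S' : {S : set nat | unbounded S},
    sval S' `<=` sval Sm.1 /\ (c Sm.2 true != c Sm.2 false ->
      forall f, contraction f -> ~ oscillates (near_value (c Sm.2)) (sval S') f).
  move=> [[S uS] m] /=; have [cm|cm] := eqVneq (c m true) (c m false).
    by exists (exist _ S uS); split => //.
  apply: contrapT => H; apply: (good (c m) cm S uS) => S' S'S uS'; apply: contrapT => H'.
  apply: H; exists (exist _ S' uS'); split => // _ f cf osc; apply: H'; by exists f.
have /boolp.choice[g Hg] := step.
have u0 : unbounded setT by move=> N; exists N.
pose fix St m : {S : set nat | unbounded S} := if m is m'.+1 then g (St m', m') else exist _ setT u0.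
have StS k : sval (St k.+1) `<=` sval (St k) by have [] := Hg (St k, k).
have Stm i j : (i <= j)%N -> sval (St j) `<=` sval (St i).
  move=> ij; rewrite -(subnKC ij); elim: (j - i)%N => [|l IH]; first by rewrite addn0.
  by rewrite addnS => x /StS; exact: IH.
have [k N|phi hphi Hphi] := @extraction (fun k n => sval (St k) n).
  exact: (svalP (St k)).
exists phi => //.
suff main f : contraction f -> exists z : K, f (u (phi n)) @[n --> \oo] --> (z : K^o).
  move=> h; have [f [fr fn]] := functional_of_real_part h.
  pose b := (2 * `|h| + 1 : R).
  have b0 : 0 < b by rewrite /b; have := normr_ge0 h; lra.
  have cfb : contraction ((of_real b^-1 : K) \*: f).
    move=> x; rewrite /= rnormZE rnorm_of_real ger0_norm ?invr_ge0 ?(ltW b0)//.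
    rewrite mulrC ler_pdivrMr// (le_trans (fn x))// mulrC ler_wpM2l ?rnorm_ge0//.
    by rewrite /b lerDl.
  have [z Hz] := main _ cfb.
  exists (b * re_part z); apply/cvgn_distP => e e0.
  have /cvg_rnormP/(_ _ (divr_gt0 e0 b0))[N HN] := Hz.
  exists N => n Nn; have := HN n Nn; set w := f (u (phi n)); rewrite -[X in rnorm (X - _)]/(of_real b^-1 * w).
  move=> hn; have := le_trans (re_part_norm _) hn.
  have zN : re_part (- z) = - re_part z.
    by apply: (addrI (re_part z)); rewrite -re_partD !subrr -(@of_real0 R s) of_realK.
  rewrite re_partD re_partZ zN ler_pdivlMr// => h1; apply: le_trans h1.
  have -> : h ((u \o phi) n) - b * re_part z = (b^-1 * re_part w - re_part z) * b.
    by rewrite mulrBl mulrAC (mulVf (lt0r_neq0 b0)) mul1r [re_part z * b]mulrC /w fr.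
  by rewrite normrM (ger0_norm (ltW b0)).
move=> cf.
have [n|[z Hz]|[a [b [ab Hab]]]] := @scalar_two_clusters (fun n => f (u (phi n))) M.
- exact: le_trans (cf _) (uM _).
- by exists z.
exfalso.
have d0 : 0 < rnorm (a - b : K^o).
  rewrite lt_neqAle rnorm_ge0 andbT eq_sym; apply: contra_neq ab => h.
  by apply/eqP; rewrite -subr_eq0; apply/eqP; exact: (@rnorm_eq0 R s K^o _ h).
set d := rnorm (a - b : K^o) in d0.
(* Two errors d / 1000 stay within the tolerance |q i - q j| / 50, since |q i - q j| is at least d -
   d / 500. *)
have d1 : 0 < d / 1000 by lra.
have [i Hi] := Hq a _ d1; have [j Hj] := Hq b _ d1.
pose m := pickle (i, j).
have ct : c m true = q i by rewrite /c /m pickleK.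
have cf' : c m false = q j by rewrite /c /m pickleK.
have dd : d <= rnorm (q i - q j : K^o) + d / 500.
  have dE : a - b = ((a - q i) + (q i - q j)) + (q j - b) by rewrite subrKA subrKA.
  have := ler_rnormD ((a - q i) + (q i - q j) : K^o) (q j - b : K^o); rewrite -dE -/d.
  have := ler_rnormD (a - q i : K^o) (q i - q j : K^o).
  have : rnorm (q j - b : K^o) <= d / 1000 by rewrite -rnormN opprB.
  lra.
have [] := Hg (St m, m); rewrite /= ct cf' => _ /(_ _ f cf); apply.
  by apply: contraTneq d0 => qij; move: dd; rewrite qij subrr (@rnorm0 R s K^o) -leNgt; lra.
move=> bb N.
have [z [zab zq]] : exists z, (z = a \/ z = b) /\ rnorm (z - c m bb : K^o) <= d / 1000.
  by case: bb; [exists a; rewrite ct; split; [left|]|exists b; rewrite cf'; split; [right|]].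
have [k] := Hab z zab _ d1 (maxn N m.+1); rewrite geq_max => /andP[Nk mk] /= hk.
exists (phi k); first exact: leq_trans Nk (homo_leq_id hphi _).
split; first exact: (Stm m.+1 k mk).
rewrite /near_value /= ct cf' -(subrKA z).
apply: (le_trans (ler_rnormD (_ : K^o) (_ : K^o))); lra.
Qed.


End weak_cauchy.

Lemma ler_rnorm_sum {R : realType} {s : scalars} (V : normedModType (scalar_field R s))
    (I : Type) (r : seq I) (P : pred I) (F : I -> V) :
  rnorm (\sum_(i <- r | P i) F i) <= \sum_(i <- r | P i) rnorm (F i).
Proof.
elim/big_ind2: _ => [|x a y b xa yb|//]; first by rewrite rnorm0.
by rewrite (le_trans (ler_rnormD _ _))// lerD.
Qed.

Section l1_copy.
Context {R : realType} {s : scalars}.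
Local Notation K := (scalar_field R s).
Variable X : normedModType K.

(** The lower bound together with the completeness of W makes the image closed. *)
Lemma embedding_copy (W : normedModType K) (U : {linear W -> X}) (c M : R) :
  rcomplete W -> 0 < c -> (forall y, c * rnorm y <= rnorm (U y)) ->
  (forall y, rnorm (U y) <= M * rnorm y) -> contains_copy X W.
Proof.
move=> Wc c0 Ul Uu.
pose P : {pred X} := [pred x | `[< exists y, U y = x >]].
have PU y : U y \in P by apply/asboolP; exists y.
have Psub : submod_closed P.
  split=> [|a x y /asboolP[x' <-] /asboolP[y' <-]].
    by rewrite -(linear0 U).
  by rewrite -linearP.
have Pcl : closed [set x | x \in P].
  apply/closed_rnormP => x xP.
  have /boolp.choice[y Hy] : forall n : nat, exists y, rnorm (x - U y) <= n.+1%:R^-1 :> R.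
    move=> n; have n0 : 0 < n.+1%:R^-1 :> R by rewrite invr_gt0.
    by have [_ /asboolP[y <-] h] := xP _ n0; exists y.
  have small (e : R) : 0 < e -> exists N, forall n, (N <= n)%N -> rnorm (x - U (y n)) <= e.
    move=> e0; have /cvgn_distP/(_ _ e0)[N HN] := @cvg_harmonic R; exists N => n Nn.
    by apply: (le_trans (Hy n)); have := HN n Nn; rewrite subr0 => /(le_trans (ler_norm _)).
  have [|l yl] := Wc y.
    move=> e e0; have e2 : 0 < c * e / 2 by rewrite divr_gt0// mulr_gt0.
    have [N HN] := small _ e2; exists N => m n Nm Nn.
    rewrite -(ler_pM2l c0); apply: le_trans (Ul _) _; rewrite raddfB /=.
    rewrite -(subrKA x) (le_trans (ler_rnormD _ _))// -(rnormN (U (y m) - x)) opprB.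
    by have := HN m Nm; have := HN n Nn; lra.
  rewrite /=; apply/asboolP; exists l; apply/esym/eqP; rewrite -subr_eq0; apply/eqP; apply: rnorm_eq0.
  apply/eqP; rewrite eq_le rnorm_ge0 andbT; apply/ler_addgt0Pr => e e0; rewrite add0r.
  have M1 : 0 < `|M| + 1 by rewrite ltr_wpDl.
  have e2 : 0 < e / 2 by lra.
  have [N HN] := small _ e2; have /cvg_rnormP/(_ _ (divr_gt0 e2 M1))[N' HN'] := yl.
  pose n := maxn N N'.
  rewrite -(subrKA (U (y n))) (le_trans (ler_rnormD _ _))// [e]splitr lerD ?HN ?leq_maxl//.
  rewrite -raddfB; apply: le_trans (Uu _) _; rewrite mulrC.
  apply: (@le_trans _ _ (e / 2 / (`|M| + 1) * (`|M| + 1))); last by rewrite divfK ?gt_eqF.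
  apply: le_trans (_ : rnorm (y n - l) * (`|M| + 1) <= _).
    by apply: ler_wpM2l; rewrite ?rnorm_ge0// (le_trans (ler_norm M))// lerDl.
  by rewrite ler_pM2r// HN'// leq_maxr.
pose Z := ClosedSubspace Psub Pcl; exists Z.
have Uinj y y' : U y = U y' -> y = y'.
  move=> h; apply/eqP; rewrite -subr_eq0; apply/eqP/rnorm_eq0/eqP; rewrite eq_le rnorm_ge0 andbT.
  by rewrite -(ler_pM2l c0) (le_trans (Ul _))// raddfB /= h subrr rnorm0 mulr0.
pose S y : subspace_type Z := exist _ (U y) (PU y).
have Slin : linear S by move=> a x y; apply/val_inj; rewrite /= linearP.
have TS (z : subspace_type Z) : exists y, S y = z.
  by case: z => z zP; have /asboolP[y yz] := zP; exists y; apply/val_inj.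
pose T z := projT1 (cid (TS z)).
have ST z : S (T z) = z by rewrite /T; case: cid.
have TSK y : T (S y) = y by apply: Uinj; exact: (congr1 val (ST (S y))).
have Tlin : linear T.
  by move=> a x y; apply: Uinj; rewrite linearP; exact: (congr1 val (etrans (ST _) (esym (congr2 (fun v w => a *: v + w) (ST x) (ST y))))).
pose SL : {linear W -> subspace_type Z} := HB.pack S (GRing.isLinear.Build _ _ _ _ _ Slin).
pose TL : {linear subspace_type Z -> W} := HB.pack T (GRing.isLinear.Build _ _ _ _ _ Tlin).
exists TL, SL; split.
- apply/continuous_linearP; exists c^-1; first by rewrite invr_ge0 ltW.
  move=> z; rewrite mulrC ler_pdivlMr// mulrC (le_trans (Ul _))//.
  by rewrite rnorm_subspace -[X in _ <= rnorm (val X)]ST.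
- apply/continuous_linearP; exists `|M| => // y.
  by rewrite rnorm_subspace /= (le_trans (Uu _))// ler_wpM2r ?rnorm_ge0 ?ler_norm.
- exact: ST.
- exact: TSK.
Qed.

Lemma lps1 L (a : nat -> R) : lps 1%:E L a = \sum_(i < L) `|a i|.
Proof.
elim: L => [|L IH]; first by rewrite big_ord0.
rewrite big_ord_recr /= -IH invr1 !powRr1 ?addr_ge0//.
by rewrite ger0_norm// lps_ge0.
Qed.

Variables (u : nat -> X) (M : R).
Hypothesis uM : forall n, rnorm (u n) <= M.

(** Let f follow the signs of the real parts of the a j, and g the opposite signs. Then f x - g x is
    close to c true - c false times a sum with real part the sum of |Re (a j)|. Imaginary parts are
    treated alike, and 4 / (1 - 2 / 25) is below 8. *)
Lemma independent_lower (c : bool -> K) (n : nat -> nat) :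
  (forall (t : nat -> bool) L, exists2 f, contraction f &
    forall j, (j < L)%N -> near_value u c (t j) (n j) f) ->
  forall L (a : nat -> K), rnorm (c true - c false : K^o) / 8 * (\sum_(j < L) rnorm (a j : K^o)) <=
    rnorm (\sum_(j < L) a j *: u (n j)).
Proof.
move=> H L a; set d := rnorm _; set S := \sum_(j < L) rnorm _; set x := \sum_(j < L) _.
have d0 : 0 <= d by exact: rnorm_ge0.
have key (part : K -> R) : (forall y z, part (y + z) = part y + part z) ->
    (forall y, `|part y| <= rnorm (y : K^o)) ->
    d * \sum_(j < L) `|part (a j)| <= 2 * rnorm x + d / 25 * S.
  move=> partD partn.
  have part0 : part 0 = 0 by apply: (addrI (part 0)); rewrite -partD !addr0.
  have partN y : part (- y) = - part y by apply: (addrI (part y)); rewrite -partD !subrr.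
  pose t j := 0 <= part (a j).
  have [f cf Hf] := H t L; have [g cg Hg] := H (fun j => ~~ t j) L.
  pose sg j : K := if t j then 1 else -1.
  have psg j : part (sg j * a j) = `|part (a j)|.
    rewrite /sg /t; case: ifPn => h; first by rewrite mul1r ger0_norm.
    by rewrite mulN1r partN ltr0_norm// ltNge.
  have h1 : \sum_(j < L) `|part (a j)| <= rnorm (\sum_(j < L) sg j * a j : K^o).
    apply: le_trans (partn _); apply: le_trans (ler_norm _).
    rewrite le_eqVlt; apply/orP; left; apply/eqP; symmetry.
    rewrite (big_morph part partD part0); apply: eq_bigr => j _; exact: psg.
  have h2 : f x - g x = (c true - c false) * (\sum_(j < L) sg j * a j) +
      \sum_(j < L) a j * (f (u (n j)) - g (u (n j)) - sg j * (c true - c false)).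
    rewrite mulr_sumr -big_split /= /x (linear_sum f) (linear_sum g) -sumrB; apply: eq_bigr => j _.
    rewrite !linearZ /= -[X in _ = X]/(_ + _).
    rewrite -[f _ in LHS]/(f (u (n j)) : K) -[g _ in LHS]/(g (u (n j)) : K).
    rewrite -![_ *: _]/(_ * _); ring.
  have h3 : rnorm (\sum_(j < L) a j * (f (u (n j)) - g (u (n j)) - sg j * (c true - c false)) : K^o) <=
      d / 25 * S.
    apply: le_trans (ler_rnorm_sum (V := K^o) _ _ _) _; rewrite mulr_sumr; apply: ler_sum => j _.
    rewrite rnormM mulrC; apply: ler_wpM2r; first exact: rnorm_ge0.
    have := Hf j (ltn_ord j); have := Hg j (ltn_ord j); rewrite /near_value /= /sg -/d.
    case: (t j) => /= k1 k2.
      have -> : f (u (n j)) - g (u (n j)) - 1 * (c true - c false) =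
        (f (u (n j)) - c true) - (g (u (n j)) - c false) :> K by ring.
      by apply: le_trans (ler_rnormD (_ : K^o) (_ : K^o)) _; rewrite rnormN; lra.
    have -> : f (u (n j)) - g (u (n j)) - (-1) * (c true - c false) =
      (f (u (n j)) - c false) - (g (u (n j)) - c true) :> K by ring.
    by apply: le_trans (ler_rnormD (_ : K^o) (_ : K^o)) _; rewrite rnormN; lra.
  have h4 : rnorm (f x - g x) <= 2 * rnorm x.
    by rewrite (le_trans (ler_rnormD _ _))// rnormN; have := cf x; have := cg x; lra.
  have h5 : rnorm ((c true - c false) * (\sum_(j < L) sg j * a j) : K^o) = d * rnorm (\sum_(j < L) sg j * a j : K^o).
    exact: rnormM.
  have h6 : d * rnorm (\sum_(j < L) sg j * a j : K^o) <= rnorm (f x - g x) +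
     rnorm (\sum_(j < L) a j * (f (u (n j)) - g (u (n j)) - sg j * (c true - c false)) : K^o).
    rewrite -h5 -(rnormN (\sum_(j < L) a j * _ : K^o)); apply: le_trans (ler_rnormD _ _).
    by rewrite h2 addrK.
  have := ler_wpM2l d0 h1; lra.
have h1 := key _ (@re_partD R s) (@re_part_norm R s).
have h2 := key _ (@im_partD R s) (@im_part_norm R s).
have h3 : S <= \sum_(j < L) `|re_part (a j)| + \sum_(j < L) `|im_part (a j)|.
  by rewrite -big_split; apply: ler_sum => j _; exact: rnorm_parts.
have h4 := ler_wpM2l d0 h3.
have := rnorm_ge0 x; lra.
Qed.

Hypothesis Xc : rcomplete X.

Theorem rosenthal : ~ contains_copy X (ell1 (R := R) (s := s)) ->
  exists2 phi : nat -> nat, {homo phi : m n / (m < n)%N} & wcauchy ((u : nat -> realify X) \o phi).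
Proof.
move=> nl1; apply: (weak_cauchy_or_bad uM) => c cn S uS bS; apply: nl1.
have [n Hn] := independent_sequence uS bS.
have low := independent_lower Hn.
have M0 : 0 <= M by apply: le_trans (uM 0%N); exact: rnorm_ge0.
have lin j : linear (fun a : K^o => a *: u (n j)) by move=> a x y; rewrite scalerDl scalerA.
pose A j : {linear K^o -> X} := HB.pack (fun a : K^o => a *: u (n j)) (GRing.isLinear.Build _ _ _ _ _ (lin j)).
have [|U [Uu Uf]] := @sum_operator R s (fun=> K^o) 1%:E (lexx _) X A M Xc M0.
  move=> L f; rewrite lps1 mulr_sumr; apply: le_trans (ler_rnorm_sum _ _ _) _.
  apply: ler_sum => j _; rewrite /= rnormZE mulrC /coords ger0_norm ?rnorm_ge0//.
  by rewrite ler_wpM2r ?rnorm_ge0.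
set d := rnorm (c true - c false : K^o) in low.
have d0 : 0 < d.
  rewrite lt_neqAle rnorm_ge0 andbT eq_sym; apply: contra_neq cn => h.
  by apply/eqP; rewrite -subr_eq0; apply/eqP; exact: (@rnorm_eq0 R s K^o _ h).
apply: (@embedding_copy _ U (d / 8) M) => //.
- by apply: lp_sum_complete => _; exact: scalar_complete.
- by rewrite divr_gt0.
move=> y; apply/ler_addgt0Pr => e e0.
have dM : 0 < d / 8 + M by rewrite ltr_pwDl// divr_gt0.
have [N /(_ N (leqnn N)) HN] := tail_cvg y (divr_gt0 e0 dM).
have h1 : d / 8 * rnorm (trunc N y) <= rnorm (U (trunc N y)).
  rewrite (Uf _ N); last by move=> n' Nn'; rewrite truncE ltnNge Nn'.
  apply: le_trans (low N (fun j => val (trunc N y) j)); rewrite ler_pM2l ?divr_gt0//.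
  apply: le_trans (trunc_rnorm _ _) _; rewrite lps1; apply: ler_sum => j _.
  by rewrite /coords ger0_norm ?rnorm_ge0// truncE ltn_ord.
have h2 : rnorm (U (y - trunc N y)) <= M * rnorm (y - trunc N y) by exact: Uu.
have h3 : rnorm y <= rnorm (y - trunc N y) + rnorm (trunc N y).
  by rewrite -{1}(subrK (trunc N y) y) ler_rnormD.
have h4 : rnorm (U (trunc N y)) <= rnorm (U y) + rnorm (U (y - trunc N y)).
  by rewrite -(rnormN (U (y - _))) -raddfN opprB -{1}(subrKC y (trunc N y)) raddfD ler_rnormD.
have h5 : (d / 8 + M) * rnorm (y - trunc N y) <= e.
  by move: HN; rewrite ler_pdivlMr// mulrC.
have := ler_wpM2l (ltW d0) h3; lra.
Qed.

End l1_copy.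

(** * Quotients of lp_sum have property (m_p) *)

(** Uniform boundedness by a gliding hump. The limit f of the sums of 4^-k F (n k), with F norming,
    is tested at u (n k): the k-th term contributes c >= 6, the earlier ones at most 1 in modulus
    and the later ones at most c / 3. So f exceeds 1 at arbitrarily late indices. *)
Lemma wnull_bounded {R : realType} (V : normedModType R) (u : nat -> V) :
  wnull u -> exists M : R, forall n, `|u n| <= M.
Proof.
move=> un; apply: contrapT => H.
pose w k : R := 4^-1 ^+ k.
have w0 k : 0 < w k by rewrite exprn_gt0// invr_gt0.
have wS k : w k.+1 = w k / 4 by rewrite /w exprSr.
have w1 k : w k <= 1 by rewrite exprn_ile1 ?invr_ge0// invf_le1// ler1n.
have /boolp.choice[F HF] : forall n, exists f : dual V, `|f| <= 1 /\ f (u n) = `|u n|.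
  by move=> n; exact: dual_norming.
have /boolp.choice[N HN] : forall Sk : dual V * nat, exists n,
    [/\ (Sk.2 <= n)%N, `|Sk.1 (u n)| <= 1 & 6 <= w Sk.2 * `|u n|].
  move=> [S k] /=; have /cvgn_distP/(_ _ ltr01)[N HN] := un S.
  apply: contrapT => H'; apply: H.
  exists (\sum_(i < maxn N k) `|u i| + 6 / w k) => n; rewrite leNgt; apply/negP => h.
  have u3 : 6 / w k <= `|u n| by apply: le_trans (ltW h); rewrite lerDr sumr_ge0.
  have [nN|Nn] := ltnP n (maxn N k).
    move: h; rewrite ltNge => /negP; apply.
    rewrite (bigD1 (Ordinal nN))//= -addrA lerDl addr_ge0 ?sumr_ge0// divr_ge0// ltW//.
  move: Nn; rewrite geq_max => /andP[Nn kn].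
  apply: H'; exists n; split => //; first by have := HN n Nn; rewrite subr0.
  by move: u3; rewrite ler_pdivrMr// mulrC.
pose fix S k : dual V := if k is k'.+1 then S k' + w k' *: F (N (S k', k')) else 0.
pose n k := N (S k, k).
have Sd m k : `|S (k + m)%N - S k| <= 4 / 3 * (w k - w (k + m)%N).
  elim: m => [|m IH]; first by rewrite addn0 !subrr normr0 mulr0.
  rewrite addnS /= addrAC (le_trans (ler_normD _ _))// normrZ (gtr0_norm (w0 _)) wS.
  have [h _] := HF (n (k + m)%N); have := ler_wpM2l (ltW (w0 (k + m)%N)) h; rewrite /n; lra.
have [|f [fS _]] := @dual_ulim R V S 2.
  by move=> k; have := Sd k 0%N; rewrite add0n subr0; have := w0 k; have := w1 0%N; lra.
have fd k x : `|f x - S k x| <= 4 / 3 * w k * `|x|.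
  apply/ler_addgt0Pr => e e0.
  have [m km] := ultra_freq k (cvg_ultra_dist e0 (fS x)); rewrite /= -(subnKC km) => h.
  have := le_trans (dual_ub (S (k + (m - k))%N - S k) x) (ler_wpM2r (normr_ge0 x) (Sd (m - k)%N k)).
  have := mulr_ge0 (ltW (w0 (k + (m - k))%N)) (normr_ge0 x).
  rewrite dualB; have := ler_distD (S (k + (m - k))%N x) (f x) (S k x).
  rewrite (distrC (f x) (S (k + _)%N x)); lra.
have /cvgn_distP/(_ _ (ltr0n R 1))[N0 HN0] := un f.
have [Nn S1 u3] := HN (S N0, N0).
have := HN0 _ Nn; rewrite subr0; have := fd N0.+1 (u (n N0)).
rewrite /= dualD dualZ (HF _).2 wS /= -/(n N0).
move: S1 u3; rewrite /= -/(n N0).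
move: (S N0 (u (n N0))) (f (u (n N0))) => a b.
rewrite !ler_norml; set c := w N0 * _ => /andP[a1 a2] u3.
rewrite (_ : 4 / 3 * (w N0 / 4) * `|u (n N0)| = c / 3); last by rewrite /c; field.
move=> /andP[b1 b2] /andP[b3 b4]; lra.
Qed.

Lemma fd_real_span {R : realType} {s : scalars} (V : normedModType (scalar_field R s)) :
  finite_dimensional V -> exists (v : nat -> realify V) D, forall x, span v D x.
Proof.
move=> [n [v Hv]].
pose v' (k : nat) : realify V := if (insub k : option 'I_n) is Some i then v i else
  if (insub (k - n)%N : option 'I_n) is Some i then jay *: v i else 0.
exists v', (n + n)%N => x; have [c ->] := Hv x.
apply: span_sum => i _; rewrite (scalar_parts (c i)) scalerDl -scalerA.
have v1 : span v' (n + n) (v i : realify V).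
  have -> : (v i : realify V) = v' i by rewrite /v' valK.
  by apply: span_gen; rewrite ltn_addl.
have v2 : span v' (n + n) (jay *: v i : realify V).
  have -> : (jay *: v i : realify V) = v' (n + i)%N.
    by rewrite /v' insubF ?addKn ?valK// ltnNge leq_addr.
  by apply: span_gen; rewrite ltn_add2l.
apply: spanD; first exact: (spanZ (re_part (c i)) v1).
exact: (spanZ (im_part (c i)) v2).
Qed.

Section coordinates.
Context {R : realType} {s : scalars}.
Local Notation K := (scalar_field R s).
Variables (E : nat -> normedModType K) (p : \bar R) (p1 : (1 <= p)%E).
Local Notation C := (lp_sum E p1).
Local Notation Cr := (realify C).

Lemma single_key i (x : E i) : exists z : C, val z = eqtype.dfwith (fun n => 0 : E n) x /\ rnorm z <= rnorm x.
Proof.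
have [|z [zE zx]] := @lp_sum_finite R s E p p1 (eqtype.dfwith (fun n => 0 : E n) x) i.+1.
  by move=> n; case: (eqtype.dfwithP (fun n => 0 : E n) x n) => //; rewrite ltnn.
exists z; split => //; apply: (le_trans zx) => /=.
rewrite (@eq_lps _ p i _ (fun=> 0)).
  have -> : lps p i (fun=> 0) = 0 by rewrite (lps_widen p1 (leq0n i)).
  by rewrite lp0l// ger0_norm ?rnorm_ge0// /coords dfwith_in.
move=> n ni; rewrite /coords; case: (eqtype.dfwithP (fun n => 0 : E n) x n) ni; first by rewrite ltnn.
by move=> *; rewrite rnorm0.
Qed.

Definition single i (x : E i) : C := projT1 (cid (single_key x)).

Lemma singleE i (x : E i) n : val (single x) n = eqtype.dfwith (fun n => 0 : E n) x n.
Proof. by rewrite /single; case: cid => z [/= -> _]. Qed.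

Lemma single_rnorm i (x : E i) : rnorm (single x) <= rnorm x.
Proof. by rewrite /single; case: cid => z []. Qed.

Lemma single_linear i : linear (@single i).
Proof.
move=> a x y; apply: lp_sum_eq => n; rewrite val_lin !singleE.
have [->|ni] := eqVneq n i; first by rewrite !dfwith_in.
by rewrite !dfwith_out 1?eq_sym// scaler0 addr0.
Qed.

Lemma trunc0 (y : C) : trunc 0 y = 0.
Proof. by apply: lp_sum_eq => n; rewrite truncE. Qed.

Lemma truncS N (y : C) : trunc N.+1 y = trunc N y + single (val y N).
Proof.
apply: lp_sum_eq => n; rewrite valD !truncE singleE ltnS leq_eqVlt.
have [->|nN] := eqVneq n N; first by rewrite ltnn dfwith_in add0r.
by rewrite dfwith_out 1?eq_sym// addr0.
Qed.

Lemma truncK N M (y : C) : (forall n, (N <= n)%N -> val y n = 0) -> (N <= M)%N -> trunc M y = y.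
Proof.
move=> y0 NM; apply: lp_sum_eq => n; rewrite truncE ltnNge; case: leqP => //= Mn.
by rewrite y0// (leq_trans NM).
Qed.

Lemma tailK N (y : C) : (forall n, (n < N)%N -> val y n = 0) -> y - trunc N y = y.
Proof. by move=> y0; apply: lp_sum_eq => n; rewrite tailE; case: ifP => // /y0 ->. Qed.

Lemma tail_le N (y : C) : rnorm (y - trunc N y) <= rnorm y.
Proof.
apply/lp_sum_leP => [|M]; first exact: rnorm_ge0.
apply: le_trans (lps_le_rnorm y M); apply: lps_le => // i _; rewrite rnorm_ge0 /coords tailE.
by case: ifP => _; rewrite ?rnorm0 ?rnorm_ge0/=.
Qed.

(** Induction on the number of coordinates: each coordinate space is finite dimensional, so
    smallness at finitely many generators becomes uniform on its bounded sets. *)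
Lemma functional_on_truncs (phi : nat -> dual Cr) (y : nat -> C) (M B : R) :
  (forall n, finite_dimensional (E n)) ->
  (forall n, `|phi n| <= M) -> (forall z, phi n z @[n --> ultra] --> (0 : R)) ->
  (forall n, rnorm (y n) <= B) ->
  forall N (e : R), 0 < e -> ultra [set n | `|phi n (trunc N (y n))| <= e].
Proof.
move=> Efd pM p0 yB; elim=> [|N IH] e e0.
  by apply: filterS filterT => n _ /=; rewrite trunc0 dapp0 normr0 ltW.
have M0 : 0 <= M by apply: le_trans (pM 0%N).
have B0 : 0 <= B by apply: le_trans (yB 0%N); exact: rnorm_ge0.
have [v [D Hv]] := fd_real_span (Efd N).
have B1 : 0 < B + 1 by lra.
have e1 : 0 < e / 2 / (B + 1) by rewrite !divr_gt0.
have [d d0 Hd] := @span_uniform R _ v D M _ e1.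
have /boolp.choice[psi Hpsi] : forall n, exists f : dual (realify (E N)),
    (forall x, f x = phi n (single x)) /\ `|f| <= M.
  move=> n; apply: dual_make => // [t x z|x]; first by rewrite -dapp_linear; congr dapp; exact: single_linear.
  apply: (le_trans (dual_le _ _)); apply: ler_pM => //; exact: single_rnorm.
have U1 : ultra [set n | forall i, (i < D)%N -> `|psi n (v i)| <= d].
  elim: D {Hv Hd} => [|D IHD]; first by apply: filterS filterT.
  apply: filterS (filterI IHD (cvg_ultra_dist d0 (p0 (single (v D))))) => n /= [h1].
  rewrite subr0 -(Hpsi n).1 => h2 i; rewrite ltnS leq_eqVlt => /predU1P[->//|]; exact: h1.
have e2 : 0 < e / 2 by lra.
apply: filterS (filterI U1 (IH _ e2)) => n /= [h1 h2].
rewrite truncS dappD (le_trans (ler_normD _ _))// [e]splitr lerD// -(Hpsi n).1.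
have := Hd _ (Hpsi n).2 h1 ((B + 1)^-1 *: (val (y n) N : realify (E N))) (Hv _).
rewrite normrZ dappZ normrM gtr0_norm ?invr_gt0// mulrC ler_pdivrMr// mul1r => h.
have : `|psi n (val (y n) N)| / (B + 1) <= e / 2 / (B + 1).
  rewrite mulrC; apply: h; apply: le_trans (coord_le_rnorm _ _) _.
  by apply: le_trans (yB n) _; rewrite lerDl.
by rewrite ler_pM2r// invr_gt0.
Qed.

(** Otherwise g is at least e / 2 on infinitely many vectors of norm at most 1 with successive
    supports. The sum of L of them has norm at most kappa L and value at least L e / 2, against
    [kappa_small]. *)
Lemma functional_tail (p1s : (1 < p)%E) (g : dual Cr) (e : R) : 0 < e -> exists N, forall n, (N <= n)%N ->
  forall y : C, `|g (y - trunc n y)| <= e * rnorm y.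
Proof.
move=> e0; apply: contrapT => H.
have step (N : nat) : exists zN : C * nat, [/\ (N <= zN.2)%N, rnorm zN.1 <= 1, e / 2 <= g zN.1 &
    forall n, ~~ (N <= n < zN.2)%N -> val zN.1 n = 0].
  have [n Nn [y Hy]] : exists2 n, (N <= n)%N & exists y, e * rnorm y < g (y - trunc n y).
    apply: contrapT => H'; apply: H; exists N => n Nn y; rewrite ler_norml lerNl.
    apply/andP; split; rewrite leNgt; apply/negP => h; apply: H'; exists n => //.
      exists (- y); rewrite rnormN (_ : - y - trunc n (- y) = - (y - trunc n y)) ?dappN//.
      apply: lp_sum_eq => i; rewrite -[RHS]/(- val (y - trunc n y) i) !tailE.
      by case: ifP => //; rewrite oppr0.
    by exists y.
  set w : C := y - trunc n y in Hy; have wy : rnorm w <= rnorm y by exact: tail_le.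
  have gw : e * rnorm w < g w by apply: le_lt_trans Hy; rewrite ler_pM2l.
  have w0 : 0 < rnorm w.
    rewrite lt_neqAle rnorm_ge0 andbT eq_sym; apply/negP => /eqP/rnorm_eq0 h.
    by move: gw; rewrite h dapp0 rnorm0 mulr0 ltxx.
  have G1 : 0 < `|g| + 1 by rewrite ltr_wpDl.
  have e1 : 0 < e / 2 * rnorm w / (`|g| + 1) by rewrite divr_gt0// mulr_gt0// divr_gt0.
  have [N' HN'] := tail_cvg w e1.
  pose z : C := trunc (maxn N N') w.
  have gz : e / 2 * rnorm w <= g z.
    have h1 : g (w - z : C) <= e / 2 * rnorm w.
      apply: (le_trans (dual_le _ _)).
      have := HN' _ (leq_maxr N N'); rewrite ler_pdivlMr// => /(le_trans _); apply.
      by rewrite mulrC realify_norm ler_wpM2l ?rnorm_ge0// lerDl.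
    have : g w = g z + g (w - z : C) by rewrite -dappD; congr dapp; rewrite /= subrKC.
    lra.
  exists (((rnorm w)^-1 *: (z : Cr) : Cr) : C, maxn N N'); split => /=.
  - exact: leq_maxl.
  - rewrite -realify_norm normrZ gtr0_norm ?invr_gt0// mulrC ler_pdivrMr// mul1r realify_norm.
    by apply: le_trans (trunc_rnorm _ _) (lps_le_rnorm _ _).
  - by rewrite dappZ [leRHS]mulrC ler_pdivlMr.
  - move=> i Hi; rewrite -[LHS]/(of_real (rnorm w)^-1 *: val z i).
    rewrite truncE; case: ifP => [iN|_]; last by rewrite scaler0.
    by rewrite tailE; case: ifPn; rewrite ?scaler0// -leqNgt => ni; rewrite (leq_trans Nn ni) iN in Hi.
have /boolp.choice[h Hh] := step.
pose N k := iter k (fun n => (h n).2) 0%N.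
pose z k := (h (N k)).1.
pose Z L : C := \sum_(k < L) z k.
have Z0 L n : (N L <= n)%N -> val (Z L) n = 0.
  rewrite /Z; elim: L n => [|L IH] n Ln; first by rewrite big_ord0.
  have [h1 _ _ h2] := Hh (N L).
  have Ln' : ((h (N L)).2 <= n)%N by exact: Ln.
  rewrite big_ord_recr valD IH; last exact: leq_trans Ln'.
  rewrite add0r; apply: h2; rewrite negb_and; apply/orP; right; by rewrite -leqNgt.
have Zn L : rnorm (Z L) <= kappa p L.
  rewrite /Z /kappa; elim: L => [|L IH]; first by rewrite big_ord0 rnorm0.
  have [h1 h2 _ h3] := Hh (N L).
  rewrite big_ord_recr /= -/(Z L) -(truncK (Z0 L) (leqnn _)) -(@tailK (N L) (z L)); last first.
    by move=> n nL; apply: h3; rewrite leqNgt nL.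
  apply: le_trans (lp_sum_join _ _ _) _; rewrite (truncK (Z0 L) (leqnn _)) tailK; last first.
    by move=> n nL; apply: h3; rewrite leqNgt nL.
  by apply: lp_le => //; rewrite rnorm_ge0 /=.
have gZ L : L%:R * (e / 2) <= g (Z L).
  rewrite /Z; elim: L => [|L IH]; first by rewrite big_ord0 dapp0 mul0r.
  have [_ _ hg _] := Hh (N L).
  rewrite big_ord_recr dappD -natr1 mulrDl mul1r; exact: lerD.
have G1 : 0 < `|g| + 1 by rewrite ltr_wpDl.
have e1 : 0 < e / 4 / (`|g| + 1) by rewrite !divr_gt0.
have [k Hk] := kappa_small p1 p1s e1.
have := le_trans (gZ (2 ^ k)%N) (dual_le g (Z (2 ^ k)%N)).
have L0 : 0 < (2 ^ k)%:R :> R by rewrite ltr0n expn_gt0.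
have h1 : `|g| * rnorm (Z (2 ^ k)%N) <= (`|g| + 1) * kappa p (2 ^ k).
  by apply: ler_pM; rewrite ?rnorm_ge0// lerDl.
have h2 : (`|g| + 1) * kappa p (2 ^ k) <= e / 4 * (2 ^ k)%:R.
  by move: Hk; rewrite mulrAC ler_pdivlMr// mulrC.
rewrite realify_norm => h3; have h4 := le_trans h3 (le_trans h1 h2).
have := mulr_gt0 e0 L0; lra.
Qed.

End coordinates.

Section quotient_asymptotics.
Context {R : realType} {s : scalars}.
Local Notation K := (scalar_field R s).
Variables (E : nat -> normedModType K) (p : \bar R) (p1 : (1 <= p)%E).
Hypothesis p1s : (1 < p)%E.
Hypothesis Efd : forall n, finite_dimensional (E n).
Local Notation C := (lp_sum E p1).
Local Notation Cr := (realify C).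
Variable X : normedModType K.
Local Notation Xr := (realify X).
Local Notation lp := (lp_norm2 p).

(** The norm of a quotient is an infimum that need not be attained, hence the slack e in the
    lifts. *)
Definition almost_quotient (lam : R) (Q : {linear C -> X}) :=
  (forall y, rnorm (Q y) <= rnorm y) /\
  forall x (e : R), 0 < e -> exists y, Q y = x /\ rnorm y <= lam * rnorm x + e.

Section fixed_map.
Variables (lam : R) (Q : {linear C -> X}).
Hypotheses (lam1 : 1 <= lam) (QQ : almost_quotient lam Q).

Let pull (f : dual Xr) : exists g : dual Cr, (forall y, g y = f (Q y)) /\ `|g| <= `|f|.
Proof.
apply: dual_make => // [t y z|y].
  rewrite -dapp_linear; congr dapp; exact: (linearP Q (of_real t) y z).
apply: (le_trans (dual_le f _)); rewrite ler_wpM2l// !realify_norm; exact: QQ.1.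
Qed.

Variables (x : X) (u : nat -> X) (t B : R).
Hypotheses (un : wnull (u : nat -> Xr)) (ut : rnorm (u n) @[n --> \oo] --> t).
Hypothesis uB : forall n, rnorm (u n) <= B.

Let t0 : 0 <= t.
Proof.
rewrite -(cvg_lim (@Rhausdorff R) ut); apply: limr_ge; first exact: cvgP ut.
by apply: nearW => n; exact: rnorm_ge0.
Qed.

(** Let f n norm x + u n. On the initial segment of the lift z n, g n is close to gl, and gl is
    small there because both fl (u n) and gl on the tail are small. So u n counts only through the
    tail of its lift, and x only through an initial segment. *)
Lemma quotient_upper (e : R) : 0 < e -> exists n, rnorm (x + u n) <= lam * lp (rnorm x) t + e.
Proof.
move=> e0; have l1 := lam1; have l0 : 0 <= lam by lra.
have B0 : 0 <= B by apply: le_trans (uB 0%N); exact: rnorm_ge0.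
have [B' B'E] : exists B', B' = lam * B + e by exists (lam * B + e).
have B'0 : 0 <= B' by rewrite B'E addr_ge0 ?mulr_ge0// ltW.
have m0 : 0 < 5 + lam + B' by lra.
have [d d0 dE] : exists2 d : R, 0 < d & d * (5 + lam + B') = e.
  by exists (e / (5 + lam + B')); [rewrite divr_gt0|rewrite divfK ?gt_eqF].
have de : d <= e by rewrite -dE ler_peMr ?(ltW d0)//; lra.
have /boolp.choice[f Hf] : forall n, exists f : dual Xr, `|f| <= 1 /\ f (x + u n : X) = rnorm (x + u n).
  by move=> n; exact: (dual_norming (x + u n : Xr)).
have [|fl [fE fl1]] := @dual_ulim R Xr f 1; first by move=> n; have [] := Hf n.
have /boolp.choice[g Hg] : forall n, exists g : dual Cr, (forall y, g y = f n (Q y)) /\ `|g| <= `|f n|.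
  by move=> n; exact: pull.
have [gl [glE gl1]] := pull fl.
have [y [yx yn]] := QQ.2 x _ d0.
have /boolp.choice[z Hz] : forall n, exists z, Q z = u n /\ rnorm z <= lam * rnorm (u n) + d.
  by move=> n; exact: QQ.2.
have zB n : rnorm (z n) <= B'.
  by apply: (le_trans (Hz n).2); rewrite B'E lerD// ler_wpM2l.
have [N1 HN1] := functional_tail p1s gl d0.
have [N2 HN2] := tail_cvg y d0.
pose N := maxn N1 N2.
have H1 := HN1 N (leq_maxl _ _); have H2 := HN2 N (leq_maxr _ _).
have phi2 n : `|g n - gl| <= 2.
  rewrite (le_trans (ler_normB _ _))//; have := (Hg n).2; have := (Hf n).1; lra.
have phi0 w : (g n - gl : dual Cr) w @[n --> ultra] --> (0 : R).
  rewrite -(subrr (gl w)); under eq_fun do rewrite dualB (Hg _).1.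
  by apply: cvgB; [rewrite glE; exact: fE|exact: cvg_cst].
have U1 := functional_on_truncs Efd phi2 phi0 zB N d0.
have U2 := cvg_ultra_dist d0 (cvg_ultra (un fl)).
have U3 := cvg_ultra_dist d0 (cvg_ultra ut).
have [n _ /= [[h1 h2] h3]] := ultra_freq 0 (filterI (filterI U1 U2) U3).
exists n; have [Qz zn] := Hz n.
have tK (w : C) : w = trunc N w + (w - trunc N w) by rewrite subrKC.
have e1 : rnorm (x + u n) = f n x + f n (u n) by rewrite -dappD (Hf n).2.
have e2 : f n x = g n (trunc N y) + g n (y - trunc N y).
  by rewrite -[in LHS]yx -(Hg n).1 {1}(tK y); exact: dappD.
have e3 : f n (u n) = g n (trunc N (z n)) + g n (z n - trunc N (z n)).
  by rewrite -[in LHS]Qz -(Hg n).1 {1}(tK (z n)); exact: dappD.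
have e4 : fl (u n) = gl (trunc N (z n)) + gl (z n - trunc N (z n)).
  by rewrite -[in LHS]Qz -glE {1}(tK (z n)); exact: dappD.
have i1 : `|g n (y - trunc N y)| <= d.
  apply: (le_trans (dual_ub _ _)); apply: le_trans (_ : 1 * rnorm (y - trunc N y) <= _); last by rewrite mul1r.
  by apply: ler_wpM2r; [exact: rnorm_ge0|exact: le_trans (Hg n).2 (Hf n).1].
have i2 : `|gl (z n - trunc N (z n))| <= d * B'.
  by apply: (le_trans (H1 _)); rewrite ler_wpM2l ?(ltW d0).
have i3 : g n (trunc N y) + g n (z n - trunc N (z n)) <= lp (lam * rnorm x + d) (lam * (t + d) + d).
  rewrite -dappD; apply: (le_trans (dual_le _ _)).
  apply: (@le_trans _ _ (1 * rnorm (trunc N y + (z n - trunc N (z n))))).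
    by apply: ler_wpM2r; [exact: rnorm_ge0|exact: le_trans (Hg n).2 (Hf n).1].
  rewrite mul1r (le_trans (lp_sum_join _ _ _))//; apply: lp_le => //; rewrite rnorm_ge0 /=.
    by apply: le_trans yn; apply: le_trans (trunc_rnorm _ _) (lps_le_rnorm _ _).
  apply: le_trans (tail_le _ _) _; apply: le_trans zn _; rewrite lerD2r ler_wpM2l//.
  by move: h3; rewrite ler_distl => /andP[].
have i4 : lp (lam * rnorm x + d) (lam * (t + d) + d) <= lam * lp (rnorm x) t + (d * (2 + lam)).
  have k0 := ltW d0; have k1 : 0 <= lam * d + d by rewrite addr_ge0 ?mulr_ge0.
  have -> : lam * (t + d) + d = lam * t + (lam * d + d) by rewrite mulrDr addrA.
  apply: le_trans (lpD p1 _ _ _ _) _; rewrite lpZ// lerD2l.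
  apply: le_trans (lp_leD p1 _ _) _; rewrite (ger0_norm k0) (ger0_norm k1).
  by rewrite le_eqVlt; apply/orP; left; apply/eqP; ring.
move: h1 h2; rewrite dualB subr0 => h1 h2.
move: h1 h2 i1 i2; rewrite !ler_norml => /andP[_ h1] /andP[_ h2] /andP[_ i1] /andP[i2 _].
rewrite e1 e2 e3; clear -h1 h2 i1 i2 i3 i4 dE e4; nra.
Qed.

(** A lift of x + u n is cut into T and W. The functional h norming x sees only T, as h (u n) -> 0
    and its pullback is small on tails. With f n norming u n, the value g n T is close to gl T,
    hence to fl x and to f n x; so f n (u n) is close to g n W. *)
Lemma quotient_lower (e : R) : 0 < e -> exists n, lp (rnorm x) t <= lam * rnorm (x + u n) + e.
Proof.
move=> e0; have l1 := lam1; have l0 : 0 <= lam by lra.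
have B0 : 0 <= B by apply: le_trans (uB 0%N); exact: rnorm_ge0.
have x0 := rnorm_ge0 x.
have [B' B'E] : exists B', B' = lam * (rnorm x + B) + e by exists (lam * (rnorm x + B) + e).
have B'0 : 0 <= B' by rewrite B'E addr_ge0 ?mulr_ge0 ?addr_ge0// ltW.
have m0 : 0 < 6 + 2 * B' by lra.
have [d d0 dE] : exists2 d : R, 0 < d & d * (6 + 2 * B') = e.
  by exists (e / (6 + 2 * B')); [rewrite divr_gt0|rewrite divfK ?gt_eqF].
have de : d <= e by rewrite -dE ler_peMr ?(ltW d0)//; lra.
have /boolp.choice[f Hf] : forall n, exists f : dual Xr, `|f| <= 1 /\ f (u n : X) = rnorm (u n).
  by move=> n; exact: (dual_norming (u n : Xr)).
have [h [h1 hx]] := dual_norming (x : Xr).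
have [|fl [fE fl1]] := @dual_ulim R Xr f 1; first by move=> n; have [] := Hf n.
have /boolp.choice[g Hg] : forall n, exists g : dual Cr, (forall y, g y = f n (Q y)) /\ `|g| <= `|f n|.
  by move=> n; exact: pull.
have [gl [glE gl1]] := pull fl.
have [gh [ghE gh1]] := pull h.
have /boolp.choice[z Hz] : forall n, exists z, Q z = x + u n /\ rnorm z <= lam * rnorm (x + u n) + d.
  by move=> n; exact: QQ.2.
have zB n : rnorm (z n) <= B'.
  apply: (le_trans (Hz n).2); rewrite B'E lerD// ler_wpM2l//.
  by rewrite (le_trans (ler_rnormD _ _))// lerD2l.
have [N1 HN1] := functional_tail p1s gl d0.
have [N2 HN2] := functional_tail p1s gh d0.
pose N := maxn N1 N2.
have H1 := HN1 N (leq_maxl _ _); have H2 := HN2 N (leq_maxr _ _).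
have phi2 n : `|g n - gl| <= 2.
  rewrite (le_trans (ler_normB _ _))//; have := (Hg n).2; have := (Hf n).1; lra.
have phi0 w : (g n - gl : dual Cr) w @[n --> ultra] --> (0 : R).
  rewrite -(subrr (gl w)); under eq_fun do rewrite dualB (Hg _).1.
  by apply: cvgB; [rewrite glE; exact: fE|exact: cvg_cst].
have U1 := functional_on_truncs Efd phi2 phi0 zB N d0.
have U2 := cvg_ultra_dist d0 (cvg_ultra (un fl)).
have U3 := cvg_ultra_dist d0 (cvg_ultra ut).
have U4 := cvg_ultra_dist d0 (cvg_ultra (un h)).
have U5 := cvg_ultra_dist d0 (fE x).
have [n _ /= [[h3 h4] [[h5 h6] h7]]] := ultra_freq 0 (filterI (filterI U1 U2) (filterI (filterI U3 U4) U5)).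
exists n; have [Qz zn] := Hz n.
have tK (w : C) : w = trunc N w + (w - trunc N w) by rewrite subrKC.
set T := trunc N (z n) in h3; set W := z n - trunc N (z n).
have TW : Q (T + W) = x + u n by rewrite -tK.
have e1 : h x + h (u n) = gh T + gh W by rewrite -dappD -[X in h X]TW -ghE; exact: dappD.
have e2 : f n x + f n (u n) = g n T + g n W by rewrite -dappD -[X in f n X]TW -(Hg n).1; exact: dappD.
have e3 : fl x + fl (u n) = gl T + gl W by rewrite -dappD -[X in fl X]TW -glE; exact: dappD.
have i1 : `|gl W| <= d * B' by apply: (le_trans (H1 _)); rewrite ler_wpM2l ?(ltW d0).
have i2 : `|gh W| <= d * B' by apply: (le_trans (H2 _)); rewrite ler_wpM2l ?(ltW d0).
have i3 : gh T <= rnorm T.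
  apply: (le_trans (dual_le _ _)); rewrite -[leRHS]mul1r realify_norm ler_wpM2r ?rnorm_ge0//.
  exact: le_trans gh1 h1.
have i4 : g n W <= rnorm W.
  apply: (le_trans (dual_le _ _)); rewrite -[leRHS]mul1r realify_norm ler_wpM2r ?rnorm_ge0//.
  exact: le_trans (Hg n).2 (Hf n).1.
have i5 : lp (rnorm T) (rnorm W) <= rnorm (z n) by exact: lp_sum_split.
have fu := (Hf n).2.
move: h3 h4 h5 h6 h7 i1 i2 hx fu; rewrite dualB !subr0 realify_norm !ler_norml.
move=> /andP[_ h3] /andP[_ h4] /andP[h5 _] /andP[h6 _] /andP[h7 _] /andP[i1 _] /andP[_ i2] hx fu.
have a1 : rnorm x <= rnorm T + d * (1 + B') by clear -h6 e1 i2 i3 hx; lra.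
have a2 : t <= rnorm W + d * (4 + B') by clear -h3 h4 h5 h7 e2 e3 i1 i4 fu; lra.
have t0' := t0.
apply: (@le_trans _ _ (lp (rnorm T + d * (1 + B')) (rnorm W + d * (4 + B')))).
  by apply: lp_le => //; rewrite ?x0 ?t0'.
apply: le_trans (lpD p1 _ _ _ _) _.
apply: (@le_trans _ _ (lam * rnorm (x + u n) + d + (d * (1 + B') + d * (4 + B')))).
  apply: lerD; first exact: le_trans i5 zn.
  have k1 : 0 <= d * (1 + B') by rewrite mulr_ge0 ?(ltW d0)// addr_ge0.
  have k2 : 0 <= d * (4 + B') by rewrite mulr_ge0 ?(ltW d0)// addr_ge0.
  by apply: le_trans (lp_leD p1 _ _) _; rewrite (ger0_norm k1) (ger0_norm k2).
rewrite -addrA lerD2l -dE le_eqVlt; apply/orP; left; apply/eqP; ring.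
Qed.

End fixed_map.

Theorem quotients_asymptotic_lp :
  (forall e : R, 0 < e -> exists Q, almost_quotient (1 + e) Q) -> asymptotic_lp Xr p.
Proof.
move=> H x u t un ut.
have [B uB] := wnull_bounded un.
have lp0 : 0 <= lp `|x| t by exact: lp_ge0.
have B0 : 0 <= B by apply: le_trans (uB 0%N).
apply: cvgn_subseqs => phi hphi e e0.
have un' : wnull ((u : nat -> Xr) \o phi) := fun f => cvg_subseq hphi (un f).
have ut' := cvg_subseq hphi ut.
have m0 : 0 < lp `|x| t + (`|x| + B) + 1 by have := normr_ge0 x; lra.
have [d d0 dE] : exists2 d : R, 0 < d & d * (lp `|x| t + (`|x| + B) + 1) = e / 2.
  by exists (e / 2 / (lp `|x| t + (`|x| + B) + 1)); [rewrite !divr_gt0|rewrite divfK ?gt_eqF].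
have [Q HQ] := H _ d0.
have l1 : 1 <= 1 + d by lra.
have e2 : 0 < e / 2 by lra.
have d1 := mulr_ge0 (ltW d0) lp0.
have d2 := mulr_ge0 (ltW d0) (normr_ge0 x).
have d3 := mulr_ge0 (ltW d0) B0.
split.
  have [k hk] := quotient_upper l1 HQ x un' ut' (fun n => uB (phi n)) e2.
  exists k; apply: (le_trans hk); rewrite -[rnorm x]/(`|x|).
  move: d1 d2 d3 dE; rewrite !mulrDl !mulrDr !mul1r !mulr1; lra.
have [k hk] := quotient_lower l1 HQ x un' ut' (fun n => uB (phi n)) e2.
exists k; move: hk; rewrite -[rnorm x]/(`|x|) -[rnorm (_ + _)]/(`|x + u (phi k)|) => hk.
have h1 : `|x + u (phi k)| <= `|x| + B by rewrite (le_trans (ler_normD _ _))// lerD2l.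
have := ler_wpM2l (ltW d0) h1.
move: hk d1 d2 d3 dE; rewrite !mulrDl !mulrDr !mul1r !mulr1; lra.
Qed.

End quotient_asymptotics.

(** * Operator norms and the passage from Banach-Mazur distance to quotient maps *)

Lemma mul_lt_slack {R : realType} (a b m : R) : 0 <= a -> a * b < m ->
  exists2 c : R, b < c & a * c <= m.
Proof.
move=> a0 ab; have a1 : 0 < a + 1 by rewrite ltr_wpDl.
exists (b + (m - a * b) / (a + 1)); first by rewrite ltrDl divr_gt0// subr_gt0.
rewrite mulrDr -lerBrDl mulrCA ger_pMr ?subr_gt0//.
by rewrite ler_pdivrMr// mul1r lerDl.
Qed.

Section opnorm.
Context {R : realType} {s : scalars}.
Local Notation K := (scalar_field R s).
Variables (V W : normedModType K) (T : {linear V -> W}).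

Let oset := [set rnorm (T x) | x in [set x : V | rnorm x <= 1]].

Lemma opnorm_le (c : R) : (forall x, rnorm (T x) <= c * rnorm x) -> 0 <= c -> opnorm T <= c.
Proof.
move=> Tc c0; apply: ge_sup.
  by exists (rnorm (T 0)), 0 => //=; rewrite rnorm0.
by move=> _ [x /= x1 <-]; apply: (le_trans (Tc x)); rewrite ler_piMr.
Qed.

Lemma opnorm_ub : continuous T -> 0 <= opnorm T /\ forall x, rnorm (T x) <= opnorm T * rnorm x.
Proof.
move=> /continuous_linearP[c c0 Tc].
have hs : has_sup oset.
  split; first by exists (rnorm (T 0)), 0 => //=; rewrite rnorm0.
  by exists c => _ [x /= x1 <-]; apply: (le_trans (Tc x)); rewrite ler_piMr.
have op0 : 0 <= opnorm T.
  have : oset (rnorm (T 0)) by exists 0 => //=; rewrite rnorm0.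
  by move=> /(sup_upper_bound hs); rewrite linear0 rnorm0.
split=> // x.
have [/rnorm_eq0 ->|x0] := eqVneq (rnorm x) 0; first by rewrite linear0 !rnorm0 mulr0.
have {}x0 : 0 < rnorm x by rewrite lt_neqAle eq_sym x0 rnorm_ge0.
rewrite -ler_pdivrMr//; apply: sup_upper_bound hs _ _.
exists (of_real (rnorm x)^-1 *: x).
  by rewrite /= rnormZE rnorm_of_real gtr0_norm ?invr_gt0// mulVf ?gt_eqF.
by rewrite linearZ /= rnormZE rnorm_of_real gtr0_norm ?invr_gt0// mulrC.
Qed.

End opnorm.

Section quotient_to_property_m.
Context {R : realType} {s : scalars}.
Local Notation K := (scalar_field R s).
Variables (E : nat -> normedModType K) (p : \bar R) (p1 : (1 <= p)%E).
Local Notation C := (lp_sum E p1).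
Variable X : normedModType K.

(** The inverse S is divided by a constant c slightly above its norm, with |T| c <= 1 + e still
    true; c is positive even if S has norm 0. *)
Lemma banach_mazur_almost_quotient (e : R) (Z : closed_subspace C) : 0 < e ->
  (banach_mazur X (quotient_type Z) < (1 + e)%:E)%E ->
  exists Q : {linear C -> X}, almost_quotient (1 + e) Q.
Proof.
move=> e0 /ereal_inf_lt[_ [T [S [[Tc Sc TSK STK] ->]]]]; rewrite lte_fin => ab.
have [a0 Ta] := opnorm_ub Tc; have [b0 Sb] := opnorm_ub Sc.
set a := opnorm T in ab a0 Ta; set b := opnorm S in ab b0 Sb.
have [c bc ac] := mul_lt_slack a0 ab.
have c0 : 0 < c by exact: le_lt_trans bc.
have ci : rnorm (of_real c^-1 : K^o) = c^-1 by rewrite rnorm_of_real gtr0_norm ?invr_gt0.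
have cc : rnorm (of_real c : K^o) = c by rewrite rnorm_of_real gtr0_norm.
pose q y := of_real c^-1 *: S (quotient_map Z y).
have qlin : linear q.
  by move=> t y z; rewrite /q quotient_mapD quotient_mapZ linearP scalerDr !scalerA mulrC.
pose Q : {linear C -> X} := HB.pack q (GRing.isLinear.Build _ _ _ _ _ qlin).
have qn y : rnorm (quotient_map Z y) <= rnorm y.
  rewrite rnorm_quotient; apply: ge_inf; last by exists y.
  by exists 0 => _ [z _ <-]; exact: rnorm_ge0.
exists Q; split=> [y|x d d0].
  rewrite /Q /= /q rnormZE ci mulrC ler_pdivrMr// (le_trans (Sb _))// mulrC.
  by apply: ler_pM; rewrite ?rnorm_ge0//; exact: ltW.
have [z zT hz] : exists2 z, quotient_map Z z = T x & rnorm z < rnorm (T x) + d / c.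
  have hi : has_inf [set rnorm z | z in [set z | quotient_map Z z = T x]].
    split; first by have [z zT] := quotient_map_surj (T x); exists (rnorm z), z.
    by exists 0 => _ [z _ <-]; exact: rnorm_ge0.
  have [_ [z zT <-] h] := inf_adherent (divr_gt0 d0 c0) hi.
  by exists z => //; rewrite rnorm_quotient.
exists (of_real c *: z); split.
  rewrite linearZ /= /q zT TSK scalerA -of_realM mulfV ?gt_eqF// of_real1 scale1r//.
rewrite rnormZE cc.
have h1 := ler_wpM2l (ltW c0) (ltW hz); rewrite mulrDr mulrCA mulfV ?gt_eqF// mulr1 in h1.
have h2 := ler_wpM2l (ltW c0) (Ta x).
have h3 := ler_wpM2r (rnorm_ge0 x) ac.
rewrite mulrA (mulrC c a) in h2; lra.
Qed.

Lemma quotients_property_m : (1 < p)%E -> (forall n, finite_dimensional (E n)) ->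
  (forall e : R, 0 < e -> exists Z : closed_subspace C,
      (banach_mazur X (quotient_type Z) < (1 + e)%:E)%E) -> property_m p X.
Proof.
move=> p1s Efd H; apply: asymptotic_property_m => //.
  move=> u /weakly_nullP un; exact: wnull_bounded un.
apply: (quotients_asymptotic_lp p1s Efd) => e e0.
have [Z HZ] := H e e0; exact: banach_mazur_almost_quotient HZ.
Qed.

End quotient_to_property_m.

(** * Spaces with property (m_p) are almost quotients of lp_sum *)

Section quotient_of_map.
Context {R : realType} {s : scalars}.
Local Notation K := (scalar_field R s).
Variables (W X : normedModType K) (U : {linear W -> X}).

(* Hahn-Banach for the functional [inf_y (|y| + M |x - U y|)], with [M] large. *)
Lemma approximately_onto (k : R) : 0 <= k ->
  (forall (f : dual (realify X)) (e : R), 0 < e ->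
    exists y, rnorm y <= 1 /\ `|f| <= k * f (U y) + e) ->
  forall x (d e : R), 0 < d -> 0 < e -> exists y, rnorm y <= k * rnorm x + e /\ rnorm (x - U y) <= d.
Proof.
move=> k0 H x d e d0 e0.
have kx : 0 <= k * rnorm x by rewrite mulr_ge0 ?rnorm_ge0.
pose M := (k * rnorm x + e) / d.
have M0 : 0 < M by rewrite divr_gt0//; lra.
pose A (z : realify X) := [set r : R | exists y, r = rnorm y + M * rnorm ((z : X) - U y)].
have A0 z r : A z r -> 0 <= r.
  by move=> [y ->]; apply: addr_ge0; [exact: rnorm_ge0|apply: mulr_ge0; [exact: ltW|exact: rnorm_ge0]].
have Ai z : has_inf (A z).
  split; first by exists (rnorm (0 : W) + M * rnorm ((z : X) - U 0)), 0.
  by exists 0 => r; exact: A0.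
pose rho z := inf (A z).
have rho_le z y : rho z <= rnorm y + M * rnorm ((z : X) - U y).
  by apply: ge_inf; [exact: (Ai z).2|exists y].
have rho_adh z (c : R) : 0 < c -> exists y, rnorm y + M * rnorm ((z : X) - U y) < rho z + c.
  by move=> c0; have [_ [y ->] h] := inf_adherent c0 (Ai z); exists y.
have rho0 z : 0 <= rho z by apply: lb_le_inf; [exact: (Ai z).1|exact: A0].
have rhoD (a b : realify X) : rho (a + b) <= rho a + rho b.
  apply/ler_addgt0Pr => c c0; have c2 : 0 < c / 2 by lra.
  have [y hy] := rho_adh a _ c2; have [z hz] := rho_adh b _ c2.
  apply: le_trans (rho_le _ (y + z)) _.
  have h1 := ler_rnormD y z.
  have h2 : rnorm ((a + b : X) - U (y + z)) <= rnorm ((a : X) - U y) + rnorm ((b : X) - U z).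
    by rewrite raddfD opprD addrACA ler_rnormD.
  have := ler_wpM2l (ltW M0) h2; rewrite mulrDr; lra.
have rhoZ_le (t : R) (a : realify X) : 0 < t -> rho (t *: a) <= t * rho a.
  move=> t0; apply/ler_addgt0Pr => c c0; have [y hy] := rho_adh a _ (divr_gt0 c0 t0).
  apply: le_trans (rho_le _ (of_real t *: y)) _.
  have -> : (t *: a : X) - U (of_real t *: y) = of_real t *: ((a : X) - U y) by rewrite linearZ scalerBr.
  rewrite !rnormZE rnorm_of_real gtr0_norm// mulrCA -mulrDr.
  have := ler_wpM2l (ltW t0) (ltW hy); rewrite [t * (rho a + _)]mulrDr [t * (c / t)]mulrC divfK ?gt_eqF//.
have rhoZ (t : R) (a : realify X) : 0 <= t -> rho (t *: a) = t * rho a.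
  rewrite le_eqVlt => /predU1P[<-|t0].
    rewrite scale0r mul0r; apply/eqP; rewrite eq_le rho0 andbT.
    by have := rho_le 0 0; rewrite linear0 subrr !rnorm0 mulr0 addr0.
  apply/eqP; rewrite eq_le rhoZ_le//=.
  have ti : 0 < t^-1 by rewrite invr_gt0.
  have := rhoZ_le _ (t *: a) ti; rewrite scalerA mulVf ?gt_eqF// scale1r => h.
  by have := ler_wpM2l (ltW t0) h; rewrite mulrA mulfV ?gt_eqF// mul1r.
have [||g [gl gq gx]] := @hahn_banach R (realify X) _ rhoD rhoZ [set u | exists t, u = (t *: (x : realify X), t * rho x)].
- split=> [t u v [a ->] [b ->]|u [a ->]] /=.
    by exists (t * a + b); rewrite scalerA -scalerDl mulrA -mulrDl.
  have [a0|a0] := leP 0 a; first by rewrite rhoZ.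
  by apply: le_trans (rho0 _); rewrite nmulr_rle0.
- by exists (0 *: (x : realify X), 0 * rho x), 0.
have [z|f [fE fM]] := @dual_make R (realify X) g M gl (ltW M0).
  apply: le_trans (gq z) _; have := rho_le z 0; rewrite linear0 subr0 rnorm0 add0r; exact.
have fk : `|f| <= k.
  apply/ler_addgt0Pr => c c0; have [y [y1 h]] := H f c c0; apply: le_trans h _; rewrite lerD2r.
  rewrite ler_piMr// fE (le_trans (gq _))// (le_trans (rho_le _ y))//.
  by rewrite subrr rnorm0 mulr0 addr0.
have rx : rho x <= k * rnorm x.
  have := gx (1 *: (x : realify X), 1 * rho x); rewrite /= scale1r mul1r => <-; last by exists 1; rewrite scale1r mul1r.
  rewrite -fE (le_trans (dual_le _ _))// ler_wpM2r//.
have [y hy] := rho_adh x e e0; exists y.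
have yx := rnorm_ge0 y; have ux := mulr_ge0 (ltW M0) (rnorm_ge0 (x - U y)).
split; first by lra.
have : M * rnorm (x - U y) <= k * rnorm x + e by lra.
rewrite /M mulrAC ler_pdivrMr// ler_pM2l//; lra.
Qed.

(** Successive approximation as in the open mapping theorem. With (k + 1) q 0 = e / 4, the first
    step exceeds k |x| by at most e / 4, and the later corrections add at most 4 / 3 of e / 4. *)
Lemma exactly_onto (k c : R) : 0 <= k -> 0 <= c -> rcomplete W -> (forall y, rnorm (U y) <= c * rnorm y) ->
  (forall x (d e : R), 0 < d -> 0 < e -> exists y, rnorm y <= k * rnorm x + e /\ rnorm (x - U y) <= d) ->
  forall x (e : R), 0 < e -> exists y, U y = x /\ rnorm y <= k * rnorm x + e.
Proof.
move=> k0 c0 Wc Uc H x e e0.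
pose q n : R := e / 4 / (k + 1) * 4^-1 ^+ n.
have k1 : 0 < k + 1 by lra.
have q0 n : 0 < q n by rewrite mulr_gt0 ?divr_gt0// exprn_gt0// invr_gt0.
have qS n : q n = 4 * q n.+1 by rewrite /q exprSr; field; rewrite gt_eqF.
have /boolp.choice[g Hg] : forall zn : X * nat, exists y, rnorm y <= k * rnorm zn.1 + q zn.2 /\ rnorm (zn.1 - U y) <= q zn.2.
  by move=> [z n]; exact: H.
pose fix Y n : W := if n is n'.+1 then Y n' + g (x - U (Y n'), n') else 0.
have r n : rnorm (x - U (Y n.+1)) <= q n.
  by rewrite /= raddfD opprD addrA; have [_] := Hg (x - U (Y n), n).
have stp n : rnorm (Y n.+2 - Y n.+1) <= (k + 1) * q n.
  rewrite [Y n.+2]/(Y n.+1 + g (x - U (Y n.+1), n.+1)) addrAC subrr add0r.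
  have [h _] := Hg (x - U (Y n.+1), n.+1); apply: le_trans h _ => /=.
  have := ler_wpM2l k0 (r n); have := qS n; have := q0 n.+1; rewrite /= mulrDl mul1r; lra.
have dist n m : rnorm (Y (n + m).+1 - Y n.+1) <= (k + 1) * (4 / 3 * (q n - q (n + m)%N)).
  elim: m => [|m IH]; first by rewrite addn0 !subrr rnorm0 !mulr0.
  rewrite addnS -(subrKA (Y (n + m).+1)) addrC (le_trans (ler_rnormD _ _))//.
  have := stp (n + m)%N; have -> : q (n + m)%N = 4 * q (n + m).+1 by exact: qS.
  move: IH; have -> : q (n + m)%N = 4 * q (n + m).+1 by exact: qS.
  rewrite (_ : 4 / 3 * (q n - 4 * q (n + m).+1) = 4 / 3 * (q n - q (n + m).+1) - 4 * q (n + m).+1); last by field.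
  by rewrite [(k + 1) * (_ - 4 * _)]mulrBr; lra.
have qlim (d : R) : 0 < d -> exists N, forall n, (N <= n)%N -> q n <= d.
  move=> d0; have : q n @[n --> \oo] --> (0 : R).
    by rewrite -(mulr0 (e / 4 / (k + 1))); apply: cvgMr; apply: cvg_expr; rewrite ger0_norm ?invr_ge0// invf_lt1// ltr1n.
  move=> /cvgn_distP/(_ _ d0)[N HN]; exists N => n Nn.
  by have := HN n Nn; rewrite subr0 => /(le_trans (ler_norm _)).
have dist' n m : (n <= m)%N -> rnorm (Y m.+1 - Y n.+1) <= (k + 1) * (4 / 3) * q n.
  move=> nm; rewrite -(subnKC nm); apply: le_trans (dist _ _) _.
  by rewrite -[leRHS]mulrA ler_pM2l ?ler_pM2l ?divr_gt0 ?gerBl ?ltW.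
have [|y yl] := Wc (fun n => Y n.+1).
  move=> d d0; have k2 : 0 < (k + 1) * (4 / 3) by rewrite mulr_gt0// divr_gt0.
  have [N HN] := qlim _ (divr_gt0 d0 k2).
  have bd n m : (N <= n)%N -> (n <= m)%N -> rnorm (Y m.+1 - Y n.+1) <= d.
    move=> Nn nm; apply: le_trans (dist' _ _ nm) _.
    by rewrite -ler_pdivlMl// mulrC HN.
  exists N => m n Nm Nn; have [nm|mn] := leqP n m; first exact: bd.
  by rewrite -rnormN opprB; apply: bd => //; exact: ltnW.
exists y; split.
  apply/eqP; rewrite -subr_eq0; apply/eqP/rnorm_eq0/eqP; rewrite eq_le rnorm_ge0 andbT.
  apply/ler_addgt0Pr => d d0; rewrite add0r.
  have d2 : 0 < d / 2 by lra.
  have c1 : 0 < c + 1 by lra.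
  have [N HN] := qlim _ d2; have /cvg_rnormP/(_ _ (divr_gt0 d2 c1))[N' HN'] := yl.
  pose n := maxn N N'.
  rewrite -(subrKA (U (Y n.+1))) (le_trans (ler_rnormD _ _))// [d]splitr lerD//.
    rewrite -raddfB -rnormN -raddfN opprB; apply: le_trans (Uc _) _.
    have := HN' n (leq_maxr _ _); rewrite ler_pdivlMr// => /(le_trans _); apply.
    by rewrite mulrC ler_wpM2l ?rnorm_ge0// lerDl.
  by rewrite -rnormN opprB (le_trans (r n))// HN// leq_maxl.
apply/ler_addgt0Pr => d d0; have /cvg_rnormP/(_ _ d0)[N /(_ N (leqnn N)) HN] := yl.
rewrite -(subrK (Y N.+1) y) (le_trans (ler_rnormD _ _))// addrC lerD//; last by rewrite -rnormN opprB.
rewrite -(subrK (Y 1%N) (Y N.+1)) (le_trans (ler_rnormD _ _))//.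
have h1 := dist' 0%N N (leq0n _).
have h2 : rnorm (Y 1%N) <= k * rnorm x + q 0%N.
  by rewrite /= add0r linear0 subr0; have [] := Hg (x, 0%N).
have q0E : (k + 1) * q 0%N = e / 4 by rewrite /q expr0 mulr1 mulrC divfK ?gt_eqF.
have h3 : q 0%N <= e / 4 by rewrite -q0E ler_peMl ?(ltW (q0 _))//; lra.
rewrite mulrAC q0E in h1; lra.
Qed.

Lemma kernel_quotient (k c : R) : 0 <= k -> 0 <= c -> (forall y, rnorm (U y) <= c * rnorm y) ->
  (forall x (e : R), 0 < e -> exists y, U y = x /\ rnorm y <= k * rnorm x + e) ->
  exists Z : closed_subspace W, (banach_mazur X (quotient_type Z) <= (k * c)%:E)%E.
Proof.
move=> k0 c0 Uc H.
pose P : {pred W} := [pred y | `[< U y = 0 >]].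
have Psub : submod_closed P.
  split=> [|a x y /asboolP xP /asboolP yP]; apply/asboolP; first exact: linear0.
  by rewrite linearP xP yP scaler0 addr0.
have Pcl : closed [set y | y \in P].
  apply/closed_rnormP => y yP; apply/asboolP/rnorm_eq0/eqP; rewrite eq_le rnorm_ge0 andbT.
  apply/ler_addgt0Pr => e e0; have c1 : 0 < c + 1 by lra.
  have [z /asboolP zP yz] := yP _ (divr_gt0 e0 c1).
  rewrite add0r -(subr0 (U y)) -zP -raddfB (le_trans (Uc _))//.
  move: yz; rewrite ler_pdivlMr// => /(le_trans _); apply.
  by rewrite mulrC ler_wpM2l ?rnorm_ge0// lerDl.
pose Z := ClosedSubspace Psub Pcl; exists Z.
have pU y z : quotient_map Z y = quotient_map Z z <-> U y = U z.
  rewrite quotient_map_eq; split=> [/asboolP|h].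
    by rewrite raddfB => /eqP; rewrite subr_eq0 => /eqP.
  by apply/asboolP; rewrite raddfB /= h subrr.
have /boolp.choice[S0 HS] : forall q : quotient_type Z, exists x, forall y, quotient_map Z y = q -> U y = x.
  by move=> q; have [y yq] := quotient_map_surj q; exists (U y) => z zq; apply/pU; rewrite zq yq.
have SE y : S0 (quotient_map Z y) = U y by rewrite -(HS _ y).
have /boolp.choice[T0 HT] : forall x, exists q : quotient_type Z, forall y, U y = x -> quotient_map Z y = q.
  move=> x; have [y [yx _]] := H x 1 ltr01; exists (quotient_map Z y) => z zx.
  by apply/pU; rewrite zx yx.
have TE y : T0 (U y) = quotient_map Z y by rewrite -(HT _ y).
have sur x : exists y, U y = x by have [y [yx _]] := H x 1 ltr01; exists y.
have Slin : linear S0.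
  move=> a q1 q2; have [y1 <-] := quotient_map_surj q1; have [y2 <-] := quotient_map_surj q2.
  by rewrite -quotient_mapZ -quotient_mapD !SE linearP.
have Tlin : linear T0.
  move=> a x1 x2; have [y1 <-] := sur x1; have [y2 <-] := sur x2.
  by rewrite -linearP !TE quotient_mapD quotient_mapZ.
pose S : {linear quotient_type Z -> X} := HB.pack S0 (GRing.isLinear.Build _ _ _ _ _ Slin).
pose T : {linear X -> quotient_type Z} := HB.pack T0 (GRing.isLinear.Build _ _ _ _ _ Tlin).
have Sc q : rnorm (S q) <= c * rnorm q.
  apply/ler_addgt0Pr => e e0; have c1 : 0 < c + 1 by lra.
  have hi : has_inf [set rnorm z | z in [set z | quotient_map Z z = q]].
    split; first by have [z zT] := quotient_map_surj q; exists (rnorm z), z.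
    by exists 0 => _ [z _ <-]; exact: rnorm_ge0.
  have [_ [z zq <-]] := inf_adherent (divr_gt0 e0 c1) hi; rewrite -[inf _]rnorm_quotient => h.
  rewrite /S /= -zq SE (le_trans (Uc _))//.
  have h1 := ler_wpM2l c0 (ltW h); rewrite zq; apply: (le_trans h1); rewrite mulrDr lerD2l.
  by rewrite mulrCA ger_pMr// ler_pdivrMr// mul1r lerDl.
have Tc x : rnorm (T x) <= k * rnorm x.
  apply/ler_addgt0Pr => e e0; have [y [yx h]] := H x e e0; apply: le_trans h.
  rewrite /T /= -yx TE rnorm_quotient; apply: ge_inf; last by exists y.
  by exists 0 => _ [z _ <-]; exact: rnorm_ge0.
apply: ereal_inf_le => //=; exists (opnorm T * opnorm S)%:E.
  exists T, S; split => //; split.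
  - by apply/continuous_linearP; exists k.
  - by apply/continuous_linearP; exists c.
  - by move=> x; have [y <-] := sur x; rewrite /T /S /= TE SE.
  - by move=> q; have [y <-] := quotient_map_surj q; rewrite /T /S /= SE TE.
rewrite lee_fin; apply: ler_pM; [| |exact: opnorm_le|exact: opnorm_le].
  by apply: (opnorm_ub _).1; apply/continuous_linearP; exists k.
by apply: (opnorm_ub _).1; apply/continuous_linearP; exists c.
Qed.

End quotient_of_map.

(** * Finite-dimensional spaces and their covers by the spaces E n *)

Section finite_dimension.
Context {R : realType} {s : scalars}.
Local Notation K := (scalar_field R s).

Lemma finite_dimensional_complete (V : normedModType K) : finite_dimensional V -> rcomplete V.
Proof.
move=> /fd_real_span[v [D Hv]] u uc.
have [N0 H0] := uc _ ltr01.
have [||phi hphi [l _ ul]] := @span_subseq R (realify V) v D (fun k => u (N0 + k)%N) (rnorm (u N0) + 1).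
- by move=> k; exact: Hv.
- move=> k; rewrite realify_norm -(subrK (u N0) (u (N0 + k)%N)) (le_trans (ler_rnormD _ _))// addrC lerD2l.
  by apply: H0; rewrite ?leq_addr.
exists (l : V); apply/cvg_rnormP => e e0; have e2 : 0 < e / 2 by lra.
have [N HN] := uc _ e2.
have /cvgrPdist_le/(_ _ e2)[N' _ HN'] := ul.
exists N => n Nn; pose k := maxn N N'.
rewrite -(subrKA (u (N0 + phi k)%N)) (le_trans (ler_rnormD _ _))// [e]splitr lerD//.
  apply: HN => //; apply: leq_trans (leq_addl _ _); apply: leq_trans (homo_leq_id hphi _).
  exact: leq_maxl.
by have := HN' k (leq_maxr _ _); rewrite distrC.
Qed.

(** Density of E is stated for spaces that carry a completeness structure; this moves a space known
    to be complete into that class, isometrically. *)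
Lemma complete_model (V : normedModType K) : rcomplete V ->
  exists (G : completeNormedModType K) (T : {linear G -> V}) (S : {linear V -> G}),
    [/\ cancel T S, cancel S T & forall x, rnorm (S x) = rnorm x].
Proof.
move=> Vc.
have c (F : set_system V) : ProperFilter F -> cauchy F -> cvg F.
  move=> PF /cauchyP cF.
  have /boolp.choice[x Hx] : forall n : nat, exists x : V, F (ball x (of_real n.+1%:R^-1 : K)).
    by move=> n; apply: cF; rewrite -(@of_real0 R s) ltr_of_real invr_gt0.
  have xn (a b : nat) : exists2 z, rnorm (z - x a) <= a.+1%:R^-1 & rnorm (z - x b) <= b.+1%:R^-1.
    have [z [za zb]] := filter_ex (filterI (Hx a) (Hx b)); exists z.
      by move: za; rewrite -ball_normE /= => h; rewrite -(@ler_of_real R s) rnormE distrC ltW.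
    by move: zb; rewrite -ball_normE /= => h; rewrite -(@ler_of_real R s) rnormE distrC ltW.
  have small (e : R) : 0 < e -> exists N : nat, forall n, (N <= n)%N -> n.+1%:R^-1 <= e.
    move=> e0; have /cvgn_distP/(_ _ e0)[N HN] := @cvg_harmonic R; exists N => n Nn.
    by have := HN n Nn; rewrite subr0 => /(le_trans (ler_norm _)).
  have [|l xl] := Vc x.
    move=> e e0; have e2 : 0 < e / 2 by lra.
    have [N HN] := small _ e2; exists N => a b Na Nb; have [z za zb] := xn a b.
    rewrite -(subrKA z) (le_trans (ler_rnormD _ _))// -(rnormN (x a - z)) opprB [e]splitr.
    by apply: lerD; [exact: le_trans za (HN _ Na)|exact: le_trans zb (HN _ Nb)].
  apply/cvg_ex; exists l; apply/cvgrPdist_le => e e0.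
  have e0' : 0 < re_part e by rewrite -(@ltr_of_real _ s) of_real0 re_partK// ltW.
  have e2 : 0 < re_part e / 2 by lra.
  have [N HN] := small _ e2; have /cvg_rnormP/(_ _ e2)[N' HN'] := xl.
  pose k := maxn N N'.
  apply: filterS (Hx k) => z; rewrite -ball_normE /= => h.
  have {}h : rnorm (x k - z) <= k.+1%:R^-1 by rewrite -(@ler_of_real R s) rnormE ltW.
  rewrite -rnormE -(re_partK (ltW e0)) ler_of_real -(subrKA (x k)) (le_trans (ler_rnormD _ _))//.
  rewrite [re_part e]splitr lerD//; last by apply: le_trans h (HN _ (leq_maxl _ _)).
  by rewrite -rnormN opprB; apply: HN'; exact: leq_maxr.
pose G := HB.pack_for (completeNormedModType K) V (Uniform_isComplete.Build V c).
have lin : linear (fun x : V => (x : G)) by [].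
have lin' : linear (fun x : G => (x : V)) by [].
pose S : {linear V -> G} := HB.pack (fun x : V => (x : G)) (GRing.isLinear.Build _ _ _ _ _ lin).
pose T : {linear G -> V} := HB.pack (fun x : G => (x : V)) (GRing.isLinear.Build _ _ _ _ _ lin').
by exists G, T, S; split.
Qed.

Lemma finite_dimensional_dependent (V : lmodType K) n m (v : 'I_n -> V) (w : 'I_m -> V) :
  (forall x, exists c : 'I_n -> K, x = \sum_i c i *: v i) -> (n < m)%N ->
  exists c : 'rV[K]_m, c != 0 /\ \sum_j c 0 j *: w j = 0.
Proof.
move=> Hv nm; have /boolp.choice[M HM] : forall j, exists c : 'I_n -> K, w j = \sum_i c i *: v i.
  by move=> j; exact: Hv.
pose A : 'M[K]_(m, n) := \matrix_(j, i) M j i.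
have : kermx A != 0.
  by rewrite -mxrank_eq0 mxrank_ker -lt0n subn_gt0; exact: leq_ltn_trans (rank_leq_col A) nm.
move=> /rowV0Pn[c /sub_kermxP cA c0]; exists c; split => //.
under eq_bigr do rewrite HM scaler_sumr.
rewrite exchange_big big1 //= => i _.
have := congr1 (fun B : 'rV_n => B 0 i) cA; rewrite !mxE => h.
under eq_bigr do rewrite scalerA.
rewrite -scaler_suml (_ : \sum_j _ = 0) ?scale0r// -[RHS]h.
by apply: eq_bigr => j _; rewrite mxE.
Qed.

End finite_dimension.

Section covers.
Context {R : realType} {s : scalars}.
Local Notation K := (scalar_field R s).
Variable E : nat -> completeNormedModType K.
Hypothesis Efin : forall n, finite_dimensional (E n).
Hypothesis Edense : banach_mazur_dense E.

(* Applying density to [F * K^(D+1)], whose dimension exceeds that of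
   [E 0, ..., E N.-1], makes the index [n] at least [N]. *)
Lemma finite_dimensional_cover (F : normedModType K) (e : R) (N : nat) :
  finite_dimensional F -> 0 < e -> exists2 n, (N <= n)%N & exists tau : {linear E n -> F},
    (forall y, rnorm (tau y) <= rnorm y) /\
    forall b, exists y, tau y = b /\ rnorm y <= (1 + e) * rnorm b.
Proof.
move=> Ffin e0.
have /boolp.choice[D HD] : forall n, exists D : nat, exists v : 'I_D -> E n,
    forall x, exists c : 'I_D -> K, x = \sum_i c i *: v i.
  by move=> n; exact: Efin.
pose d := (\max_(n < N) D n).+1.
pose W : normedModType K := (F * 'rV[K]_d)%type.
have Wfin : finite_dimensional W.
  have [n [v Hv]] := Ffin.
  exists (n + d)%N, (fun i => match fintype.split i with inl i => (v i, 0) | inr j => (0, delta_mx 0 j) end) => -[b r].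
  have [c bc] := Hv b.
  exists (fun i => match fintype.split i with inl i => c i | inr j => r 0 j end).
  rewrite big_split_ord /=.
  under eq_bigr do rewrite (unsplitK (inl _)).
  under [X in _ = _ + X]eq_bigr do rewrite (unsplitK (inr _)).
  apply: injective_projections.
    rewrite -[RHS]/(_.1 + _.1) !(big_morph fst (fun _ _ => erefl) erefl) /= -bc.
    by rewrite [X in _ + X]big1 ?addr0// => j _; exact: scaler0.
  rewrite -[RHS]/(_.2 + _.2) !(big_morph snd (fun _ _ => erefl) erefl) /=.
  rewrite [X in X + _]big1 ?add0r; last by move=> j _; exact: scaler0.
  exact: row_sum_delta.
have [G [T [S [TS ST Sn]]]] := complete_model (finite_dimensional_complete Wfin).
have Gfin : finite_dimensional G.
  have [n [v Hv]] := Wfin; exists n, (S \o v) => x; have [c xc] := Hv (T x).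
  exists c; rewrite -[LHS]TS xc linear_sum; apply: eq_bigr => i _; exact: linearZ.
have [n /ereal_inf_lt[_ [A [B [[Ac Bc AB BA] ->]]]]] := Edense Gfin e0.
rewrite lte_fin => ab.
exists n.
  (* For n < N the space E n is spanned by D n < d vectors, so the images in it of the d unit
     vectors are dependent, although S and B are injective. *)
  rewrite leqNgt; apply/negP => nN.
  have [v Hv] := HD n.
  have [|c [c0 Hc]] := @finite_dimensional_dependent R s (E n) _ d v
      (fun j => B (S ((0, delta_mx 0 j) : W))) Hv.
    by rewrite ltnS (@leq_bigmax _ (fun i : 'I_N => D i) (Ordinal nN)).
  move/eqP: c0; apply.
  have : T (A (\sum_j c 0 j *: B (S ((0, delta_mx 0 j) : W)))) = 0 by rewrite Hc !linear0.
  rewrite !linear_sum => /(congr1 snd); rewrite (big_morph snd (fun _ _ => erefl) erefl) => h.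
  rewrite [c]row_sum_delta -[RHS]h; apply: eq_bigr => j _.
  by rewrite !linearZ /= BA ST.
have [a0 Aa] := opnorm_ub Ac; have [b0 Bb] := opnorm_ub Bc.
rewrite mulrC in ab; have [c bc ac] := mul_lt_slack b0 ab.
have c0 : 0 < c by exact: le_lt_trans bc.
have ci : rnorm (of_real c^-1 : K^o) = c^-1 by rewrite rnorm_of_real gtr0_norm ?invr_gt0.
have cc : rnorm (of_real c : K^o) = c by rewrite rnorm_of_real gtr0_norm.
pose t y : F := of_real c^-1 *: (T (A y)).1.
have tlin : linear t.
  by move=> r y z; rewrite /t linearP linearP -[(_ + _).1]/(r *: (T (A y)).1 + (T (A z)).1) scalerDr !scalerA mulrC.
pose tau : {linear E n -> F} := HB.pack t (GRing.isLinear.Build _ _ _ _ _ tlin).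
have nfst (w : W) : rnorm w.1 <= rnorm w.
  by rewrite -(@ler_of_real R s) !rnormE prod_normE maxEle; case: ifP.
have nin (b : F) : rnorm ((b, 0) : W) = rnorm b.
  by rewrite /rnorm prod_normE /= normr0 maxElt normr_lt0.
have Tn x : rnorm (T x) = rnorm x by rewrite -Sn TS.
exists tau; split=> [y|b].
  rewrite /tau /= /t rnormZE ci mulrC ler_pdivrMr// (le_trans (nfst _))// Tn (le_trans (Aa _))// mulrC.
  by apply: ler_wpM2l; [exact: rnorm_ge0|exact: ltW].
exists (of_real c *: B (S ((b, 0) : W))); split.
  by rewrite linearZ /= /t BA ST /= scalerA -of_realM mulfV ?gt_eqF// of_real1 scale1r.
rewrite rnormZE cc; apply: (@le_trans _ _ (c * (opnorm B * rnorm b))).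
  by rewrite ler_pM2l// -(nin b) -(Sn (b, 0)).
by rewrite mulrA ler_wpM2r ?rnorm_ge0// mulrC.
Qed.

End covers.

Section subsequences.
Variables (nn : nat -> nat).
Hypothesis nn_mono : {homo nn : i j / (i < j)%N}.

Let gap i n : (nn i < n < nn i.+1)%N -> forall j, nn j <> n.
Proof.
move=> /andP[h1 h2] j jn; have [ij|ji] := ltnP i j.
  have : (nn i.+1 <= nn j)%N.
    by move: ij; rewrite leq_eqVlt => /predU1P[->//|/nn_mono/ltnW].
  by rewrite jn leqNgt h2.
have : (nn j <= nn i)%N by move: ji; rewrite leq_eqVlt => /predU1P[->//|/nn_mono/ltnW].
by rewrite jn leqNgt h1.
Qed.

Let gap0 n : (n < nn 0)%N -> forall j, nn j <> n.
Proof. by move=> n0 [|j] jn; [|have := nn_mono (ltn0Sn j)]; rewrite jn in n0 *; lia. Qed.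

Lemma sum_subseq (V : nmodType) (G : nat -> V) L : (forall n, (forall i, nn i <> n) -> G n = 0) ->
  \sum_(n < nn L) G n = \sum_(i < L) G (nn i).
Proof.
move=> G0.
have widen a b : (a <= b)%N -> (forall n, (a <= n < b)%N -> G n = 0) -> \sum_(n < b) G n = \sum_(n < a) G n.
  move=> ab H; rewrite -(subnKC ab) big_split_ord /= [X in _ + X]big1 ?addr0// => i _.
  by apply: H; rewrite leq_addr /= -ltn_subRL.
elim: L => [|L IH]; first by rewrite big_ord0 big1// => n _; apply: G0; apply: gap0.
rewrite big_ord_recr -IH; transitivity (\sum_(n < (nn L).+1) G n); last by rewrite big_ord_recr.
apply: widen => [|n h]; first exact: nn_mono.
by apply: G0; exact: gap h.
Qed.

Context {R : realType} (p : \bar R) (p1 : (1 <= p)%E).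

Lemma lps_subseq (a : nat -> R) L : (forall n, (forall i, nn i <> n) -> a n = 0) ->
  lps p (nn L) a = lps p L (a \o nn).
Proof.
move=> a0; elim: L => [|L IH].
  by rewrite (lps_widen p1 (leq0n _))// => n /andP[_ h]; apply: a0; exact: gap0.
rewrite /= -IH (lps_widen p1 (nn_mono (ltnSn L)))// => n h.
by apply: a0; exact: gap h.
Qed.

Lemma lps_subseq_le (a : nat -> R) L : lps p L (a \o nn) <= lps p (nn L) a.
Proof.
elim: L => [|L IH]; first exact: lps_ge0.
apply: (@le_trans _ _ (lps p (nn L).+1 a)); last exact: lps_mono (nn_mono (ltnSn L)).
rewrite /= -[leLHS](lp_abs p1) -[leRHS](lp_abs p1).
by apply: lp_le; rewrite ?normr_ge0 ?lexx// !ger0_norm ?lps_ge0.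
Qed.

End subsequences.

Section blocks_operator.
Context {R : realType} {s : scalars}.
Local Notation K := (scalar_field R s).
Variable E : nat -> completeNormedModType K.
Hypothesis Efin : forall n, finite_dimensional (E n).
Hypothesis Edense : banach_mazur_dense E.
Variables (p : \bar R) (p1 : (1 <= p)%E).
Variables (X : normedModType K) (F : nat -> normedModType K) (J : forall i, {linear F i -> X}).
Hypothesis Xc : rcomplete X.
Hypothesis Ffin : forall i, finite_dimensional (F i).
Variables (w C e : R).
Hypotheses (w0 : 0 < w) (C0 : 0 <= C) (e0 : 0 < e).
Hypothesis JC : forall L (g : forall i, F i),
  w * rnorm (\sum_(i < L) J i (g i)) <= C * lps p L (fun i => rnorm (g i)).

(** Block i is covered by E (nn i) with nn strictly increasing, and coordinates outside the range of
    nn are sent to 0. As the order of the blocks is kept, [lps] along nn compares directly with the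
    norm of the sum. *)
Lemma blocks_operator : exists U : {linear lp_sum E p1 -> X},
  (forall y, rnorm (U y) <= C * rnorm y) /\
  forall L (g : forall i, F i), exists y, U y = of_real w *: (\sum_(i < L) J i (g i)) /\
    rnorm y <= (1 + e) * lps p L (fun i => rnorm (g i)).
Proof.
have e1 : 0 <= 1 + e by have := e0; lra.
have [k N|nn nn_mono Hnn] := @extraction (fun k n => exists tau : {linear E n -> F k},
    (forall y, rnorm (tau y) <= rnorm y) /\
    forall b, exists y, tau y = b /\ rnorm y <= (1 + e) * rnorm b).
  exact: (finite_dimensional_cover Efin Edense N (Ffin k) e0).
have nn_inj i j : nn i = nn j -> i = j.
  by move=> ij; have [/(nn_mono _ _)|/(nn_mono _ _)|//] := ltngtP i j; rewrite ij ltnn.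
pose tau i := projT1 (cid (Hnn i)).
have tau_le i y : rnorm (tau i y) <= rnorm y by rewrite /tau; case: cid => t []/=.
have tau_lift i b : exists y, tau i y = b /\ rnorm y <= (1 + e) * rnorm b.
  by rewrite /tau; case: cid => t []/=.
have HA n : exists A : {linear E n -> X},
    (forall (f : dprod E) i, nn i = n -> A (f n) = of_real w *: J i (tau i (f (nn i)))) /\
    ((forall i, nn i <> n) -> forall y, A y = 0).
  have [[i <-]|H] := pselect (exists i, nn i = n).
    have lin : linear (fun y => (of_real w : K) *: J i (tau i y)).
      by move=> a x y; rewrite !linearP !scalerA mulrC.
    pose B : {linear E (nn i) -> X} := HB.pack (fun y => (of_real w : K) *: J i (tau i y))
      (GRing.isLinear.Build _ _ _ _ _ lin).
    exists B.
    split => [f j ji|/(_ i)//]; by rewrite (nn_inj _ _ ji).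
  have lin : linear (fun _ : E n => 0 : X) by move=> a x y; rewrite scaler0 addr0.
  pose B : {linear E n -> X} := HB.pack (fun _ : E n => 0 : X) (GRing.isLinear.Build _ _ _ _ _ lin).
  exists B.
  by split => // f i ni; case: H; exists i.
pose A n := projT1 (cid (HA n)).
have AE (f : dprod E) i : A (nn i) (f (nn i)) = of_real w *: J i (tau i (f (nn i))).
  by rewrite /A; case: cid => B [/= H _]; exact: (H f i erefl).
have A0 n : (forall i, nn i <> n) -> forall y, A n y = 0 by rewrite /A; case: cid => B [].
have wn : rnorm (of_real w : K^o) = w by rewrite rnorm_of_real gtr0_norm.
have AC L (f : dprod E) : rnorm (\sum_(i < L) A i (f i)) <= C * lps p L (coords f).
  pose f' : dprod E := fun n => if (n < L)%N then f n else 0.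
  have Ln : (L <= nn L)%N by exact: homo_leq_id.
  have -> : \sum_(i < L) A i (f i) = \sum_(i < nn L) A i (f' i).
    rewrite -(subnKC Ln) big_split_ord /= [X in _ + X]big1 ?addr0; last first.
      by move=> i _; rewrite /f' ltnNge leq_addr /= linear0.
    by apply: eq_bigr => i _; rewrite /f' ltn_ord.
  rewrite (@sum_subseq nn nn_mono _ (fun i => A i (f' i))); last by move=> n H; exact: A0.
  under eq_bigr do rewrite AE.
  rewrite -scaler_sumr rnormZE wn (le_trans (JC L (fun i => tau i (f' (nn i)))))// ler_wpM2l//.
  have -> : lps p L (coords f) = lps p (nn L) (coords f').
    rewrite (lps_widen p1 Ln) => [|i /andP[Li _]]; last by rewrite /coords /f' ltnNge Li rnorm0.
    by apply: eq_lps => i iL; rewrite /coords /f' iL.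
  apply: le_trans (lps_subseq_le nn_mono p1 (coords f') L); apply: lps_le => // i _.
  by rewrite rnorm_ge0 /=; exact: tau_le.
have [U [Uc Uf]] := sum_operator p1 Xc C0 AC.
exists U; split => // L g.
pose g' i := if (i < L)%N then g i else 0.
have Hf n : exists x : E n, (forall i, nn i = n -> A n x = of_real w *: J i (g' i) /\
    rnorm x <= (1 + e) * rnorm (g' i)) /\ ((forall i, nn i <> n) -> x = 0).
  have [[i <-]|H] := pselect (exists i, nn i = n).
    have [x [xg xn]] := tau_lift i (g' i); exists x; split=> [j /nn_inj ->|/(_ i)//]; split => //.
    pose f := eqtype.dfwith (fun n => 0 : E n) x.
    by have := AE f i; rewrite /f eqtype.dfwith_in xg.
  by exists 0; split => // i ni; case: H; exists i.
pose f : dprod E := fun n => projT1 (cid (Hf n)).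
have fE i : A (nn i) (f (nn i)) = of_real w *: J i (g' i).
  by rewrite /f; case: cid => x [/= h _]; have [] := h i erefl.
have fn i : rnorm (f (nn i)) <= (1 + e) * rnorm (g' i).
  by rewrite /f; case: cid => x [/= h _]; have [] := h i erefl.
have f0 n : (forall i, nn i <> n) -> f n = 0 by rewrite /f; case: cid => x [].
have fL n : (nn L <= n)%N -> f n = 0.
  move=> Ln; have [[i ni]|H] := pselect (exists i, nn i = n); last by apply: f0 => i ni; apply: H; exists i.
  have Li : (L <= i)%N.
    by rewrite leqNgt; apply/negP => /nn_mono; rewrite ni ltnNge Ln.
  apply: rnorm_eq0; apply/eqP; rewrite eq_le rnorm_ge0 andbT -ni (le_trans (fn i))//.
  by rewrite /g' ltnNge Li rnorm0 mulr0.
have [y [yf yn]] := lp_sum_finite p1 fL.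
exists y; split.
  rewrite (Uf y (nn L)) => [|n]; last by rewrite yf; exact: fL.
  rewrite yf (@sum_subseq nn nn_mono _ (fun i => A i (f i))); last by move=> n H; exact: A0.
  by rewrite scaler_sumr; apply: eq_bigr => i _; rewrite fE /g' ltn_ord.
apply: (le_trans yn); rewrite lps_subseq//; last by move=> n H; rewrite /coords f0// rnorm0.
rewrite -lpsZ//; apply: lps_le => // i iL; rewrite rnorm_ge0 /= (le_trans (fn i))//.
by rewrite /g' iL.
Qed.

End blocks_operator.

(** Induction on n: if some x0 in P really uses the last generator, subtracting a multiple of it
    clears this generator from any other element of P. *)
Lemma finite_dimensional_sub {R : realType} {s : scalars} (V : lmodType (scalar_field R s))
    (P : set V) n (v : nat -> V) :
  P 0 -> (forall a x y, P x -> P y -> P (a *: x + y)) ->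
  (forall x, P x -> exists c, x = \sum_(i < n) c (i : nat) *: v i) ->
  exists k (w : nat -> V), (forall i, P (w i)) /\
    forall x, P x -> exists c, x = \sum_(i < k) c (i : nat) *: w i.
Proof.
elim: n P => [|n IH] P P0 Plin Pv.
  exists 0%N, (fun=> 0); split => // x /Pv[c ->].
  by exists c; rewrite !big_ord0.
have [[x0 [Px0 nx0]]|H] := pselect (exists x0, P x0 /\ ~ exists c, x0 = \sum_(i < n) c (i : nat) *: v i); last first.
  by apply: IH => // x Px; apply: contrapT => nx; apply: H; exists x.
have [c0 x0E] := Pv _ Px0; rewrite big_ord_recr /= in x0E.
have cn0 : c0 n != 0.
  by apply/eqP => h; apply: nx0; exists c0; rewrite {1}x0E h scale0r addr0.
have [|||k [w [Pw Hw]]] := IH (fun x => P x /\ exists c, x = \sum_(i < n) c (i : nat) *: v i).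
- split => //; exists (fun=> 0); by rewrite big1// => i _; rewrite scale0r.
- move=> a x y [Px [c xc]] [Py [d yd]]; split; first exact: Plin.
  exists (fun i => a * c i + d i); rewrite xc yd scaler_sumr -big_split; apply: eq_bigr => i _ /=.
  by rewrite scalerDl scalerA.
- by move=> x [].
exists k.+1, (fun i => if (i < k)%N then w i else x0); split.
  by move=> i; case: ifP => // _; have [] := Pw i.
move=> x Px; have [c xE] := Pv _ Px; rewrite big_ord_recr /= in xE.
pose t := - (c n / c0 n).
have [|d Hd] := Hw (t *: x0 + x).
  split; first exact: Plin.
  exists (fun i => t * c0 i + c i); rewrite {1}x0E {1}xE scalerDr addrACA scalerA -[X in _ + X]scalerDl.
  rewrite {2}/t mulNr divfK// addNr scale0r addr0 scaler_sumr -big_split; apply: eq_bigr => i _ /=.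
  by rewrite scalerDl scalerA.
exists (fun i => if (i < k)%N then d i else - t); rewrite big_ord_recr /= ltnn.
under eq_bigr do rewrite ltn_ord.
by rewrite -Hd addrAC -scalerDl subrr scale0r add0r.
Qed.

(** The right side is the chord over [0, 1] of the convex function (1 + t)^n. *)
Lemma expr1D_le {R : realType} (t : R) n : 0 <= t <= 1 -> (1 + t) ^+ n <= 1 + (2 ^+ n - 1) * t.
Proof.
move=> /andP[t0 t1]; elim: n => [|n IH]; first by rewrite !expr0 subrr mul0r addr0.
have p0 : 1 <= (2 : R) ^+ n by rewrite exprn_ege1// ler1n.
rewrite exprSr [2 ^+ n.+1]exprSr.
have h : 0 <= 1 + t by lra.
apply: le_trans (ler_wpM2r h IH) _; move: (2 ^+ n) p0 => q q1.
have h1 := mulr_ge0 (mulr_ge0 (_ : 0 <= q - 1) t0) (_ : 0 <= 1 - t); rewrite !subr_ge0 in h1.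
have := h1 q1 t1; lra.
Qed.

Lemma expr1D_small {R : realType} n (e : R) : 0 < e ->
  exists t : R, [/\ 0 < t, t <= 1 & (1 + t) ^+ n < 1 + e].
Proof.
move=> e0; have p0 : 0 < (2 : R) ^+ n by rewrite exprn_gt0.
have m0 : 0 < 2 ^+ n + e by rewrite addr_gt0.
have t0 : 0 < e / (2 ^+ n + e) by rewrite divr_gt0.
have t1 : e / (2 ^+ n + e) <= 1 by rewrite ler_pdivrMr// mul1r lerDr ltW.
exists (e / (2 ^+ n + e)); split => //.
apply: le_lt_trans (expr1D_le n _) _; first by rewrite (ltW t0).
rewrite ltrD2l mulrA ltr_pdivrMr// mulrC ltr_pM2l//; lra.
Qed.

(** * Blocks as subspaces over the scalar field *)

Section invariant_blocks.
Context {R : realType} {s : scalars}.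
Local Notation K := (scalar_field R s).
Variable X : normedModType K.
Local Notation Xr := (realify X).
Local Notation jayX := (fun x : Xr => (jay *: (x : X) : Xr)).

Let j2 : exists c : R, forall x : X, (jay *: (jay *: x) : X) = of_real c *: x.
Proof.
rewrite /jay /of_real; move: X; case: s => Y; [exists 1|exists (-1)] => x; rewrite scalerA.
  by rewrite mul1r.
congr (_ *: _); rewrite -[LHS]expr2 sqr_i.
by rewrite (rmorphN (real_complex R)) rmorph1.
Qed.

Variables (v0 : nat -> X) (d0 : nat -> dual Xr).

(** Each vector is followed by its multiple by [jay], so that initial segments of even length span
    subspaces stable under [jay]. *)
Definition jay_closed_seq (k : nat) : Xr := if odd k then jay *: v0 k./2 else v0 k./2.

Lemma jay_span n x : span jay_closed_seq n.*2 x -> span jay_closed_seq n.*2 (jayX x).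
Proof.
have [c jc] := j2.
move=> [t ->].
have -> : jayX (\sum_(i < n.*2) t i *: jay_closed_seq i) = \sum_(i < n.*2) t i *: jayX (jay_closed_seq i).
  rewrite /= [LHS](scaler_sumr (jay : K)); apply: eq_bigr => i _.
  by rewrite !realifyZ !scalerA mulrC.
apply: span_sum => i _; apply: spanZ.
have iE := odd_double_half i; rewrite /jay_closed_seq; case: ifPn iE (ltn_ord i) => oi; rewrite /= -?(negbTE oi).
  move=> {1}<- in_; rewrite [X in span _ _ X](_ : _ = c *: jay_closed_seq (i./2).*2).
    apply: spanZ; apply: span_gen; exact: ltn_trans (ltnSn _) in_.
  by rewrite /jay_closed_seq odd_double doubleK jc.
rewrite add0n => {1}<-; rewrite ltn_double => h.
rewrite [X in span _ _ X](_ : _ = jay_closed_seq (i./2).*2.+1).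
  by apply: span_gen; rewrite ltn_Sdouble.
by rewrite /jay_closed_seq /= odd_double /= uphalf_double.
Qed.

(** The functionals are doubled accordingly, by composing with multiplication by [jay]: common
    kernels of even length become stable as well. *)
Lemma jay_dual_seq : exists d : nat -> dual Xr,
  (forall k, d k.*2 = d0 k) /\ forall k x, d k.*2.+1 x = d0 k (jayX x).
Proof.
have /boolp.choice[e He] : forall k, exists f : dual Xr, forall x, f x = d0 k (jayX x).
  move=> k; have [t x y|||f [fE _]] := @dual_make R Xr (fun x => d0 k (jayX x)) `|d0 k|.
  - rewrite -dapp_linear; congr dapp.
    by rewrite scalerDr !realifyZ !scalerA mulrC.
  - by [].
  - move=> x; apply: le_trans (dual_le _ _) _; rewrite !realify_norm rnormZE rnorm_jay mul1r//.
  by exists f.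
exists (fun k => if odd k then e k./2 else d0 k./2); split => [k|k x].
  by rewrite odd_double doubleK.
by rewrite /= odd_double /= uphalf_double He.
Qed.

Variable d : nat -> dual Xr.
Hypothesis d_even : forall k, d k.*2 = d0 k.
Hypothesis d_odd : forall k x, d k.*2.+1 x = d0 k (jayX x).

Lemma jay_common_ker m x : common_ker d m.*2 x -> common_ker d m.*2 (jayX x).
Proof.
have [c jc] := j2.
move=> dx i im; have iE := odd_double_half i; move: iE im; case: (odd i).
  rewrite add1n => <- im; rewrite d_odd [jayX _]jc.
  by rewrite -realifyZ dappZ -d_even dx ?mulr0//; exact: ltn_trans (ltnSn _) im.
by rewrite add0n => <-; rewrite ltn_double => im; rewrite d_even -d_odd dx// ltn_Sdouble.
Qed.

Lemma block_subspace n m : exists Z : closed_subspace X,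
  (forall x, x \in cs_pred Z <-> span jay_closed_seq n.*2 x /\ common_ker d m.*2 x) /\
  finite_dimensional (subspace_type Z).
Proof.
pose B := [set x : Xr | span jay_closed_seq n.*2 x /\ common_ker d m.*2 x].
have B0 : B 0 by split; [exact: span0|exact: common_ker0].
have Blin t x y : B x -> B y -> B (t *: x + y).
  by move=> [x1 x2] [y1 y2]; split; [exact: span_lin|exact: common_ker_lin].
have BlinK (a : K) (x y : X) : B x -> B y -> B (a *: x + y).
  move=> Bx By; rewrite (scalar_parts a) scalerDl -addrA -scalerA.
  apply: (Blin (re_part a) x) => //; apply: (Blin (im_part a) (jayX x)) => //.
  by case: Bx => x1 x2; split; [exact: jay_span|exact: jay_common_ker].
pose P : {pred X} := [pred x | `[< B x >]].
have Psub : submod_closed P.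
  by split=> [|a x y /asboolP Bx /asboolP By]; apply/asboolP => //; exact: BlinK.
have Pcl : closed [set x | x \in P].
  apply/closed_rnormP => x xP.
  have /boolp.choice[b Hb] : forall k : nat, exists b : X, B b /\ rnorm (x - b) <= k.+1%:R^-1 :> R.
    move=> k; have k0 : 0 < k.+1%:R^-1 :> R by rewrite invr_gt0.
    by have [b /asboolP Bb h] := xP _ k0; exists b.
  have small (e : R) : 0 < e -> exists N : nat, forall n, (N <= n)%N -> rnorm (x - b n) <= e.
    move=> e0; have /cvgn_distP/(_ _ e0)[N HN] := @cvg_harmonic R; exists N => k Nk.
    by apply: (le_trans (Hb k).2); have := HN k Nk; rewrite subr0 => /(le_trans (ler_norm _)).
  apply/asboolP; split; last first.
    move=> i im; apply/eqP; rewrite -normr_le0; apply/ler_addgt0Pr => e e0; rewrite add0r.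
    have d1 : 0 < `|d i| + 1 by rewrite ltr_wpDl.
    have [N HN] := small _ (divr_gt0 e0 d1); have := HN N (leqnn N).
    rewrite ler_pdivlMr// => /(le_trans _); apply.
    have [_ k0] := (Hb N).1; rewrite -[X in `|X|](subr0) -{1}(k0 _ im) -dappB.
    by apply: (le_trans (dual_ub _ _)); rewrite mulrC ler_wpM2l// lerDl.
  have [||phi hphi [l sl bl]] := @span_subseq R Xr jay_closed_seq n.*2 b (rnorm x + 1).
  - by move=> k; have [[]] := Hb k.
  - move=> k; rewrite realify_norm -(subrKC x (b k)) (le_trans (ler_rnormD _ _))// lerD2l.
    rewrite -rnormN opprB (le_trans (Hb k).2)// invf_le1// ler1n//.
  suff -> : x = l by [].
  apply/eqP; rewrite -subr_eq0; apply/eqP/rnorm_eq0/eqP; rewrite eq_le rnorm_ge0 andbT.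
  apply/ler_addgt0Pr => e e0; rewrite add0r; have e2 : 0 < e / 2 by lra.
  have [N HN] := small _ e2; have /cvgrPdist_le/(_ _ e2)[N' _ HN'] := bl.
  pose k := maxn N N'.
  rewrite -(subrKA (b (phi k))) (le_trans (ler_rnormD _ _))// [e]splitr lerD//.
    by apply: HN; apply: leq_trans (leq_maxl _ _) (homo_leq_id hphi _).
  by have := HN' k (leq_maxr _ _); rewrite distrC.
pose Z := ClosedSubspace Psub Pcl; exists Z.
have ZB x : x \in cs_pred Z <-> B x by split=> [/asboolP|h]; [|apply/asboolP].
split=> //.
have [|k [w [Bw Hw]]] := @finite_dimensional_sub R s X B n.*2 jay_closed_seq B0 BlinK.
  by move=> x [[c ->] _]; exists (fun i => of_real (c i)).
pose wZ i : subspace_type Z := exist _ (w i) ((ZB _).2 (Bw i)).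
exists k, (fun i => wZ i) => -[x xZ]; have [c xc] := Hw x ((ZB x).1 xZ).
exists (fun i => c i); apply: val_inj; rewrite [RHS]raddf_sum -[LHS]/x xc.
exact: eq_bigr.
Qed.

End invariant_blocks.

Section property_m_to_quotient.
Context {R : realType} {s : scalars}.
Local Notation K := (scalar_field R s).
Variable E : nat -> completeNormedModType K.
Hypothesis Efin : forall n, finite_dimensional (E n).
Hypothesis Edense : banach_mazur_dense E.
Variables (p : \bar R) (p1 : (1 < p)%E) (X : completeNormedModType K).
Hypothesis Xsep : separable X.
Hypothesis Xl1 : ~ contains_copy X ell1.

Lemma property_m_quotients : property_m p X -> forall e : R, 0 < e ->
  exists Z : closed_subspace (lp_sum E (ltW p1)), (banach_mazur X (quotient_type Z) < (1 + e)%:E)%E.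
Proof.
move=> mX e e0.
pose Xr := realify X.
have Xc : rcomplete X by exact: cauchy_rnorm.
have mV := property_m_asymptotic mX.
have wcV : weak_cauchy_subseqs Xr by move=> u M uM; exact: (rosenthal uM Xc Xl1).
have mdV := dual_asymptotics p1 mV wcV.
have [v0 v0_dense] := separable_seq Xsep.
pose v := jay_closed_seq v0.
have v_dense (x : Xr) (t : R) : 0 < t -> exists i, `|x - v i| <= t.
  by move=> t0; have [i xi] := v0_dense x t t0; exists i.*2; rewrite /v /jay_closed_seq odd_double doubleK.
have [d0 d0_dense] := dual_separable p1 v_dense mdV.
have [d [d_even d_odd]] := jay_dual_seq d0.
have d_dense (f : dual Xr) : `|f| = 1 -> forall t : R, 0 < t -> exists i, `|f - d i| <= t.
  by move=> f1 t t0; have [i fi] := d0_dense f f1 t t0; exists i.*2; rewrite d_even.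
(* The exponent 7 collects, with C = 1 + t, a factor C^5 from norming by blocks, C from covering the
   blocks by spaces E n, and C from the norm of U. *)
have [t [t0 t1 te]] := expr1D_small 7 e0.
have C1 : 1 < 1 + t by rewrite ltrDl.
have [n [m [w [w0 Bsum Bnorm]]]] := blocks_existence p1 v_dense d_dense mV mdV C1.
have /boolp.choice[Z HZ] : forall i, exists Z : closed_subspace X,
    (forall x, x \in cs_pred Z <-> span v (n i).*2 x /\ common_ker d (m i).*2 x) /\
    finite_dimensional (subspace_type Z).
  by move=> i; exact: (block_subspace v0 d_even d_odd).
have lin i : linear (fun x : subspace_type (Z i) => val x) by [].
pose J i : {linear subspace_type (Z i) -> X} := HB.pack (fun x : subspace_type (Z i) => val x)
  (GRing.isLinear.Build _ _ _ _ _ (lin i)).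
have JC L (g : forall i, subspace_type (Z i)) :
    w * rnorm (\sum_(i < L) J i (g i)) <= (1 + t) * lps p L (fun i => rnorm (g i)).
  by apply: (Bsum L (fun i => val (g i))) => i; apply/(HZ i).1; exact: valP.
have C0 : 0 <= 1 + t := addr_ge0 ler01 (ltW t0).
have [U [Uc Ul]] := blocks_operator Efin Edense (ltW p1) Xc (fun i => (HZ i).2) w0 C0 t0 JC.
have k0 : 0 <= (1 + t) ^+ 6 by exact: exprn_ge0.
have app := @approximately_onto R s _ X U ((1 + t) ^+ 6) k0 _.
have [|Z' HZ'] := kernel_quotient k0 C0 Uc.
  apply: (exactly_onto k0 C0 _ Uc); last apply: app.
    by apply: lp_sum_complete => i; exact: cauchy_rnorm.
  move=> f c c0; have [L [g [gB g1 fg]]] := Bnorm f c c0.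
  pose gZ i : subspace_type (Z i) := exist _ (g i) (((HZ i).1 _).2 (gB i)).
  have [y [yE yn]] := Ul L gZ.
  have y1 : rnorm y <= 1 + t by apply: (le_trans yn); rewrite -[leRHS]mulr1; exact: ler_wpM2l C0 _ _ g1.
  have C2 : 0 < 1 + t := addr_gt0 ltr01 t0.
  exists (of_real (1 + t)^-1 *: y); split.
    by rewrite rnormZE rnorm_of_real gtr0_norm ?invr_gt0// mulrC ler_pdivrMr// mul1r.
  have fU : f (U (of_real (1 + t)^-1 *: y)) = (1 + t)^-1 * (w * f (\sum_(i < L) g i)).
    rewrite linearZ; apply: (etrans (dappZ f _ (U y))); congr (_ * _).
    by rewrite yE; exact: dappZ.
  apply: (le_trans fg); rewrite lerD2r fU.
  by rewrite [_ ^+ 6]exprSr -[leRHS]mulrA (mulrA (1 + t)) mulfV ?gt_eqF// mul1r.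
by exists Z'; apply: le_lt_trans HZ' _; rewrite lte_fin -exprSr.
Qed.

End property_m_to_quotient.

Theorem theorem4p2 (R : realType) (s : scalars)
    (E : nat -> completeNormedModType (scalar_field R s))
    (Efin : forall n, finite_dimensional (E n))
    (Edense : banach_mazur_dense E)
    (p : \bar R) (p1 : (1 < p)%E)
    (X : completeNormedModType (scalar_field R s))
    (Xsep : separable X) (Xl1 : ~ contains_copy X ell1) :
  property_m p X <->
  forall e : R, 0 < e ->
    exists Z : closed_subspace (lp_sum E (ltW p1)),
      (banach_mazur X (quotient_type Z) < (1 + e)%:E)%E.
Proof.
by split; [exact: property_m_quotients|exact: quotients_property_m].
Qed.
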